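(* The following hold for the class $\mathcal{S}^*_{SG}$ (with $e$ Euler's number): (i) $R_{\mathcal{S}^*_{SG}}(\mathcal{T}_1)=\dfrac{3+7e-\sqrt{41+42e+17e^2}}{8+8e}$ $(\approx 0.177213)$; (ii) $R_{\mathcal{S}^*_{SG}}(\mathcal{T}_2)=\dfrac{1+3e-\sqrt{5+6e+5e^2}}{2+2e}$ $(\approx 0.204712)$; (iii) $R_{\mathcal{S}^*_{SG}}(\mathcal{T}_3)=\sqrt{\dfrac{1-2e+e^2}{8+20e+8e^2}}$ $(\approx 0.1559)$.
   Context: Let $\mathbb{D}=\{z\in\mathbb{C}:|z|<1\}$ and let $\mathcal{A}$ be the class of analytic functions $f:\mathbb{D}\to\mathbb{C}$ with $f(0)=0$, $f'(0)=1$. For analytic $f,g$ on $\mathbb{D}$, $f\prec g$ ($f$ is subordinate to $g$) means $f=g\circ w$ for some analytic $w:\mathbb{D}\to\mathbb{D}$ with $w(0)=0$. Square roots are principal branches, and quotients such as $f/g$, $g/(zp)$, $zf'/f$ are understood with removable singularities at $0$ filled in. Define $\mathcal{T}_1$: all $f\in\mathcal{A}$ such that $f/g\prec e^z$ and $g/(zp)\prec e^z$ for some $g\in\mathcal{A}$ and some $p\prec\sqrt{1+z}$; $\mathcal{T}_2$: all $f\in\mathcal{A}$ such that $f/g\prec \sqrt{1+z}$ and $g/(zp)\prec \sqrt{1+z}$ for some $g\in\mathcal{A}$ and some $p\prec e^z$; $\mathcal{T}_3$: all $f\in\mathcal{A}$ such that $f/g\prec z+\sqrt{1+z^2}$ and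 $g/(zp)\prec z+\sqrt{1+z^2}$ for some $g\in\mathcal{A}$ and some $p\prec z+\sqrt{1+z^2}$. $\mathcal{S}^*_{SG}$ is the class of $f\in\mathcal{A}$ with $zf'(z)/f(z)\prec \dfrac{2}{1+e^{-z}}$; this function maps $\mathbb{D}$ onto $\{w:|\log(w/(2-w))|<1\}$. For classes $\mathcal{G},\mathcal{M}\subset\mathcal{A}$, the $\mathcal{G}$-radius $R_{\mathcal{G}}(\mathcal{M})$ is $\inf\{\rho_f: f\in\mathcal{M}\}$, where $\rho_f$ is the largest number in $(0,1]$ such that for every $0<r\le\rho_f$ the function $f$ has the property defining $\mathcal{G}$ in the disk $|z|<r$, i.e. $z\mapsto f(rz)/r$ belongs to $\mathcal{G}$. *)

(* Defs.v *)
From Stdlib Require Import Reals.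
From Coquelicot Require Import Coquelicot.

Local Open Scope C_scope.

Definition Cexp (z : C) : C := (exp (Re z) * cos (Im z), exp (Re z) * sin (Im z))%R.

(* Principal branch: nonnegative real part, and imaginary part with the sign
   of [Im z] (square roots of negative reals lie on the positive imaginary axis). *)
Definition Csqrt (z : C) : C :=
  let s := sqrt ((Cmod z - Re z) / 2)%R in
  (sqrt ((Cmod z + Re z) / 2)%R, if Rle_dec 0 (Im z) then s else (- s)%R).

Definition in_disk (z : C) : Prop := (Cmod z < 1)%R.

(* Functions on the disk are total functions [C -> C] of which only the values
   on the disk matter. *)
Definition analytic_on_disk (f : C -> C) : Prop :=
  forall z : C, in_disk z -> ex_derive f z.

Definition class_A (f : C -> C) : Prop :=
  analytic_on_disk f /\ f 0 = 0 /\ is_derive f (RtoC 0) (RtoC 1).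

Definition subordinate (f g : C -> C) : Prop :=
  analytic_on_disk f /\ analytic_on_disk g /\
  exists w : C -> C,
    analytic_on_disk w /\
    (forall z, in_disk z -> in_disk (w z)) /\
    w 0 = 0 /\
    (forall z, in_disk z -> f z = g (w z)).

(* [h] is [num / den] on the disk with the removable singularity at 0 filled in:
   no other zero of [den] is allowed, and [h 0] is forced by the continuity of [h]. *)
Definition is_filled_quotient (num den h : C -> C) : Prop :=
  analytic_on_disk h /\
  forall z, in_disk z -> z <> 0 -> den z <> 0 /\ h z = num z / den z.

Definition quotient_subordinate (num den phi : C -> C) : Prop :=
  exists h : C -> C, is_filled_quotient num den h /\ subordinate h phi.

Definition ratio_class (phi psi : C -> C) (f : C -> C) : Prop :=
  class_A f /\
  exists g p : C -> C,
    class_A g /\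
    subordinate p psi /\
    quotient_subordinate f g phi /\
    quotient_subordinate g (fun z => z * p z) phi.

Definition sqrt_1_plus (z : C) : C := Csqrt (1 + z).
Definition crescent (z : C) : C := z + Csqrt (1 + z * z).
Definition sigmoid (z : C) : C := 2 / (1 + Cexp (- z)).

Definition T1 : (C -> C) -> Prop := ratio_class Cexp sqrt_1_plus.
Definition T2 : (C -> C) -> Prop := ratio_class sqrt_1_plus Cexp.
Definition T3 : (C -> C) -> Prop := ratio_class crescent crescent.

Definition S_SG (f : C -> C) : Prop :=
  class_A f /\ quotient_subordinate (fun z => z * C_derive f z) f sigmoid.

Definition dilate (r : R) (f : C -> C) (z : C) : C := f (r * z) / r.

Definition has_property_upto (G : (C -> C) -> Prop) (f : C -> C) (rho : R) : Prop :=
  (0 < rho <= 1)%R /\ forall r : R, (0 < r <= rho)%R -> G (dilate r f).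

Definition is_rho (G : (C -> C) -> Prop) (f : C -> C) (rho : R) : Prop :=
  has_property_upto G f rho /\
  forall rho' : R, has_property_upto G f rho' -> (rho' <= rho)%R.

(* [x] is the [G]-radius of [M]; that [rho_f] exists for every [f] in [M] is
   part of the assertion. *)
Definition is_radius (G M : (C -> C) -> Prop) (x : R) : Prop :=
  (forall f, M f -> exists rho, is_rho G f rho) /\
  is_glb_Rbar (fun rho => exists f, M f /\ is_rho G f rho) (Finite x).

(* Main.v *)
(* Writing f = z h1 h2 p with h1 = phi(w1), h2 = phi(w2), p = psi(w3) for Schwarz functions w1, w2, w3
   gives z f'/f = 1 + u with u = z (w1' L(w1) + w2' L(w2) + w3' M(w3)), where L and M are the logarithmic
   derivatives of phi and psi.  By Dieudonné's lemma |z w' - w| <= (r^2 - |w|^2) / (1 - r^2) for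
   |z| = r, which bounds each summand.  On the other hand 1 + u lies in the range of the sigmoid iff
   |2 artanh u| < 1, and this holds when |u| < delta = tanh(1/2) = (e - 1)/(e + 1).  The summands have
   modulus at most r (exponential, for r <= sqrt 2 - 1) and r / (2 (1 - r)) (square root), which settles
   the first two classes.  For the crescent, a single summand can have modulus r / sqrt(1 - r^2) in
   the imaginary direction, too large for the disk of radius delta when r is the claimed radius;
   but the region |2 artanh u| < 1 also contains the ellipse x^2 + 0.9 y^2 < delta^2, and in the norm
   sqrt(x^2 + 0.9 y^2) each summand is at most r / sqrt(1 + r^2), as on the real axis.
   All three bounds are attained at z = -r when w1 = w2 = w3 = z.

   The required function theory (a holomorphic function has a holomorphic derivative, Schwarz's lemma
   and the Schwarz-Pick inequality) follows from Goursat's lemma and Cauchy's formula on circles. *)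

(* The summands are bounded one by one, so the target region has to be replaced by the ball of a
   norm, and an ellipse is the simplest choice beyond a disk. For x^2 + c y^2 two requirements limit
   c. At u = iy the region |2 artanh u| < 1 ends at y = tan(1/2), which forces c >= (delta /
   tan(1/2))^2, about 0.72. A crescent summand of modulus r / sqrt(1 - r^2) in the imaginary
   direction stays below r / sqrt(1 + r^2) only if c <= (1 - r^2) / (1 + r^2), about 0.95 at the
   claimed radius. The value 0.9 lies between and leaves room for crude polynomial estimates.
   Subordination to the sigmoid reduces to a pointwise condition: v is recovered from w = sigmoid v
   as log(w / (2 - w)), so values in the range already yield an analytic Schwarz function. The
   condition concerns open disks, hence the supremum of the admissible radii is itself admissible,
   and a radius larger than R0 would bring the point -R0 into the disk, where z f'/f of the extremal
   function is the boundary value 1 - delta. *)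
From Stdlib Require Import Reals Lra ssreflect ClassicalEpsilon FunctionalExtensionality.
From Coquelicot Require Import Coquelicot.
Require Import Defs.

Local Open Scope C_scope.
Notation cmod z := (Cmod z%C) (only parsing).

(** * Differentiation and integration of complex-valued functions *)

(** Written with increments and [Cmod] only, allowing h = 0 and free of division; it favours no
    normed-module structure on [C] and so bridges the different ones. *)
Definition cderiv (f : C -> C) (z l : C) : Prop :=
  forall eps : R, (0 < eps)%R -> exists d : R, (0 < d)%R /\
  forall h : C, (Cmod h < d)%R -> (cmod (f (z + h) - f z - h * l) <= eps * Cmod h)%R.

Definition rderiv (f : R -> C) (t : R) (l : C) : Prop :=
  forall eps : R, (0 < eps)%R -> exists d : R, (0 < d)%R /\
  forall h : R, (Rabs h < d)%R -> (cmod (f (t + h)%R - f t - h * l) <= eps * Rabs h)%R.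

Lemma cderiv_is_derive f z l : cderiv f z l <-> is_derive f z l.
Proof.
split.
- move=> H; split; first exact: is_linear_scal_l.
  move=> x Hx eps.
  have <- : z = x by apply: is_filter_lim_locally_unique Hx.
  have [d [d0 Hd]] := H eps (cond_pos eps).
  exists (mkposreal d d0); refine (fun (y : C) Hy => _).
  have := Hd (y - z) Hy.
  by replace (z + (y - z)) with y by ring.
- move=> [_ H] eps e0.
  have [d Hd] := H z (fun P HP => HP) (mkposreal eps e0).
  exists d; split; first exact: cond_pos.
  move=> h Hh.
  have Hb : @ball (AbsRing_UniformSpace C_AbsRing) z d (z + h).
    rewrite /ball /= /AbsRing_ball.
    change (cmod (z + h - z) < d)%R; by replace (z + h - z) with h by ring.
  have := Hd _ Hb.
  change (cmod (f (z + h) - f z - (z + h - z) * l) <= eps * cmod (z + h - z) -> 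
   cmod (f (z + h) - f z - h * l) <= eps * Cmod h)%R.
  by replace (z + h - z) with h by ring.
Qed.

(* Coquelicot equips [C] with two normed-module structures over itself, with different
   uniform structures: the product one, used in [analytic_on_disk], and that of an
   absolute ring, for which the product and chain rules are stated. *)
Lemma cderiv_is_derive_ring f z l : cderiv f z l <-> is_derive (V := AbsRing_NormedModule C_AbsRing) f z l.
Proof.
split.
- move=> H; split; first exact: is_linear_scal_l.
  move=> x Hx eps.
  have <- : z = x by apply: is_filter_lim_locally_unique Hx.
  have [d [d0 Hd]] := H eps (cond_pos eps).
  exists (mkposreal d d0); refine (fun (y : C) Hy => _).
  have := Hd (y - z) Hy.
  by replace (z + (y - z)) with y by ring.
- move=> [_ H] eps e0.
  have [d Hd] := H z (fun P HP => HP) (mkposreal eps e0).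
  exists d; split; first exact: cond_pos.
  move=> h Hh.
  have Hb : @ball (AbsRing_UniformSpace C_AbsRing) z d (z + h).
    rewrite /ball /= /AbsRing_ball.
    change (cmod (z + h - z) < d)%R; by replace (z + h - z) with h by ring.
  have := Hd _ Hb.
  change (cmod (f (z + h) - f z - (z + h - z) * l) <= eps * cmod (z + h - z) -> 
   cmod (f (z + h) - f z - h * l) <= eps * Cmod h)%R.
  by replace (z + h - z) with h by ring.
Qed.

Lemma rderiv_is_derive f t l : rderiv f t l <-> is_derive (V := C_R_NormedModule) f t l.
Proof.
have E (h : R) (x : C) : scal (V := C_R_NormedModule) h x = h * x.
  rewrite /scal /= /prod_scal /scal /= /mult /=; case: x => a b; rewrite /Cmult /=.
  f_equal; ring.
split.
- move=> H; split; first exact: is_linear_scal_l.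
  move=> x Hx eps.
  have <- : t = x by apply: is_filter_lim_locally_unique Hx.
  have [d [d0 Hd]] := H eps (cond_pos eps).
  exists (mkposreal d d0); refine (fun (y : R) Hy => _).
  have := Hd (y - t)%R Hy.
  replace (t + (y - t))%R with y by ring.
  by rewrite Cmod_norm -E.
- move=> [_ H] eps e0.
  have [d Hd] := H t (fun P HP => HP) (mkposreal eps e0).
  exists d; split; first exact: cond_pos.
  move=> h Hh.
  have Hb : ball t d (t + h)%R.
    rewrite /ball /= /AbsRing_ball /abs /= /minus /plus /opp /=.
    by replace (t + h + - t)%R with h by ring.
  have := Hd _ Hb.
  rewrite -Cmod_norm E.
  change (cmod (f (t + h)%R - f t - (t + h - t)%R * l) <= eps * Rabs (t + h - t) -> 
   cmod (f (t + h)%R - f t - h * l) <= eps * Rabs h)%R.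
  by replace (t + h - t)%R with h by ring.
Qed.

Definition C_continuous (f : C -> C) (z : C) : Prop :=
  forall eps : R, (0 < eps)%R -> exists d : R, (0 < d)%R /\
  forall h : C, (Cmod h < d)%R -> (cmod (f (z + h) - f z) < eps)%R.

Lemma cderiv_cont f z l : cderiv f z l -> C_continuous f z.
Proof.
move=> H eps e0.
have [d [d0 Hd]] := H 1%R Rlt_0_1.
have Hl := Cmod_ge_0 l.
exists (Rmin d (eps / (2 + Cmod l))); split.
  apply: Rmin_glb_lt => //; apply: Rdiv_lt_0_compat => //; lra.
move=> h Hh.
have Hh1 : (Cmod h < d)%R by apply: Rlt_le_trans Hh (Rmin_l _ _).
have Hh2 : (Cmod h < eps / (2 + Cmod l))%R by apply: Rlt_le_trans Hh (Rmin_r _ _).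
replace (f (z + h) - f z) with (f (z + h) - f z - h * l + h * l) by ring.
apply: Rle_lt_trans (Cmod_triangle _ _) _.
rewrite Cmod_mult.
have := Hd h Hh1.
have Hh3 : (Cmod h * (2 + Cmod l) < eps)%R.
  apply: (Rmult_lt_reg_r (/ (2 + Cmod l))); first by apply: Rinv_0_lt_compat; lra.
  rewrite Rmult_assoc Rinv_r; last lra. by rewrite Rmult_1_r.
have := Cmod_ge_0 h; nra.
Qed.

Lemma C_continuous_continuous f z : C_continuous f z <-> continuous (T := C_UniformSpace) (U := C_UniformSpace) f z.
Proof.
split.
- move=> H; apply/filterlim_locally => eps.
  have [d [d0 Hd]] := H eps (cond_pos eps).
  (* Balls of the product structure are squares; passing between them and disks in [Cmod] costs a
     factor sqrt 2. *)
  have s2 : (0 < sqrt 2)%R by apply: sqrt_lt_R0; lra.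
  have d2 : (0 < d / sqrt 2)%R by apply: Rdiv_lt_0_compat.
  exists (mkposreal _ d2); refine (fun (y : C) Hy => _).
  apply: C_NormedModule_mixin_compat1.
  have := C_NormedModule_mixin_compat2 _ _ _ Hy => /= Hy'.
  have := Hd (y - z); replace (z + (y - z)) with y by ring; apply.
  apply: Rlt_le_trans Hy' _; right; field; lra.
- move=> /filterlim_locally H eps e0.
  have s2 : (0 < sqrt 2)%R by apply: sqrt_lt_R0; lra.
  have d2 : (0 < eps / sqrt 2)%R by apply: Rdiv_lt_0_compat.
  have [d Hd] := H (mkposreal _ d2).
  exists d; split; first exact: cond_pos.
  move=> h Hh.
  have Hb : ball z d (z + h).
    apply: C_NormedModule_mixin_compat1.
    change (cmod (z + h - z) < d)%R; by replace (z + h - z) with h by ring.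
  have := C_NormedModule_mixin_compat2 _ _ _ (Hd _ Hb) => /= Hy'.
  apply: Rlt_le_trans Hy' _; right; field; lra.
Qed.

Lemma cderiv_eq f z a b : cderiv f z a -> a = b -> cderiv f z b.
Proof. by move=> H <-. Qed.
Lemma cderiv_const c z : cderiv (fun _ => c) z 0.
Proof. apply/cderiv_is_derive. exact: is_derive_const. Qed.
Lemma cderiv_id z : cderiv (fun x => x) z 1.
Proof.
move=> eps e0; exists 1%R; split; first lra.
move=> h _; replace (z + h - z - h * 1) with (RtoC 0) by ring.
rewrite Cmod_0; have := Cmod_ge_0 h; nra.
Qed.
Lemma cderiv_plus f g z a b : cderiv f z a -> cderiv g z b -> cderiv (fun x => f x + g x) z (a + b).
Proof. move=> /cderiv_is_derive Hf /cderiv_is_derive Hg; apply/cderiv_is_derive. exact: is_derive_plus Hf Hg. Qed.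
Lemma cderiv_opp f z a : cderiv f z a -> cderiv (fun x => - f x) z (- a).
Proof. move=> /cderiv_is_derive Hf; apply/cderiv_is_derive. exact: is_derive_opp Hf. Qed.
Lemma cderiv_minus f g z a b : cderiv f z a -> cderiv g z b -> cderiv (fun x => f x - g x) z (a - b).
Proof. move=> Hf Hg; exact: cderiv_plus Hf (cderiv_opp _ _ _ Hg). Qed.
Lemma cderiv_mult f g z a b : cderiv f z a -> cderiv g z b -> cderiv (fun x => f x * g x) z (a * g z + f z * b).
Proof.
move=> /cderiv_is_derive_ring Hf /cderiv_is_derive_ring Hg; apply/cderiv_is_derive_ring.
exact (@is_derive_mult C_AbsRing f g z a b Hf Hg Cmult_comm).
Qed.
Lemma cderiv_comp f g z a b : cderiv f (g z) a -> cderiv g z b -> cderiv (fun x => f (g x)) z (b * a).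
Proof.
move=> /cderiv_is_derive Hf /cderiv_is_derive_ring Hg; apply/cderiv_is_derive.
exact: (is_derive_comp (K := C_AbsRing) f g z a b Hf Hg).
Qed.
Lemma cderiv_ext_loc f g z a d : (0 < d)%R ->
  (forall h, (Cmod h < d)%R -> f (z + h) = g (z + h)) -> cderiv f z a -> cderiv g z a.
Proof.
move=> d0 E H eps e0; have [d1 [d10 Hd]] := H eps e0.
exists (Rmin d d1); split; first exact: Rmin_glb_lt.
move=> h Hh; rewrite -E; last exact: Rlt_le_trans Hh (Rmin_l _ _).
have <- : f z = g z.
  have := E 0; rewrite Cmod_0; replace (z + 0) with z by ring; exact.
apply: Hd; exact: Rlt_le_trans Hh (Rmin_r _ _).
Qed.

Lemma cderiv_unique f z a b : cderiv f z a -> cderiv f z b -> a = b.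
Proof.
move=> /cderiv_is_derive /is_C_derive_unique <- /cderiv_is_derive /is_C_derive_unique <- //.
Qed.

Lemma cderiv_inv (z : C) : z <> 0 -> cderiv Cinv z (- (/ z * / z)).
Proof.
move=> z0 eps e0.
have m0 := proj1 (Cmod_gt_0 z) z0.
(* The first bound gives |z + h| >= |z| / 2, the second then |h| <= eps |z|^2 |z + h|, as the
   remainder h^2 / (z^2 (z + h)) requires. *)
exists (Rmin (Cmod z / 2) (eps * Cmod z ^ 3 / 2)); split.
  apply: Rmin_glb_lt; first lra.
  have := pow_lt _ 3 m0; nra.
move=> h Hh.
have H1 : (Cmod h < Cmod z / 2)%R by exact: Rlt_le_trans Hh (Rmin_l _ _).
have H2 : (Cmod h < eps * Cmod z ^ 3 / 2)%R by exact: Rlt_le_trans Hh (Rmin_r _ _).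
have H3 : (Cmod z / 2 <= Cmod (z + h))%R.
  have := Cmod_triangle (z + h) (- h); replace (z + h + - h) with z by ring.
  rewrite Cmod_opp; lra.
have zh0 : z + h <> 0 by apply/Cmod_gt_0; lra.
replace (/ (z + h) - / z - h * - (/ z * / z)) with (h * h / (z * z * (z + h))) by (field; done).
rewrite Cmod_div; last by apply: Cmult_neq_0 => //; apply: Cmult_neq_0.
rewrite !Cmod_mult.
apply: (Rmult_le_reg_r (Cmod z * Cmod z * cmod (z + h))); first by apply: Rmult_lt_0_compat; [nra|lra].
rewrite /Rdiv Rmult_assoc Rinv_l; last by apply: Rgt_not_eq; apply: Rmult_lt_0_compat; [nra|lra].
rewrite Rmult_1_r.
have := Cmod_ge_0 h => hp.
have : (Cmod z ^ 3 / 2 <= Cmod z * Cmod z * cmod (z + h))%R by nra.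
move=> H4.
have : (Cmod h <= eps * (Cmod z * Cmod z * cmod (z + h)))%R by nra.
nra.
Qed.

Lemma Cmod_le_Re_Im (z : C) : (Cmod z <= Rabs (Re z) + Rabs (Im z))%R.
Proof.
have -> : z = (RtoC (Re z) + Ci * RtoC (Im z)).
  by case: z => a b; rewrite /Ci /RtoC /Cmult /Cplus /=; f_equal; ring.
apply: Rle_trans (Cmod_triangle _ _) _.
rewrite Cmod_mult Cmod_Ci !Cmod_R /= .
rewrite !Rmult_0_l !Rmult_0_r !Rmult_1_l. right; f_equal; f_equal; ring.
Qed.

Lemma im_le_Cmod (z : C) : (Rabs (Im z) <= Cmod z)%R.
Proof. apply: Rle_trans (Rmax_Cmod z); exact: Rmax_r. Qed.

Lemma Rderive_eps (f : R -> R) t l : is_derive f t l <->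
  forall eps : R, (0 < eps)%R -> exists d : R, (0 < d)%R /\
  forall h : R, (Rabs h < d)%R -> (Rabs (f (t + h) - f t - h * l) <= eps * Rabs h)%R.
Proof.
split.
- move=> [_ H] eps e0.
  have [d Hd] := H t (fun P HP => HP) (mkposreal eps e0).
  exists d; split; first exact: cond_pos.
  move=> h Hh.
  have Hb : ball t d (t + h)%R.
    rewrite /ball /= /AbsRing_ball /abs /= /minus /plus /opp /=.
    by replace (t + h + - t)%R with h by ring.
  have := Hd _ Hb.
  change (Rabs (f (t + h)%R - f t - (t + h - t)%R * l) <= eps * Rabs (t + h - t) -> 
   Rabs (f (t + h)%R - f t - h * l) <= eps * Rabs h)%R.
  by replace (t + h - t)%R with h by ring.
- move=> H; split; first exact: is_linear_scal_l.
  move=> x Hx eps.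
  have <- : t = x by apply: is_filter_lim_locally_unique Hx.
  have [d [d0 Hd]] := H eps (cond_pos eps).
  exists (mkposreal d d0); refine (fun (y : R) Hy => _).
  have := Hd (y - t)%R Hy.
  by replace (t + (y - t))%R with y by ring.
Qed.

Lemma rderiv_pair (f : R -> C) t l :
  is_derive (fun s => Re (f s)) t (Re l) -> is_derive (fun s => Im (f s)) t (Im l) -> rderiv f t l.
Proof.
move=> /Rderive_eps H1 /Rderive_eps H2 eps e0.
have e2 : (0 < eps / 2)%R by lra.
have [d1 [d10 Hd1]] := H1 _ e2. have [d2 [d20 Hd2]] := H2 _ e2.
exists (Rmin d1 d2); split; first exact: Rmin_glb_lt.
move=> h Hh.
have := Hd1 h (Rlt_le_trans _ _ _ Hh (Rmin_l _ _)).
have := Hd2 h (Rlt_le_trans _ _ _ Hh (Rmin_r _ _)).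
move: (Cmod_le_Re_Im (f (t + h)%R - f t - h * l)).
have -> : Re (f (t + h)%R - f t - h * l) = (Re (f (t + h)) - Re (f t) - h * Re l)%R.
  rewrite /Re /=; ring.
have -> : Im (f (t + h)%R - f t - h * l) = (Im (f (t + h)) - Im (f t) - h * Im l)%R.
  rewrite /Im /=; ring.
lra.
Qed.

Lemma rderiv_Re (f : R -> C) t l : rderiv f t l -> is_derive (fun s => Re (f s)) t (Re l).
Proof.
move=> H; apply/Rderive_eps => eps e0; have [d [d0 Hd]] := H eps e0.
exists d; split=> // h /Hd; apply: Rle_trans.
have <- : Re (f (t + h)%R - f t - h * l) = (Re (f (t + h)) - Re (f t) - h * Re l)%R.
  rewrite /Re /=; ring.
exact: re_le_Cmod.
Qed.
Lemma rderiv_Im (f : R -> C) t l : rderiv f t l -> is_derive (fun s => Im (f s)) t (Im l).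
Proof.
move=> H; apply/Rderive_eps => eps e0; have [d [d0 Hd]] := H eps e0.
exists d; split=> // h /Hd; apply: Rle_trans.
have <- : Im (f (t + h)%R - f t - h * l) = (Im (f (t + h)) - Im (f t) - h * Im l)%R.
  rewrite /Im /=; ring.
exact: im_le_Cmod.
Qed.

(** With k the increment of g, the error splits as (f(g t + k) - f(g t) - k a) + (k - h b) a, and
    each part gets eps / 2. The minimum with 1 in the tolerance for g ensures |k| <= (|b| + 1)
    |h|. *)
Lemma rderiv_comp (f : C -> C) (g : R -> C) t a b : cderiv f (g t) a -> rderiv g t b ->
  rderiv (fun s => f (g s)) t (b * a).
Proof.
move=> Hf Hg eps e0.
have [ap bp] := (Cmod_ge_0 a, Cmod_ge_0 b).
have e1 : (0 < eps / (2 * (Cmod b + 1)))%R by apply: Rdiv_lt_0_compat; lra.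
have e2 : (0 < Rmin 1 (eps / (2 * (Cmod a + 1))))%R.
  apply: Rmin_glb_lt; first lra. by apply: Rdiv_lt_0_compat; lra.
have [d1 [d10 Hd1]] := Hf _ e1.
have [d2 [d20 Hd2]] := Hg _ e2.
have d3 : (0 < d1 / (Cmod b + 1))%R by apply: Rdiv_lt_0_compat; lra.
exists (Rmin d2 (d1 / (Cmod b + 1))); split; first exact: Rmin_glb_lt.
move=> h Hh.
have h1 := Rlt_le_trans _ _ _ Hh (Rmin_l _ _).
have h2 := Rlt_le_trans _ _ _ Hh (Rmin_r _ _).
have := Hd2 h h1; set k := (g (t + h)%R - g t) => Hk.
have m1 := Rmin_l 1 (eps / (2 * (Cmod a + 1))).
have m2 := Rmin_r 1 (eps / (2 * (Cmod a + 1))).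
have hp := Rabs_pos h.
have kb : (Cmod k <= (Cmod b + 1) * Rabs h)%R.
  have := Cmod_triangle (k - h * b) (h * b); replace (k - h * b + h * b) with k by ring.
  rewrite Cmod_mult Cmod_R; nra.
have kd : (Cmod k < d1)%R.
  apply: Rle_lt_trans kb _.
  apply: (Rmult_lt_reg_r (/ (Cmod b + 1))); first by apply: Rinv_0_lt_compat; lra.
  replace ((Cmod b + 1) * Rabs h * / (Cmod b + 1))%R with (Rabs h) by (field; lra). exact: h2.
have := Hd1 k kd. replace (g t + k) with (g (t + h)%R) by (rewrite /k; ring).
move=> Hfk.
replace (f (g (t + h)%R) - f (g t) - h * (b * a)) with
  ((f (g (t + h)%R) - f (g t) - k * a) + (k - h * b) * a) by ring.
apply: Rle_trans (Cmod_triangle _ _) _; rewrite Cmod_mult.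
have E1 : (eps / (2 * (Cmod b + 1)) * ((Cmod b + 1) * Rabs h) = eps / 2 * Rabs h)%R by field; lra.
have E2 : (eps / (2 * (Cmod a + 1)) * (Cmod a + 1) = eps / 2)%R by field; lra.
have S1 : (eps / (2 * (Cmod b + 1)) * Cmod k <= eps / 2 * Rabs h)%R by rewrite -E1; apply: Rmult_le_compat_l; lra.
have S2 : (cmod (k - h * b) <= eps / (2 * (Cmod a + 1)) * Rabs h)%R.
  apply: Rle_trans Hk _; apply: Rmult_le_compat_r; lra.
have S3 : (cmod (k - h * b) * Cmod a <= eps / (2 * (Cmod a + 1)) * (Cmod a + 1) * Rabs h)%R.
  have := Cmod_ge_0 (k - h * b)%C; set e3 := (eps / (2 * (Cmod a + 1)))%R in S2 *; nra.
rewrite E2 in S3; lra.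
Qed.

Lemma rderiv_ext (f g : R -> C) t l : (forall s, f s = g s) -> rderiv f t l -> rderiv g t l.
Proof. by move=> E H eps e0; have [d [d0 Hd]] := H eps e0; exists d; split=> // h; rewrite -!E; exact: Hd. Qed.

Section Cont.
Context {T : UniformSpace}.

Lemma cont_pair (f : T -> C) x : continuous (fun s => Re (f s)) x -> continuous (fun s => Im (f s)) x ->
  continuous (U := C_UniformSpace) f x.
Proof.
move=> H1 H2; apply: (proj2 (filterlim_locally (U := C_UniformSpace) f (f x))) => eps.
move: H1 => /filterlim_locally H1; move: H2 => /filterlim_locally H2.
refine (filter_imp _ _ _ (filter_and _ _ (H1 eps) (H2 eps))) => y [h1 h2]; split; [exact: h1|exact: h2].
Qed.
Lemma cont_Re (f : T -> C) x : continuous (U := C_UniformSpace) f x -> continuous (fun s => Re (f s)) x.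
Proof.
move=> /(filterlim_locally (U := C_UniformSpace) f (f x)) H; apply/filterlim_locally => eps.
refine (filter_imp _ _ _ (H eps)) => y [h1 _]; exact: h1.
Qed.
Lemma cont_Im (f : T -> C) x : continuous (U := C_UniformSpace) f x -> continuous (fun s => Im (f s)) x.
Proof.
move=> /(filterlim_locally (U := C_UniformSpace) f (f x)) H; apply/filterlim_locally => eps.
refine (filter_imp _ _ _ (H eps)) => y [_ h1]; exact: h1.
Qed.
Lemma cont_const (c : C) x : continuous (T := T) (U := C_UniformSpace) (fun _ => c) x.
Proof. exact: continuous_const. Qed.
Lemma cont_plus (f g : T -> C) x : continuous (U := C_UniformSpace) f x -> continuous (U := C_UniformSpace) g x ->
  continuous (U := C_UniformSpace) (fun s => f s + g s) x.
Proof.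
move=> Hf Hg; apply: cont_pair.
- exact: (continuous_plus (fun s => Re (f s)) (fun s => Re (g s)) x (cont_Re _ _ Hf) (cont_Re _ _ Hg)).
- exact: (continuous_plus (fun s => Im (f s)) (fun s => Im (g s)) x (cont_Im _ _ Hf) (cont_Im _ _ Hg)).
Qed.
Lemma cont_mult (f g : T -> C) x : continuous (U := C_UniformSpace) f x -> continuous (U := C_UniformSpace) g x ->
  continuous (U := C_UniformSpace) (fun s => f s * g s) x.
Proof.
move=> Hf Hg.
have [a b] := (cont_Re _ _ Hf, cont_Im _ _ Hf).
have [c d] := (cont_Re _ _ Hg, cont_Im _ _ Hg).
apply cont_pair.
- exact: (continuous_minus _ _ x (continuous_mult _ _ x a c) (continuous_mult _ _ x b d)).
- exact: (continuous_plus _ _ x (continuous_mult _ _ x a d) (continuous_mult _ _ x b c)).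
Qed.
Lemma cont_comp (f : C -> C) (g : T -> C) x : C_continuous f (g x) -> continuous (U := C_UniformSpace) g x ->
  continuous (U := C_UniformSpace) (fun s => f (g s)) x.
Proof. move=> /C_continuous_continuous Hf Hg; exact: continuous_comp Hg Hf. Qed.
Lemma cont_RtoC (f : T -> R) x : continuous f x -> continuous (U := C_UniformSpace) (fun s => RtoC (f s)) x.
Proof. move=> H; apply: cont_pair => //=; exact: continuous_const. Qed.
End Cont.

(** * Integrals of complex-valued functions over a real interval *)

Ltac cring := match goal with |- @eq _ ?a ?b => change (@eq C a b) end; ring.

Definition is_CInt (f : R -> C) (a b : R) (l : C) : Prop := is_RInt (V := C_R_NormedModule) f a b l.
Definition CInt (f : R -> C) (a b : R) : C := RInt (V := C_R_CompleteNormedModule) f a b.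
Notation R_C_continuous f t := (continuous (T := R_UniformSpace) (U := C_UniformSpace) f t).

Lemma scal_C (h : R) (x : C) : scal (V := C_R_NormedModule) h x = h * x.
Proof.
rewrite /scal /= /prod_scal /scal /= /mult /=; case: x => a b; rewrite /Cmult /=.
f_equal; ring.
Qed.

Lemma CInt_correct f a b : (a <= b)%R -> (forall t, (a <= t <= b)%R -> R_C_continuous f t) -> is_CInt f a b (CInt f a b).
Proof.
move=> ab H; apply: (RInt_correct (V := C_R_CompleteNormedModule)).
apply: (ex_RInt_continuous (V := C_R_CompleteNormedModule)) => z.
rewrite Rmin_left // Rmax_right //; exact: H.
Qed.
Lemma CInt_unique f a b l : is_CInt f a b l -> CInt f a b = l.
Proof. exact: (is_RInt_unique (V := C_R_CompleteNormedModule)). Qed.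
Lemma is_CInt_unique f a b l m : is_CInt f a b l -> is_CInt f a b m -> l = m.
Proof. by move=> /CInt_unique <- /CInt_unique <-. Qed.
Lemma is_CInt_minus f g a b l m : is_CInt f a b l -> is_CInt g a b m -> is_CInt (fun t => f t - g t) a b (l - m).
Proof. move=> H1 H2; exact: (is_RInt_minus (V := C_R_NormedModule) f g a b l m H1 H2). Qed.
Lemma is_CInt_ext f g a b l : (forall t, f t = g t) -> is_CInt f a b l -> is_CInt g a b l.
Proof. move=> E; apply: is_RInt_ext => x _; exact: E. Qed.
(** The integral lives in [C] as a real vector space, where scalars are real; a complex factor is
    handled through real and imaginary parts. *)
Lemma is_CInt_scal (c : C) f a b l : is_CInt f a b l -> is_CInt (fun t => c * f t) a b (c * l).
Proof.
move=> H.
have H1 := is_RInt_fct_extend_fst (U := R_NormedModule) (V := R_NormedModule) f a b l H.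
have H2 := is_RInt_fct_extend_snd (U := R_NormedModule) (V := R_NormedModule) f a b l H.
apply: (is_RInt_fct_extend_pair (U := R_NormedModule) (V := R_NormedModule) (fun t => c * f t) a b (fst (c * l)) (snd (c * l))).
- exact: (is_RInt_minus _ _ _ _ _ _ (is_RInt_scal _ _ _ (fst c) _ H1) (is_RInt_scal _ _ _ (snd c) _ H2)).
- exact: (is_RInt_plus _ _ _ _ _ _ (is_RInt_scal _ _ _ (fst c) _ H2) (is_RInt_scal _ _ _ (snd c) _ H1)).
Qed.
Lemma is_CInt_FTC f g a b : (a <= b)%R -> (forall t, (a <= t <= b)%R -> rderiv f t (g t)) ->
  (forall t, (a <= t <= b)%R -> R_C_continuous g t) -> is_CInt g a b (f b - f a).
Proof.
move=> ab H1 H2.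
apply: (is_RInt_derive (V := C_R_CompleteNormedModule) f g a b) => x; rewrite Rmin_left // Rmax_right // => Hx.
- apply/rderiv_is_derive; exact: H1.
- exact: H2.
Qed.
Lemma is_CInt_bound f a b l M : (a <= b)%R -> (forall t, (a <= t <= b)%R -> (Cmod (f t) <= M)%R) ->
  is_CInt f a b l -> (Cmod l <= (b - a) * M)%R.
Proof.
move=> ab H Hl; rewrite Cmod_norm; apply: (norm_RInt_le_const (V := C_R_NormedModule) f a b l M) => // t Ht.
rewrite -Cmod_norm; exact: H.
Qed.
Lemma is_CInt_const a b (c : C) : is_CInt (fun _ => c) a b ((b - a)%R * c).
Proof. rewrite -scal_C. exact: is_RInt_const. Qed.

(** * Integrals along segments of the disk *)

Definition seg_int (f : C -> C) (a b : C) : C := CInt (fun t : R => (b - a) * f (a + t * (b - a))) 0 1.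

Lemma disk_convex (a b : C) (t : R) rho : (0 <= t <= 1)%R -> (Cmod a <= rho)%R -> (Cmod b <= rho)%R -> (cmod (a + t * (b - a)) <= rho)%R.
Proof.
move=> t01 Ha Hb.
replace (a + t * (b - a)) with ((1 - t)%R * a + t * b) by (rewrite RtoC_minus; ring).
apply: Rle_trans (Cmod_triangle _ _) _; rewrite !Cmod_mult !Cmod_R !Rabs_pos_eq; nra.
Qed.

Lemma in_disk_seg (a b : C) (t : R) : (0 <= t <= 1)%R -> in_disk a -> in_disk b -> in_disk (a + t * (b - a)).
Proof.
move=> t01 Ha Hb; apply: (Rle_lt_trans _ (Rmax (Cmod a) (Cmod b))); last exact: Rmax_lub_lt.
apply: disk_convex => //; [exact: Rmax_l|exact: Rmax_r].
Qed.

Lemma cont_affine (a b : C) (t : R) : R_C_continuous (fun s : R => a + s * b) t.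
Proof.
apply cont_plus; first exact: cont_const.
apply cont_mult; last exact: cont_const.
apply cont_RtoC; exact: continuous_id.
Qed.

Lemma rderiv_affine (a b : C) (t : R) : rderiv (fun s : R => a + s * b) t b.
Proof.
move=> eps e0; exists 1%R; split; first lra.
move=> h _; rewrite RtoC_plus; replace (a + (t + h) * b - (a + t * b) - h * b) with (RtoC 0) by ring.
rewrite Cmod_0; have := Rabs_pos h; nra.
Qed.

(** Numerals in [C] are embedded reals, which [ring] and [field] treat as atoms; as sums of 1 they
    become computable. *)
Lemma C2_eq : RtoC 2 = 1 + 1.
Proof. by rewrite -RtoC_plus. Qed.
Lemma C2_nz : RtoC 2 <> 0.
Proof. move=> /RtoC_inj; lra. Qed.
Lemma C1_plus_C1_nz : RtoC 1 + RtoC 1 <> RtoC 0.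
Proof. rewrite -C2_eq; exact: C2_nz. Qed.
Lemma Chalf : RtoC (/ 2) = / RtoC 2.
Proof. rewrite RtoC_inv //; lra. Qed.

Section Seg.
Variable f : C -> C.
Hypothesis fc : forall z, in_disk z -> C_continuous f z.

Lemma seg_cont (c a b : C) (t : R) : (0 <= t <= 1)%R -> in_disk a -> in_disk b ->
  R_C_continuous (fun t : R => c * f (a + t * (b - a))) t.
Proof.
move=> t01 Ha Hb; apply cont_mult; first exact: cont_const.
apply cont_comp; last exact: cont_affine.
apply: fc; exact: in_disk_seg.
Qed.

Lemma seg_correct a b : in_disk a -> in_disk b ->
  is_CInt (fun t : R => (b - a) * f (a + t * (b - a))) 0 1 (seg_int f a b).
Proof. move=> Ha Hb; apply: CInt_correct; first lra. by move=> t t01; apply: seg_cont. Qed.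

Lemma seg_rev a b : in_disk a -> in_disk b -> seg_int f b a = - seg_int f a b.
Proof.
move=> Ha Hb; apply: CInt_unique.
(* The bounds are written as the images of 0 and 1 under t -> 1 - t, the form that the affine change
   of variables expects. *)
have H : is_CInt (fun t : R => (b - a) * f (a + t * (b - a))) (-1 * 0 + 1) (-1 * 1 + 1) (- seg_int f a b).
  replace (-1 * 0 + 1)%R with 1%R by ring; replace (-1 * 1 + 1)%R with 0%R by ring.
  exact: (is_RInt_swap (V := C_R_NormedModule) _ _ _ _ (seg_correct a b Ha Hb)).
have := is_RInt_comp_lin (V := C_R_NormedModule) _ (-1) 1 0 1 _ H.
apply: is_CInt_ext => t; rewrite scal_C !RtoC_plus !RtoC_mult.
replace (a + (-1 * t + 1) * (b - a)) with (b + t * (a - b)); last by rewrite (RtoC_opp 1); ring.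
rewrite (RtoC_opp 1); ring.
Qed.

Lemma seg_mid a b : in_disk a -> in_disk b -> seg_int f a b = seg_int f a ((a + b) / 2) + seg_int f ((a + b) / 2) b.
Proof.
move=> Ha Hb.
set m := (a + b) / 2.
have C2 := C1_plus_C1_nz.
have Em : m = a + / 2 * (b - a) by rewrite /m C2_eq; field; done.
have Hm : in_disk m by rewrite Em -Chalf; apply: in_disk_seg => //; lra.
pose g := fun t : R => (b - a) * f (a + t * (b - a)).
have [l1 H1] : exists l, is_CInt g 0 (/2) l.
  exists (CInt g 0 (/2)); apply: CInt_correct; first lra. move=> t Ht; apply: seg_cont => //; lra.
have [l2 H2] : exists l, is_CInt g (/2) 1 l.
  exists (CInt g (/2) 1); apply: CInt_correct; first lra. move=> t Ht; apply: seg_cont => //; lra.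
have H := is_RInt_Chasles (V := C_R_NormedModule) _ _ _ _ _ _ H1 H2.
rewrite (is_CInt_unique _ _ _ _ _ (seg_correct a b Ha Hb) H).
change (plus l1 l2) with (l1 + l2).
f_equal; apply: eq_sym; apply: CInt_unique.
- have H1' : is_CInt g (/2 * 0 + 0) (/2 * 1 + 0) l1.
    by replace (/2 * 0 + 0)%R with 0%R by ring; replace (/2 * 1 + 0)%R with (/2)%R by ring.
  have := is_RInt_comp_lin (V := C_R_NormedModule) _ (/2) 0 0 1 _ H1'.
  apply: is_CInt_ext => t; rewrite scal_C /g !RtoC_plus !RtoC_mult.
  replace (a + (RtoC (/ 2) * t + 0) * (b - a)) with (a + t * (m - a)); last by rewrite /m Chalf C2_eq; field; done.
  rewrite /m Chalf C2_eq; field; done.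
- have H2' : is_CInt g (/2 * 0 + /2) (/2 * 1 + /2) l2.
    by replace (/2 * 0 + /2)%R with (/2)%R by field; replace (/2 * 1 + /2)%R with 1%R by field.
  have := is_RInt_comp_lin (V := C_R_NormedModule) _ (/2) (/2) 0 1 _ H2'.
  apply: is_CInt_ext => t; rewrite scal_C /g !RtoC_plus !RtoC_mult.
  replace (a + (RtoC (/ 2) * t + RtoC (/2)) * (b - a)) with (m + t * (b - m)); last by rewrite /m Chalf C2_eq; field; done.
  rewrite /m Chalf C2_eq; field; done.
Qed.

(** An affine function integrates over a segment to b - a times its value at the midpoint, so only
    the deviation from it has to be estimated. Goursat's lemma takes the tangent at a limit point,
    the construction of a primitive a constant (d = 0). *)
Lemma seg_affine_bound a b c d z0 E : in_disk a -> in_disk b ->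
  (forall t : R, (0 <= t <= 1)%R -> let p := a + t * (b - a) in (cmod (f p - (c + d * (p - z0))) <= E)%R) ->
  (cmod (seg_int f a b - ((b - a) * (c + d * ((a + b) / 2 - z0)))) <= E * cmod (b - a))%R.
Proof.
move=> Ha Hb H.
have C2 := C1_plus_C1_nz.
pose P t : C := a + t * (b - a).
have HP : is_CInt (fun t : R => (b - a) * (c + d * (P t - z0))) 0 1 ((b - a) * (c + d * ((a + b) / 2 - z0))).
  have Hc : forall t : R, R_C_continuous (fun t : R => (b - a) * (c + d * (P t - z0))) t.
    move=> t; apply: (continuous_ext (fun t : R => (b - a) * (c + d * (a - z0)) + t * ((b - a) * d * (b - a)))).
      move=> s; rewrite /P; cring. 
    exact: cont_affine.
  pose F (t : R) : C := t * ((b - a) * (c + d * (a - z0))) + t * t * ((b - a) * d * (b - a) / 2).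
  replace ((b - a) * (c + d * ((a + b) / 2 - z0))) with (F 1 - F 0); last by rewrite /F C2_eq; field.
  apply: is_CInt_FTC => //; first lra.
  move=> t _; apply: (rderiv_ext (fun t : R => (fun z => z * ((b - a) * (c + d * (a - z0))) + z * z * ((b - a) * d * (b - a) / 2)) (0 + t * 1))).
    by move=> s; rewrite /F; replace (0 + s * 1) with (RtoC s) by ring.
  set dd := (X in rderiv _ _ X).
  replace dd with (1 * dd) by ring.
  apply: (rderiv_comp (fun z => z * ((b - a) * (c + d * (a - z0))) + z * z * ((b - a) * d * (b - a) / 2)) (fun t => 0 + t * 1)); last exact: rderiv_affine.
  rewrite /dd /P.
  apply: cderiv_eq.
    apply cderiv_plus; first by apply cderiv_mult; [exact: cderiv_id|exact: cderiv_const].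
    apply cderiv_mult; last exact: cderiv_const. apply cderiv_mult; exact: cderiv_id.
  rewrite C2_eq /=; field; done.
have := is_CInt_minus _ _ _ _ _ _ (seg_correct a b Ha Hb) HP.
move=> /(is_CInt_bound _ 0 1 _ (E * cmod (b - a))) HB.
replace (E * cmod (b - a))%R with ((1 - 0) * (E * cmod (b - a)))%R by ring.
apply: HB; first lra.
move=> t t01; replace ((b - a) * f (a + t * (b - a)) - (b - a) * (c + d * (P t - z0))) with
 ((b - a) * (f (P t) - (c + d * (P t - z0)))) by (rewrite /P; ring).
rewrite Cmod_mult Rmult_comm; apply: Rmult_le_compat_r; first exact: Cmod_ge_0.
exact: H.
Qed.
End Seg.

(** * Goursat's lemma *)

(** With q n the sum of the remaining geometric bounds, the intervals [u n - q n, u n + q n] are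
    nested; the limit is the supremum of their left ends. *)
Lemma geometric_cauchy (u : nat -> R) K : (0 <= K)%R ->
  (forall n, Rabs (u (S n) - u n) <= K / 2 ^ n)%R ->
  exists l, forall n, (Rabs (u n - l) <= 2 * K / 2 ^ n)%R.
Proof.
move=> K0 H.
have p2 n : (0 < 2 ^ n)%R by apply: pow_lt; lra.
pose q n := (2 * K / 2 ^ n)%R.
have qS n : (q (S n) = K / 2 ^ n)%R by rewrite /q /=; field; have := p2 n; lra.
have q2 n : (q n = 2 * q (S n))%R by rewrite qS /q /Rdiv; ring.
have q0 n : (0 <= q n)%R by rewrite /q; apply: Rmult_le_pos; [lra|apply/Rlt_le/Rinv_0_lt_compat/p2].
have step n : (u n - q n <= u (S n) - q (S n) /\ u (S n) + q (S n) <= u n + q n)%R.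
  have := H n; rewrite -qS (q2 n); move=> /Rabs_le_between; lra.
have mono m n : (m <= n)%nat -> (u m - q m <= u n - q n /\ u n + q n <= u m + q m)%R.
  elim=> [|k _ IH]; first lra. have := step k; lra.
have all m n : (u m - q m <= u n + q n)%R.
  have [h1 _] := mono m (Nat.max m n) (Nat.le_max_l _ _).
  have [_ h2] := mono n (Nat.max m n) (Nat.le_max_r _ _).
  have := q0 (Nat.max m n); lra.
have [l [Hu Hl]] : {l | is_lub (fun x => exists n, x = (u n - q n)%R) l}.
  apply: completeness; last by exists (u 0%nat - q 0%nat)%R, 0%nat.
  exists (u 0%nat + q 0%nat)%R => x [n ->]; exact: all.
exists l => n; apply/Rabs_le_between'; split.
- have : (l <= u n + q n)%R by apply: Hl => x [m ->]; exact: all.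
  rewrite -/(q n); lra.
- have : (u n - q n <= l)%R by apply: Hu; exists n.
  rewrite -/(q n); lra.
Qed.

Lemma geometric_cauchy_C (u : nat -> C) K : (0 <= K)%R ->
  (forall n, Cmod (u (S n) - u n)%C <= K / 2 ^ n)%R ->
  exists l, forall n, (cmod (u n - l) <= 4 * K / 2 ^ n)%R.
Proof.
move=> K0 H.
have [x Hx] : exists l, forall n, (Rabs (Re (u n) - l) <= 2 * K / 2 ^ n)%R.
  apply: geometric_cauchy => // n; apply: Rle_trans (H n); exact: (re_le_Cmod (u (S n) - u n)).
have [y Hy] : exists l, forall n, (Rabs (Im (u n) - l) <= 2 * K / 2 ^ n)%R.
  apply: geometric_cauchy => // n; apply: Rle_trans (H n); exact: (im_le_Cmod (u (S n) - u n)).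
exists (x, y) => n; apply: Rle_trans (Cmod_le_Re_Im _) _.
have := Hx n; have := Hy n.
replace (4 * K / 2 ^ n)%R with (2 * K / 2 ^ n + 2 * K / 2 ^ n)%R by (rewrite /Rdiv; ring).
exact: (fun a b => Rplus_le_compat _ _ _ _ b a).
Qed.

Definition triangle_int (f : C -> C) (a b c : C) : C := seg_int f a b + seg_int f b c + seg_int f c a.
Definition perimeter (a b c : C) : R := (cmod (b - a) + cmod (c - b) + cmod (a - c))%R.

Lemma Cmod_half (z : C) : (cmod (z / 2) = Cmod z / 2)%R.
Proof. rewrite Cmod_div; last exact: C2_nz. rewrite Cmod_R Rabs_pos_eq //; lra. Qed.

Lemma perim_corner (a b c : C) : perimeter a ((a + b) / 2) ((c + a) / 2) = (perimeter a b c / 2)%R.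
Proof.
rewrite /perimeter.
replace ((a + b) / 2 - a) with ((b - a) / 2) by (rewrite C2_eq; field; exact: C1_plus_C1_nz).
replace ((c + a) / 2 - (a + b) / 2) with ((c - b) / 2) by (rewrite C2_eq; field; exact: C1_plus_C1_nz).
replace (a - (c + a) / 2) with ((a - c) / 2) by (rewrite C2_eq; field; exact: C1_plus_C1_nz).
rewrite !Cmod_half; field.
Qed.

Lemma perim_center (a b c : C) : perimeter ((a + b) / 2) ((b + c) / 2) ((c + a) / 2) = (perimeter a b c / 2)%R.
Proof.
rewrite /perimeter.
replace ((b + c) / 2 - (a + b) / 2) with (- ((a - c) / 2)) by (rewrite C2_eq; field; exact: C1_plus_C1_nz).
replace ((c + a) / 2 - (b + c) / 2) with (- ((b - a) / 2)) by (rewrite C2_eq; field; exact: C1_plus_C1_nz).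
replace ((a + b) / 2 - (c + a) / 2) with (- ((c - b) / 2)) by (rewrite C2_eq; field; exact: C1_plus_C1_nz).
rewrite !Cmod_opp !Cmod_half; field.
Qed.

Lemma perim_rot (a b c : C) : perimeter a b c = perimeter b c a.
Proof. rewrite /perimeter; ring. Qed.

Lemma Cmod_mid (a b : C) rho : (Cmod a <= rho)%R -> (Cmod b <= rho)%R -> (cmod ((a + b) / 2) <= rho)%R.
Proof. move=> Ha Hb; rewrite Cmod_half. have := Cmod_triangle a b; lra. Qed.

Section Goursat.
Variable f : C -> C.
Hypothesis fd : forall z, in_disk z -> exists l, cderiv f z l.

Let fc : forall z, in_disk z -> C_continuous f z.
Proof. move=> z /fd [l]; exact: cderiv_cont. Qed.

Lemma tri_split a b c : in_disk a -> in_disk b -> in_disk c ->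
  triangle_int f a b c = triangle_int f a ((a + b) / 2) ((c + a) / 2) + triangle_int f b ((b + c) / 2) ((a + b) / 2)
   + triangle_int f c ((c + a) / 2) ((b + c) / 2) + triangle_int f ((a + b) / 2) ((b + c) / 2) ((c + a) / 2).
Proof.
move=> Ha Hb Hc.
have D x y : in_disk x -> in_disk y -> in_disk ((x + y) / 2).
  move=> Hx Hy; apply: (Rle_lt_trans _ (Rmax (Cmod x) (Cmod y))); last exact: Rmax_lub_lt.
  apply: Cmod_mid; [exact: Rmax_l|exact: Rmax_r].
rewrite /triangle_int (seg_mid f fc a b) // (seg_mid f fc b c) // (seg_mid f fc c a) //.
rewrite (seg_rev f fc ((a + b) / 2) ((b + c) / 2)); [|exact: D|exact: D].
rewrite (seg_rev f fc ((b + c) / 2) ((c + a) / 2)); [|exact: D|exact: D].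
rewrite (seg_rev f fc ((c + a) / 2) ((a + b) / 2)); [|exact: D|exact: D].
ring.
Qed.

(** The membership conditions stand as premises, so that every triple has a successor and the
    bisection can be iterated by plain recursion. The last clause makes the sequence of first
    vertices Cauchy. *)
Definition quarter_triangle (rho : R) (t t' : C * C * C) : Prop :=
  let '(a, b, c) := t in let '(a', b', c') := t' in
  (Cmod a <= rho -> Cmod b <= rho -> Cmod c <= rho ->
   Cmod a' <= rho /\ Cmod b' <= rho /\ Cmod c' <= rho /\
   perimeter a' b' c' = perimeter a b c / 2 /\
   Cmod (triangle_int f a b c) <= 4 * Cmod (triangle_int f a' b' c') /\
   Cmod (a' - a)%C <= perimeter a b c)%R.

Lemma quarter_triangle_exists rho t : (rho < 1)%R -> exists t', quarter_triangle rho t t'.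
Proof.
move=> rho1; case: t => [[a b] c].
case: (Rle_dec (Cmod a) rho) => Ha; last by exists (a, b, c) => /Ha.
case: (Rle_dec (Cmod b) rho) => Hb; last by exists (a, b, c) => _ /Hb.
case: (Rle_dec (Cmod c) rho) => Hc; last by exists (a, b, c) => _ _ /Hc.
have := tri_split a b c (Rle_lt_trans _ _ _ Ha rho1) (Rle_lt_trans _ _ _ Hb rho1) (Rle_lt_trans _ _ _ Hc rho1).
set T1 := triangle_int f a ((a + b) / 2) ((c + a) / 2); set T2 := triangle_int f b _ ((a + b) / 2); set T3 := triangle_int f c _ ((b + c) / 2); set T4 := triangle_int f _ ((b + c) / 2) _ => E.
have M : (cmod (triangle_int f a b c) <= Cmod T1 + Cmod T2 + Cmod T3 + Cmod T4)%R.
  rewrite E; apply: Rle_trans (Cmod_triangle _ _) _; apply: Rplus_le_compat_r.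
  apply: Rle_trans (Cmod_triangle _ _) _; apply: Rplus_le_compat_r. exact: Cmod_triangle.
have [p1 [p2 p3]] := conj (Cmod_ge_0 (b - a)) (conj (Cmod_ge_0 (c - b)) (Cmod_ge_0 (a - c))).
have mab := Cmod_mid a b rho Ha Hb. have mbc := Cmod_mid b c rho Hb Hc. have mca := Cmod_mid c a rho Hc Ha.
case: (Rle_dec (cmod (triangle_int f a b c)) (4 * Cmod T1)) => H1.
  exists (a, (a + b) / 2, (c + a) / 2) => _ _ _.
  do 3 (split; [assumption|]); split; [exact: perim_corner|split; [exact: H1|]].
  replace (a - a) with (RtoC 0) by ring; rewrite Cmod_0 /perimeter; lra.
case: (Rle_dec (cmod (triangle_int f a b c)) (4 * Cmod T2)) => H2.
  exists (b, (b + c) / 2, (a + b) / 2) => _ _ _.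
  do 3 (split; [assumption|]); split; [by rewrite perim_corner -perim_rot|split; [exact: H2|]].
  rewrite /perimeter; lra.
case: (Rle_dec (cmod (triangle_int f a b c)) (4 * Cmod T3)) => H3.
  exists (c, (c + a) / 2, (b + c) / 2) => _ _ _.
  do 3 (split; [assumption|]); split; [by rewrite perim_corner perim_rot|split; [exact: H3|]].
  replace (c - a) with (- (a - c)) by ring; rewrite Cmod_opp /perimeter; lra.
(* Each corner triangle carries less than a quarter of the modulus, so the central one carries more
   than a quarter. *)
exists ((a + b) / 2, (b + c) / 2, (c + a) / 2) => _ _ _.
do 3 (split; [assumption|]); split; [exact: perim_center|split].
- rewrite -/T4; lra.
- replace ((a + b) / 2 - a) with ((b - a) / 2) by (rewrite C2_eq; field; exact: C1_plus_C1_nz).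
  rewrite Cmod_half /perimeter; lra.
Qed.

Lemma goursat a b c : in_disk a -> in_disk b -> in_disk c -> triangle_int f a b c = 0.
Proof.
move=> Ha Hb Hc.
set rho := Rmax (Cmod a) (Rmax (Cmod b) (Cmod c)).
have rho1 : (rho < 1)%R by do !apply: Rmax_lub_lt.
have ra : (Cmod a <= rho)%R by exact: Rmax_l.
have rb : (Cmod b <= rho)%R by apply: Rle_trans (Rmax_r _ _); exact: Rmax_l.
have rc : (Cmod c <= rho)%R by apply: Rle_trans (Rmax_r _ _); exact: Rmax_r.
pose next t := proj1_sig (constructive_indefinite_description _ (quarter_triangle_exists rho t rho1)).
have nextP t : quarter_triangle rho t (next t) by rewrite /next; case: constructive_indefinite_description.
pose t := fix t n := if n is S m then next (t m) else (a, b, c).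
pose A n := fst (fst (t n)); pose B n := snd (fst (t n)); pose D n := snd (t n).
have tE n : t n = (A n, B n, D n) by rewrite /A /B /D; case: (t n) => [[]].
set P := perimeter a b c.
have p2 n : (0 < 2 ^ n)%R by apply: pow_lt; lra.
have inv n : (Cmod (A n) <= rho /\ Cmod (B n) <= rho /\ Cmod (D n) <= rho /\
  perimeter (A n) (B n) (D n) = P / 2 ^ n /\ Cmod (triangle_int f a b c) <= 4 ^ n * Cmod (triangle_int f (A n) (B n) (D n)))%R.
  elim: n => [|n [h1 [h2 [h3 [h4 h5]]]]].
    rewrite /A /B /D /=; do 3 (split; [assumption|]); split; [rewrite -/P; field|lra].
  have := nextP (t n); rewrite -/(t (S n)) (tE n) (tE (S n)) => /(_ h1 h2 h3) [k1 [k2 [k3 [k4 [k5 _]]]]].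
  do 3 (split; [assumption|]); split; first by rewrite k4 h4 /=; field; have := p2 n; lra.
  apply: Rle_trans h5 _; rewrite /= (Rmult_comm 4) Rmult_assoc; apply: Rmult_le_compat_l => //.
  apply: pow_le; lra.
have P0 : (0 <= P)%R.
  rewrite /P /perimeter; have := Cmod_ge_0 (b - a); have := Cmod_ge_0 (c - b); have := Cmod_ge_0 (a - c); lra.
have [L HL] : exists L, forall n, (cmod (A n - L) <= 4 * P / 2 ^ n)%R.
  apply: geometric_cauchy_C => // n.
  have [h1 [h2 [h3 [h4 h5]]]] := inv n.
  by have := nextP (t n); rewrite -/(t (S n)) (tE n) (tE (S n)) => /(_ h1 h2 h3) [_ [_ [_ [_ [_]]]]]; rewrite h4.
(* 5 P = 4 P + P: the first vertex is within 4 P / 2^n of L, and the points of the n-th triangle are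
   within P / 2^n of that vertex. *)
have small eps : (0 < eps)%R -> exists n, (5 * P / 2 ^ n < eps)%R.
  move=> e0.
  have [n Hn] := Pow_x_infinity 2 (ltac:(rewrite Rabs_pos_eq; lra)) ((5 * P + 1) / eps).
  exists n; have := Hn n (Nat.le_refl _); rewrite Rabs_pos_eq; last exact: Rlt_le.
  move=> H; apply: (Rmult_lt_reg_r (2 ^ n)) => //.
  replace (5 * P / 2 ^ n * 2 ^ n)%R with (5 * P)%R by (field; have := p2 n; lra).
  have : ((5 * P + 1) / eps * eps = 5 * P + 1)%R by field; lra.
  nra.
have LD : in_disk L.
  apply: (Rle_lt_trans _ rho) => //; apply: le_epsilon => eps /small [n Hn].
  have [h1 _] := inv n.
  have := Cmod_triangle (A n) (- (A n - L)); replace (A n + - (A n - L)) with L by ring.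
  rewrite Cmod_opp; have := HL n.
  have : (4 * P / 2 ^ n <= 5 * P / 2 ^ n)%R.
    apply: Rmult_le_compat_r; [apply/Rlt_le/Rinv_0_lt_compat/p2|lra].
  lra.
have [l Hl] := fd L LD.
apply: Cmod_eq_0; apply: Rle_antisym; last exact: Cmod_ge_0.
apply: le_epsilon => eps e0; rewrite Rplus_0_l.
(* With this tolerance the final bound 4^n (tolerance) (5 P / 2^n) (P / 2^n) stays below eps; the
   summand 1 covers P = 0. *)
have e1 : (0 < eps / (5 * P * P + 1))%R by apply: Rdiv_lt_0_compat; nra.
have [d [d0 Hd]] := Hl _ e1.
have [n Hn] := small d d0.
have [h1 [h2 [h3 [h4 h5]]]] := inv n.
have Pn0 : (0 <= P / 2 ^ n)%R by apply: Rmult_le_pos => //; apply/Rlt_le/Rinv_0_lt_compat/p2.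
have [s1 [s2 s3]] := conj (Cmod_ge_0 (B n - A n)) (conj (Cmod_ge_0 (D n - B n)) (Cmod_ge_0 (A n - D n))).
set E := (eps / (5 * P * P + 1) * (5 * P / 2 ^ n))%R.
have near p : (cmod (p - A n) <= P / 2 ^ n)%R -> (cmod (f p - (f L + l * (p - L))) <= E)%R.
  move=> Hp.
  have Hp2 : (cmod (p - L) <= 5 * P / 2 ^ n)%R.
    replace (p - L) with ((p - A n) + (A n - L)) by ring.
    apply: Rle_trans (Cmod_triangle _ _) _.
    have := HL n; rewrite /Rdiv in Hp *; nra.
  have := Hd (p - L) (Rle_lt_trans _ _ _ Hp2 Hn).
  replace (L + (p - L)) with p by ring.
  replace (f p - f L - (p - L) * l) with (f p - (f L + l * (p - L))) by ring.
  move=> H; apply: Rle_trans H _; apply: Rmult_le_compat_l => //; exact: Rlt_le.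
have side x y : (Cmod x <= rho)%R -> (Cmod y <= rho)%R -> (cmod (x - A n) <= P / 2 ^ n)%R -> (cmod (y - A n) <= P / 2 ^ n)%R ->
  (cmod (seg_int f x y - (y - x) * (f L + l * ((x + y) / 2 - L))) <= E * cmod (y - x))%R.
  move=> Hx Hy kx ky; apply: seg_affine_bound => //.
  - exact: Rle_lt_trans Hx rho1.
  - exact: Rle_lt_trans Hy rho1.
  move=> s s01 p; apply: near.
  replace (p - A n) with ((x - A n) + s * ((y - A n) - (x - A n))) by (rewrite /p; ring).
  exact: disk_convex.
have AA : (cmod (A n - A n) <= P / 2 ^ n)%R by replace (A n - A n) with (RtoC 0) by ring; rewrite Cmod_0.
rewrite /perimeter in h4.
have BA : (cmod (B n - A n) <= P / 2 ^ n)%R by lra.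
have DA : (cmod (D n - A n) <= P / 2 ^ n)%R.
  replace (D n - A n) with (- (A n - D n)) by ring; rewrite Cmod_opp; lra.
have k1 := side _ _ h1 h2 AA BA. have k2 := side _ _ h2 h3 BA DA. have k3 := side _ _ h3 h1 DA AA.
have TT : (cmod (triangle_int f (A n) (B n) (D n)) <= E * (P / 2 ^ n))%R.
  rewrite -h4 !Rmult_plus_distr_l.
  set X1 := (seg_int f (A n) (B n) - _) in k1; set X2 := (seg_int f (B n) (D n) - _) in k2; set X3 := (seg_int f (D n) (A n) - _) in k3.
  (* The midpoint values of the affine part, weighted by the sides, cancel around the closed
     triangle. *)
  have -> : triangle_int f (A n) (B n) (D n) = X1 + X2 + X3.
    rewrite /triangle_int /X1 /X2 /X3 C2_eq; field; exact: C1_plus_C1_nz.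
  apply: Rle_trans (Cmod_triangle _ _) _. have := Cmod_triangle X1 X2; lra.
apply: Rle_trans h5 _.
have f4 : (0 < 4 ^ n)%R by apply: pow_lt; lra.
apply: (Rle_trans _ (4 ^ n * (E * (P / 2 ^ n)))); first by apply: Rmult_le_compat_l; [exact: Rlt_le|].
have E4 : (4 ^ n = 2 ^ n * 2 ^ n)%R by rewrite -Rpow_mult_distr; f_equal; ring.
rewrite E4 /E.
replace (2 ^ n * 2 ^ n * (eps / (5 * P * P + 1) * (5 * P / 2 ^ n) * (P / 2 ^ n)))%R with (eps / (5 * P * P + 1) * (5 * P * P))%R;
  last by field; have := p2 n; repeat split; nra.
have : (eps / (5 * P * P + 1) * (5 * P * P + 1) = eps)%R by field; nra.
lra.
Qed.

(** F is the integral from 0. Goursat's lemma for the triangle 0, z, z + h identifies F(z + h) -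
    F(z) with the integral over the short segment, on which f is nearly constant. *)
Lemma primitive : exists F, forall z, in_disk z -> cderiv F z (f z).
Proof.
have D0 : in_disk 0 by rewrite /in_disk Cmod_0; lra.
exists (seg_int f 0) => z Hz eps e0.
have [d [d0 Hd]] := fc z Hz eps e0.
exists (Rmin d (1 - Cmod z)); split; first by apply: Rmin_glb_lt => //; rewrite /in_disk in Hz; lra.
move=> h Hh.
have h1 := Rlt_le_trans _ _ _ Hh (Rmin_l _ _).
have h2 := Rlt_le_trans _ _ _ Hh (Rmin_r _ _).
have Hzh : in_disk (z + h) by rewrite /in_disk; have := Cmod_triangle z h; lra.
have := goursat 0 z (z + h) D0 Hz Hzh; rewrite /triangle_int (seg_rev f fc 0 (z + h)) //.
move=> G.
have -> : seg_int f 0 (z + h) - seg_int f 0 z - h * f z = seg_int f z (z + h) - (z + h - z) * (f z + 0 * ((z + (z + h)) / 2 - z)).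
  replace (seg_int f z (z + h)) with (seg_int f 0 (z + h) - seg_int f 0 z + (seg_int f 0 z + seg_int f z (z + h) + - seg_int f 0 (z + h))) by ring.
  rewrite G; ring.
replace (Cmod h) with (cmod (z + h - z)) by (f_equal; ring).
apply: seg_affine_bound => // t t01 p.
have -> : p = z + t * h by rewrite /p; ring.
replace (f (z + t * h) - (f z + 0 * (z + t * h - z))) with (f (z + t * h) - f z) by ring.
apply: Rlt_le; apply: Hd; rewrite Cmod_mult Cmod_R Rabs_pos_eq; last lra.
have := Cmod_ge_0 h; nra.
Qed.
End Goursat.

(** * Cauchy's integral formula *)

Lemma is_CInt_Re f a b l : is_CInt f a b l -> is_RInt (fun t => Re (f t)) a b (Re l).
Proof. exact: (is_RInt_fct_extend_fst (U := R_NormedModule) (V := R_NormedModule)). Qed.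
Lemma is_CInt_Im f a b l : is_CInt f a b l -> is_RInt (fun t => Im (f t)) a b (Im l).
Proof. exact: (is_RInt_fct_extend_snd (U := R_NormedModule) (V := R_NormedModule)). Qed.

(** Naming the partial derivative B puts an explicit function in place of [Derive], so that joint
    continuity can be checked directly. *)
Lemma is_derive_RInt_param_of_is_derive (A B : R -> R -> R) a b x : (a <= b)%R ->
  (exists d, (0 < d)%R /\ forall y, (Rabs (y - x) < d)%R -> forall t, is_derive (fun s => A s t) y (B y t)) ->
  (exists d, (0 < d)%R /\ forall y, (Rabs (y - x) < d)%R -> ex_RInt (A y) a b) ->
  (forall t, continuous (fun p : R * R => B (fst p) (snd p)) (x, t)) ->
  is_derive (fun s => RInt (A s) a b) x (RInt (B x) a b).
Proof.
move=> ab [d [d0 Hd]] [d' [d'0 Hd']] Hc.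
have x0 : (Rabs (x - x) < d)%R by rewrite Rminus_diag_eq // Rabs_R0.
have -> : RInt (B x) a b = RInt (fun t => Derive (fun u => A u t) x) a b.
  apply: RInt_ext => t _; apply: eq_sym; apply: is_derive_unique; exact: Hd.
apply: is_derive_RInt_param.
- exists (mkposreal d d0) => y Hy t _; exists (B y t); exact: Hd.
- move=> t _; apply: (continuity_2d_pt_ext_loc B).
    exists (mkposreal d d0) => u v Hu Hv; apply: eq_sym; apply: is_derive_unique; exact: Hd.
  apply/continuity_2d_pt_filterlim; exact: Hc.
- exists (mkposreal d' d'0) => y Hy; exact: Hd'.
Qed.

Lemma rderiv_CInt_param (A B : R -> R -> C) a b x d : (a <= b)%R -> (0 < d)%R ->
  (forall y, (Rabs (y - x) < d)%R -> forall t, rderiv (fun s => A s t) y (B y t)) ->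
  (forall y, (Rabs (y - x) < d)%R -> forall t, R_C_continuous (A y) t) ->
  (forall t, continuous (U := C_UniformSpace) (fun p : R * R => B (fst p) (snd p)) (x, t)) ->
  (forall t, R_C_continuous (B x) t) ->
  rderiv (fun s => CInt (A s) a b) x (CInt (B x) a b).
Proof.
move=> ab d0 H1 H2 H3 H4.
have x0 : (Rabs (x - x) < d)%R by rewrite Rminus_diag_eq // Rabs_R0.
have CA y : (Rabs (y - x) < d)%R -> is_CInt (A y) a b (CInt (A y) a b).
  move=> Hy; apply: CInt_correct => // t _; exact: H2.
have CB : is_CInt (B x) a b (CInt (B x) a b) by apply: CInt_correct => // t _; exact: H4.
apply rderiv_pair.
- rewrite -(is_RInt_unique _ _ _ _ (is_CInt_Re _ _ _ _ CB)).
  apply: (is_derive_ext_loc (fun s => RInt (fun t => Re (A s t)) a b)).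
    exists (mkposreal d d0) => y Hy; exact: (is_RInt_unique _ _ _ _ (is_CInt_Re _ _ _ _ (CA y Hy))).
  apply: (is_derive_RInt_param_of_is_derive (fun s t => Re (A s t)) (fun s t => Re (B s t))) => //.
  + exists d; split=> // y Hy t; apply: rderiv_Re; exact: H1.
  + exists d; split=> // y Hy; exists (Re (CInt (A y) a b)); apply: is_CInt_Re; exact: CA.
  + move=> t; exact: (cont_Re _ _ (H3 t)).
- rewrite -(is_RInt_unique _ _ _ _ (is_CInt_Im _ _ _ _ CB)).
  apply: (is_derive_ext_loc (fun s => RInt (fun t => Im (A s t)) a b)).
    exists (mkposreal d d0) => y Hy; exact: (is_RInt_unique _ _ _ _ (is_CInt_Im _ _ _ _ (CA y Hy))).
  apply: (is_derive_RInt_param_of_is_derive (fun s t => Im (A s t)) (fun s t => Im (B s t))) => //.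
  + exists d; split=> // y Hy t; apply: rderiv_Im; exact: H1.
  + exists d; split=> // y Hy; exists (Im (CInt (A y) a b)); apply: is_CInt_Im; exact: CA.
  + move=> t; exact: (cont_Im _ _ (H3 t)).
Qed.

Definition cis (t : R) : C := (cos t, sin t).

Lemma Ci2 : Ci * Ci = - (1).
Proof. rewrite /Ci /Cmult /RtoC /Copp /=; f_equal; ring. Qed.

Lemma rderiv_cis t : rderiv cis t (Ci * cis t).
Proof.
apply rderiv_pair; rewrite /=.
- replace (0 * cos t - 1 * sin t)%R with (- sin t)%R by ring; exact: is_derive_cos.
- replace (0 * sin t + 1 * cos t)%R with (cos t) by ring; exact: is_derive_sin.
Qed.

Lemma Cmod_cis t : Cmod (cis t) = 1%R.
Proof.
rewrite /Cmod /cis /=; replace (cos t * (cos t * 1) + sin t * (sin t * 1))%R with 1%R; first exact: sqrt_1.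
have := sin2_cos2 t; rewrite /Rsqr; lra.
Qed.

Lemma cont_cis {T : UniformSpace} (g : T -> R) x : continuous g x -> continuous (U := C_UniformSpace) (fun s => cis (g s)) x.
Proof.
move=> H; apply cont_pair; rewrite /cis /=.
- apply: continuous_comp => //; exact: continuous_cos.
- apply: continuous_comp => //; exact: continuous_sin.
Qed.

Lemma cis_2PI : cis (2 * PI) = cis 0.
Proof. by rewrite /cis cos_2PI sin_2PI cos_0 sin_0. Qed.

Lemma Cmod_circle rho t : (0 <= rho)%R -> (cmod (rho * cis t) = rho)%R.
Proof. move=> r0; rewrite Cmod_mult Cmod_cis Cmod_R Rabs_pos_eq //; ring. Qed.

Lemma circle_minus_nz rho t z : (Cmod z < rho)%R -> rho * cis t - z <> 0.
Proof.
move=> H E; have := Cmod_circle rho t (Rle_trans _ _ _ (Cmod_ge_0 z) (Rlt_le _ _ H)).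
have -> : rho * cis t = (rho * cis t - z) + z by ring.
rewrite E; replace (0 + z) with z by ring; lra.
Qed.

Lemma C_continuous_inv (z : C) : z <> 0 -> C_continuous Cinv z.
Proof. move=> /cderiv_inv; exact: cderiv_cont. Qed.

Lemma two_PI_pos : (0 < 2 * PI)%R.
Proof. have := PI_RGT_0; lra. Qed.

Lemma rderiv_affine_cis (a b : C) t : rderiv (fun t => a + b * cis t) t (b * (Ci * cis t)).
Proof.
have H := rderiv_comp (fun z => a + b * z) cis t b (Ci * cis t) _ (rderiv_cis t).
replace (b * (Ci * cis t)) with (Ci * cis t * b) by ring; apply: H.
apply: cderiv_eq; first by apply cderiv_plus; [exact: cderiv_const|apply cderiv_mult; [exact: cderiv_const|exact: cderiv_id]].
cbv beta; ring.
Qed.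

Ltac cont := lazymatch goal with
  | |- continuous (fun _ => ?c) _ => apply: cont_const
  | |- continuous (fun x => _ + _) _ => apply cont_plus; cont
  | |- continuous (fun x => _ * _) _ => apply cont_mult; cont
  | |- _ => idtac end.

(* The integral is constant along [s |-> s z], since its derivative in [s] integrates an exact form. *)
Lemma winding_circle rho (z : C) : (Cmod z < rho)%R ->
  CInt (fun t => rho * cis t * / (rho * cis t - z)) 0 (2 * PI) = (2 * PI)%R.
Proof.
move=> Hz.
have r0 := Rle_lt_trans _ _ _ (Cmod_ge_0 z) Hz.
have rnz : RtoC rho <> 0 by move=> /RtoC_inj; lra.
pose A (s t : R) : C := rho * cis t * / (rho * cis t - s * z).
pose B (s t : R) : C := z * (rho * cis t) * (/ (rho * cis t - s * z) * / (rho * cis t - s * z)).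
pose h (s : R) := CInt (A s) 0 (2 * PI).
have CT (T : UniformSpace) (g k : T -> R) x : continuous g x -> continuous k x -> (cmod (g x * z) < rho)%R -> 
   continuous (U := C_UniformSpace) (fun s => / (rho * cis (k s) - g s * z)) x.
  move=> Hg Hk Hx; apply: (cont_comp Cinv).
    apply: C_continuous_inv; exact: circle_minus_nz.
  apply cont_plus; first by apply cont_mult; [exact: cont_const|exact: cont_cis].
  apply: (continuous_ext (fun s => (- z) * g s)); first by move=> s; cring.
  apply cont_mult; [exact: cont_const|exact: cont_RtoC].
have z0 := Cmod_ge_0 z.
(* For y within d of [0, 1] one has |y| < 1 + d, and (1 + d) |z| = rho - d < rho. *)
pose d := ((rho - Cmod z) / (Cmod z + 1))%R.
have d0 : (0 < d)%R by apply: Rdiv_lt_0_compat; lra.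
have dE : (d * (Cmod z + 1) = rho - Cmod z)%R by rewrite /d; field; lra.
have near s y : (0 <= s <= 1)%R -> (Rabs (y - s) < d)%R -> (cmod (y * z) < rho)%R.
  move=> s01 Hy; rewrite Cmod_mult Cmod_R.
  have := Rabs_triang (y - s) s; replace (y - s + s)%R with y by ring.
  rewrite (Rabs_pos_eq s); last lra. nra.
have near0 s : (0 <= s <= 1)%R -> (cmod (s * z) < rho)%R.
  by move=> s01; apply: (near s) => //; rewrite Rminus_diag_eq // Rabs_R0.
have hd s : (0 <= s <= 1)%R -> rderiv h s 0.
  move=> s01.
  have BI : is_CInt (B s) 0 (2 * PI) 0.
    pose P t := Ci * z * / (rho * cis t - s * z).
    have -> : RtoC 0 = P (2 * PI)%R - P 0%R by rewrite /P cis_2PI; ring.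
    apply: is_CInt_FTC; first exact: Rlt_le two_PI_pos.
    - move=> t _; rewrite /P.
      have nz := circle_minus_nz rho t _ (near0 s s01).
      have H := rderiv_comp (fun w => Ci * z * / w) (fun t => - (s * z) + rho * cis t) t _ _ _ (rderiv_affine_cis _ _ t).
      apply: (rderiv_ext (fun t => Ci * z * / (- (s * z) + rho * cis t))).
        by move=> t'; f_equal; f_equal; ring.
      replace (B s t) with (rho * (Ci * cis t) * (0 * / (rho * cis t - s * z) + Ci * z * - (/ (rho * cis t - s * z) * / (rho * cis t - s * z)))).
        apply: H; replace (- (s * z) + rho * cis t) with (rho * cis t - s * z) by ring.
        exact: (cderiv_mult (fun _ => Ci * z) Cinv _ _ _ (cderiv_const _ _) (cderiv_inv _ nz)).
      rewrite /B.
      transitivity (- (Ci * Ci) * (z * (rho * cis t) * (/ (rho * cis t - s * z) * / (rho * cis t - s * z)))); first ring.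
      rewrite Ci2; ring.
    - move=> t _; rewrite /B; cont; first by apply: cont_cis; exact: continuous_id.
      + apply: CT; [exact: continuous_const|exact: continuous_id|exact: near0].
      + apply: CT; [exact: continuous_const|exact: continuous_id|exact: near0].
  rewrite -(CInt_unique _ _ _ _ BI).
  apply: (rderiv_CInt_param A B 0 (2 * PI) s d) => //; first exact: Rlt_le two_PI_pos.
  - move=> y Hy t; rewrite /A /B.
    have nz := circle_minus_nz rho t _ (near s y s01 Hy).
    have H := rderiv_comp (fun w => rho * cis t * / w) (fun s : R => rho * cis t + s * (- z)) y _ _ _ (rderiv_affine _ _ y).
    apply: (rderiv_ext (fun s : R => rho * cis t * / (rho * cis t + s * - z))).
      by move=> s'; f_equal; f_equal; ring.
    set l := z * _ * _; replace l with (- z * (0 * / (rho * cis t - y * z) + rho * cis t * - (/ (rho * cis t - y * z) * / (rho * cis t - y * z)))); last by rewrite /l; ring.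
    apply: H; replace (rho * cis t + y * - z) with (rho * cis t - y * z) by ring.
    exact: (cderiv_mult (fun _ => rho * cis t) Cinv _ _ _ (cderiv_const _ _) (cderiv_inv _ nz)).
  - move=> y Hy t; rewrite /A; cont; first by apply: cont_cis; exact: continuous_id.
    apply: CT; [exact: continuous_const|exact: continuous_id|exact: (near s)].
  - move=> t; rewrite /B; cont; first by apply: cont_cis; exact: continuous_snd.
    + apply: CT; [exact: continuous_fst|exact: continuous_snd|exact: near0].
    + apply: CT; [exact: continuous_fst|exact: continuous_snd|exact: near0].
  - move=> t; rewrite /B; cont; first by apply: cont_cis; exact: continuous_id.
    + apply: CT; [exact: continuous_const|exact: continuous_id|exact: near0].
    + apply: CT; [exact: continuous_const|exact: continuous_id|exact: near0].
have E01 : h 0%R = h 1%R.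
  apply: (eq_is_derive (V := C_R_NormedModule) h 0 1); last lra.
  move=> s s01; apply/rderiv_is_derive; exact: hd.
have <- : h 1%R = CInt (fun t => rho * cis t * / (rho * cis t - z)) 0 (2 * PI).
  rewrite /h /A; f_equal.
  apply: functional_extensionality => t.
  by replace (1 * z) with z by ring.
rewrite -E01 /h; apply: CInt_unique.
replace (RtoC (2 * PI)) with ((2 * PI - 0)%R * 1) by (rewrite Rminus_0_r; ring).
apply: is_CInt_ext (is_CInt_const 0 (2 * PI) 1) => t.
rewrite /A; replace (rho * cis t - 0 * z) with (rho * cis t) by ring.
field; split.
  move=> E; have := Cmod_cis t; rewrite E Cmod_0; lra.
exact: rnz.
Qed.

Section CauchyC1.
Variables F f : C -> C.
Hypothesis Fd : forall z, in_disk z -> cderiv F z (f z).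
Hypothesis fc : forall z, in_disk z -> C_continuous f z.

(* Contract the circle to [z] by [p s t = z + s (rho cis t - z)]: the derivative in [s] of the
   integral is that of [rho cis t * f (p s t)], again an exact form. *)
Lemma cauchy_C1 rho (z : C) : (Cmod z < rho)%R -> (rho < 1)%R ->
  CInt (fun t => F (rho * cis t) * (rho * cis t * / (rho * cis t - z))) 0 (2 * PI) = (2 * PI)%R * F z.
Proof.
move=> Hz r1.
have z0 := Cmod_ge_0 z.
have Fc w : in_disk w -> C_continuous F w by move=> /Fd; exact: cderiv_cont.
pose k t := rho * cis t * / (rho * cis t - z).
pose p (s t : R) : C := z + s * (rho * cis t - z).
pose A (s t : R) : C := F (p s t) * k t.
pose B (s t : R) : C := (rho * cis t) * f (p s t).
pose h (s : R) := CInt (A s) 0 (2 * PI).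
(* Since |rho cis t - z| < 2, moving s by less than d moves p by less than 1 - rho, which keeps it
   in the unit disk. *)
pose d := ((1 - rho) / 2)%R.
have d0 : (0 < d)%R by rewrite /d; lra.
have near s y t : (0 <= s <= 1)%R -> (Rabs (y - s) < d)%R -> in_disk (p y t).
  move=> s01 Hy; rewrite /in_disk.
  have -> : p y t = z + s * (rho * cis t - z) + (y - s)%R * (rho * cis t - z) by rewrite /p RtoC_minus; ring.
  apply: Rle_lt_trans (Cmod_triangle _ _) _; rewrite Cmod_mult Cmod_R.
  have C1 := Cmod_circle rho t (ltac:(lra)).
  have : (cmod (z + s * (rho * cis t - z)) <= rho)%R by apply: disk_convex => //; lra.
  have := Cmod_triangle (rho * cis t) (- z); rewrite Cmod_opp C1.
  change (rho * cis t + - z) with (rho * cis t - z).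
  have := Cmod_ge_0 (rho * cis t - z); have := Rabs_pos (y - s). rewrite /d in Hy; nra.
have near0 s t : (0 <= s <= 1)%R -> in_disk (p s t).
  by move=> s01; apply: (near s) => //; rewrite Rminus_diag_eq // Rabs_R0.
have pc (T : UniformSpace) (g l : T -> R) x : continuous g x -> continuous l x -> 
   continuous (U := C_UniformSpace) (fun s => p (g s) (l s)) x.
  move=> Hg Hl; rewrite /p /Cminus; cont; [exact: cont_RtoC|exact: cont_cis].
have kc t : R_C_continuous k t.
  rewrite /k; cont; first by apply: cont_cis; exact: continuous_id.
  apply: (cont_comp Cinv); first by apply: C_continuous_inv; exact: circle_minus_nz.
  rewrite /Cminus; cont; by apply: cont_cis; exact: continuous_id.
have hd s : (0 <= s <= 1)%R -> rderiv h s 0.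
  move=> s01.
  have Bc t : R_C_continuous (B s) t.
    rewrite /B; cont; first by apply: cont_cis; exact: continuous_id.
    apply cont_comp; first by apply: fc; exact: near0.
    apply: pc; [exact: continuous_const|exact: continuous_id].
  have BI : is_CInt (B s) 0 (2 * PI) 0.
    (* The primitive F(p s t) / (i s) breaks down at s = 0; there p is constantly z and [cis] itself
       is integrated. *)
    case: (Req_dec s 0) => [s0|snz].
      have E t : p s t = z by rewrite /p s0; ring.
      pose P t := - Ci * f z * rho * cis t.
      have -> : RtoC 0 = P (2 * PI)%R - P 0%R by rewrite /P cis_2PI; ring.
      apply: is_CInt_FTC; [exact: Rlt_le two_PI_pos| |by move=> t _; exact: Bc].
      move=> t _; apply: (rderiv_ext (fun t => 0 + (- Ci * f z * rho) * cis t)).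
        by move=> t'; rewrite /P; ring.
      replace (B s t) with (- Ci * f z * rho * (Ci * cis t)); first exact: rderiv_affine_cis.
      rewrite /B E. transitivity (- (Ci * Ci) * (rho * cis t * f z)); first ring.
      rewrite Ci2; ring.
    have snz' : RtoC s <> 0 by move=> /RtoC_inj.
    pose P t := (- Ci * / s) * F (p s t).
    have -> : RtoC 0 = P (2 * PI)%R - P 0%R by rewrite /P /p cis_2PI; ring.
    apply: is_CInt_FTC; [exact: Rlt_le two_PI_pos| |by move=> t _; exact: Bc].
    move=> t _.
    apply: (rderiv_ext (fun t => - Ci * / s * F ((z - s * z) + (s * rho) * cis t))).
      by move=> t'; rewrite /P /p; f_equal; f_equal; ring.
    have E : z - s * z + s * rho * cis t = p s t by rewrite /p; ring.
    have H := rderiv_comp (fun w => - Ci * / s * F w) (fun t => (z - s * z) + (s * rho) * cis t) t _ _ _ (rderiv_affine_cis _ _ t).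
    replace (B s t) with (s * rho * (Ci * cis t) * (0 * F (p s t) + - Ci * / s * f (p s t))).
      apply: H; rewrite E. exact: (cderiv_mult (fun _ => - Ci * / s) F _ _ _ (cderiv_const _ _) (Fd _ (near0 _ _ s01))).
    rewrite /B. transitivity (- (Ci * Ci) * (rho * cis t * f (p s t))); first by field.
    rewrite Ci2; ring.
  rewrite -(CInt_unique _ _ _ _ BI).
  apply: (rderiv_CInt_param A B 0 (2 * PI) s d) => //; first exact: Rlt_le two_PI_pos.
  - move=> y Hy t; rewrite /A.
    have H := rderiv_comp (fun w => F w * k t) (fun s : R => z + s * (rho * cis t - z)) y _ _ _ (rderiv_affine _ _ y).
    replace (B y t) with ((rho * cis t - z) * (f (p y t) * k t + F (p y t) * 0)).
      apply: H; exact: (cderiv_mult F (fun _ => k t) _ _ _ (Fd _ (near s _ _ s01 Hy)) (cderiv_const _ _)).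
    rewrite /B /k; field; exact: circle_minus_nz.
  - move=> y Hy t; rewrite /A; cont; last exact: kc.
    apply cont_comp; first by apply: Fc; exact: (near s).
    apply: pc; [exact: continuous_const|exact: continuous_id].
  - move=> t; rewrite /B; cont; first by apply: cont_cis; exact: continuous_snd.
    apply cont_comp; first by apply: fc; exact: near0.
    apply: pc; [exact: continuous_fst|exact: continuous_snd].
have E01 : h 0%R = h 1%R.
  apply: (eq_is_derive (V := C_R_NormedModule) h 0 1); last lra.
  move=> s s01; apply/rderiv_is_derive; exact: hd.
have <- : h 1%R = CInt (fun t => F (rho * cis t) * (rho * cis t * / (rho * cis t - z))) 0 (2 * PI).
  rewrite /h /A; f_equal.
  apply: functional_extensionality => t.
  by replace (p 1 t) with (rho * cis t) by (rewrite /p; ring).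
rewrite -E01 /h; apply: CInt_unique.
rewrite Cmult_comm -(winding_circle rho z Hz).
apply: (is_CInt_ext (fun t => F z * k t)).
  by move=> t; rewrite /A; replace (p 0 t) with z by (rewrite /p; ring).
apply: is_CInt_scal; apply: CInt_correct; first exact: Rlt_le two_PI_pos.
by move=> t _; exact: kc.
Qed.
End CauchyC1.

(** * Derivatives of Cauchy integrals in the complex parameter *)

Lemma cderiv_quadratic (G : C -> C) z l K eta : (0 < eta)%R -> (0 <= K)%R ->
  (forall h, (Cmod h < eta)%R -> (cmod (G (z + h) - G z - h * l) <= K * Cmod h * Cmod h)%R) -> cderiv G z l.
Proof.
move=> eta0 K0 H eps e0.
have e1 : (0 < eps / (K + 1))%R by apply: Rdiv_lt_0_compat; lra.
exists (Rmin eta (eps / (K + 1))); split; first exact: Rmin_glb_lt.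
move=> h Hh; apply: Rle_trans (H h (Rlt_le_trans _ _ _ Hh (Rmin_l _ _))) _.
have h2 := Rlt_le_trans _ _ _ Hh (Rmin_r _ _).
have E : (eps / (K + 1) * (K + 1) = eps)%R by field; lra.
have : (Cmod h * (K + 1) <= eps)%R by rewrite -[X in (_ <= X)%R]E; apply: Rmult_le_compat_r; lra.
have := Cmod_ge_0 h; move=> hp kp; apply: Rmult_le_compat_r => //; lra.
Qed.

(** A second-order remainder that is uniform in t integrates to a second-order remainder, so no
    limit has to be taken under the integral. *)
Lemma cderiv_CInt_param (A : C -> R -> C) (B : R -> C) a b z eta K : (a <= b)%R -> (0 < eta)%R -> (0 <= K)%R ->
  (forall h, (Cmod h < eta)%R -> forall t, R_C_continuous (A (z + h)) t) -> (forall t, R_C_continuous B t) ->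
  (forall h, (Cmod h < eta)%R -> forall t, (a <= t <= b)%R -> (cmod (A (z + h)%C t - A z t - h * B t) <= K * Cmod h * Cmod h)%R) ->
  cderiv (fun w => CInt (A w) a b) z (CInt B a b).
Proof.
move=> ab eta0 K0 Ac Bc H.
have A0 : forall t, R_C_continuous (A z) t.
  move=> t; have := Ac 0; rewrite Cmod_0; replace (z + 0) with z by ring; exact.
apply: (cderiv_quadratic _ _ _ ((b - a) * K) eta) => //; first by apply: Rmult_le_pos; lra.
move=> h Hh.
have I1 := CInt_correct (A (z + h)) a b ab (fun t _ => Ac h Hh t).
have I2 := CInt_correct (A z) a b ab (fun t _ => A0 t).
have I3 := is_CInt_scal h _ _ _ _ (CInt_correct B a b ab (fun t _ => Bc t)).
replace ((b - a) * K * Cmod h * Cmod h)%R with ((b - a) * (K * Cmod h * Cmod h))%R by ring.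
apply: is_CInt_bound ab _ (is_CInt_minus _ _ _ _ _ _ (is_CInt_minus _ _ _ _ _ _ I1 I2) I3).
move=> t Ht; exact: H.
Qed.

Section CauchyKernel.
Variables (phi : R -> C) (rho : R).
Hypothesis phi_continuous : forall t, R_C_continuous phi t.

Definition cauchy_kernel (z : C) (t : R) : C := / (rho * cis t - z).
(* Each of the following integrals is the derivative of the previous one. *)
Definition cauchy_int1 (z : C) : C := CInt (fun t => phi t * cauchy_kernel z t) 0 (2 * PI).
Definition cauchy_int2 (z : C) : C := CInt (fun t => phi t * (cauchy_kernel z t * cauchy_kernel z t)) 0 (2 * PI).
Definition cauchy_int3 (z : C) : C := CInt (fun t => phi t * (2 * (cauchy_kernel z t * cauchy_kernel z t * cauchy_kernel z t))) 0 (2 * PI).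
Definition cauchy_int4 (z : C) : C := CInt (fun t => phi t * (2 * (3 * (cauchy_kernel z t * cauchy_kernel z t * cauchy_kernel z t * cauchy_kernel z t)))) 0 (2 * PI).

Lemma kern_cont z t : (Cmod z < rho)%R -> R_C_continuous (cauchy_kernel z) t.
Proof.
move=> Hz; apply: (cont_comp Cinv); first by apply: C_continuous_inv; exact: circle_minus_nz.
rewrite /Cminus; cont; by apply: cont_cis; exact: continuous_id.
Qed.

Lemma phi_bound : exists M, (0 <= M)%R /\ forall t, (0 <= t <= 2 * PI)%R -> (Cmod (phi t) <= M)%R.
Proof.
have [m [Hm _]] := continuity_ab_maj (fun t => Rabs (Re (phi t)) + Rabs (Im (phi t)))%R 0 (2 * PI) (Rlt_le _ _ two_PI_pos)
  (fun t _ => proj2 (continuity_pt_filterlim _ t)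
   (continuous_plus _ _ t (continuous_comp (fun t => Re (phi t)) Rabs t (cont_Re _ _ (phi_continuous t)) (continuous_Rabs _)) (continuous_comp (fun t => Im (phi t)) Rabs t (cont_Im _ _ (phi_continuous t)) (continuous_Rabs _)))).
exists (Rabs (Re (phi m)) + Rabs (Im (phi m)))%R; split.
  have := Rabs_pos (Re (phi m)); have := Rabs_pos (Im (phi m)); lra.
move=> t Ht; apply: Rle_trans (Cmod_le_Re_Im _) _; exact: Hm.
Qed.

(** With eta half the distance from z to the circle, every z + h keeps at least the distance eta
    from it. The last equation is the resolvent identity, from which all the difference quotients
    below are computed. *)
Lemma kern_bounds z : (Cmod z < rho)%R -> exists eta, (0 < eta)%R /\
  forall h t, (Cmod h < eta)%R -> (cmod (z + h) < rho)%R /\ (Cmod (cauchy_kernel (z + h) t) <= / eta)%R /\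
   cauchy_kernel (z + h) t = cauchy_kernel z t + h * cauchy_kernel z t * cauchy_kernel (z + h) t.
Proof.
move=> Hz; exists ((rho - Cmod z) / 2)%R; split; first lra.
have z0 := Cmod_ge_0 z.
move=> h t Hh.
have zh : (cmod (z + h) < rho)%R by have := Cmod_triangle z h; lra.
have nz := circle_minus_nz rho t z Hz. have nzh := circle_minus_nz rho t _ zh.
split=> //; split; last by rewrite /cauchy_kernel; field.
rewrite /cauchy_kernel Cmod_inv //; apply: Rinv_le_contravar; first lra.
have := Cmod_triangle (rho * cis t - (z + h)) (z + h).
replace (rho * cis t - (z + h) + (z + h)) with (rho * cis t) by ring.
rewrite Cmod_circle; last lra. have := Cmod_triangle z h; lra.
Qed.

(** Meant for [kap] polynomial in the kernel: under b = a + h a b the remainder becomes h^2 times a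
    polynomial in a and b, which is bounded because both kernel values are at most 1 / eta. *)
Lemma cderiv_kernel_int (kap dk : C -> C) (Q : C -> C -> C) z :
  (Cmod z < rho)%R ->
  (forall a b h, b = a + h * a * b -> kap b - kap a - h * dk a = h * h * (a * a * b * Q a b)) ->
  (forall x, (0 < x)%R -> exists q, (0 <= q)%R /\ forall a b, (Cmod a <= x)%R -> (Cmod b <= x)%R -> (cmod (a * a * b * Q a b) <= q)%R) ->
  (forall w t, (Cmod w < rho)%R -> R_C_continuous (fun t => kap (cauchy_kernel w t)) t) ->
  (forall w t, (Cmod w < rho)%R -> R_C_continuous (fun t => dk (cauchy_kernel w t)) t) ->
  cderiv (fun w => CInt (fun t => phi t * kap (cauchy_kernel w t)) 0 (2 * PI)) z (CInt (fun t => phi t * dk (cauchy_kernel z t)) 0 (2 * PI)).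
Proof.
move=> Hz E Qb kc dc.
have [M [M0 HM]] := phi_bound.
have [eta [eta0 Heta]] := kern_bounds z Hz.
have [q [q0 Hq]] := Qb (/ eta)%R (Rinv_0_lt_compat _ eta0).
apply: (cderiv_CInt_param (fun w t => phi t * kap (cauchy_kernel w t)) _ _ _ _ eta (M * q)) => //.
- exact: Rlt_le two_PI_pos.
- exact: Rmult_le_pos.
- move=> h Hh t; apply cont_mult; first exact: phi_continuous. apply: kc. exact: (proj1 (Heta h t Hh)).
- move=> t; apply cont_mult; [exact: phi_continuous|exact: dc].
move=> h Hh t Ht.
have [_ [B1 B2]] := Heta h t Hh.
(* The case h = 0 bounds the kernel at z itself. *)
have [_ [A1 _]] := Heta 0 t (ltac:(rewrite Cmod_0; lra)).
replace (z + 0) with z in A1 by ring.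
replace (phi t * kap (cauchy_kernel (z + h) t) - phi t * kap (cauchy_kernel z t) - h * (phi t * dk (cauchy_kernel z t))) with
  (phi t * (kap (cauchy_kernel (z + h) t) - kap (cauchy_kernel z t) - h * dk (cauchy_kernel z t))) by ring.
rewrite (E _ _ _ B2) !Cmod_mult -!Cmod_mult.
rewrite !(Cmod_mult (phi t)) !(Cmod_mult (h * h)) (Cmod_mult h).
have := HM t Ht; have := Hq _ _ A1 B1; have := Cmod_ge_0 h; have := Cmod_ge_0 (phi t).
set X := cmod (_ * _ * _ * _) => u v w u'.
have X0 : (0 <= X)%R by exact: Cmod_ge_0.
have : (Cmod (phi t) * X <= M * q)%R by apply: Rmult_le_compat.
nra.
Qed.

Lemma cderiv_cint1 z : (Cmod z < rho)%R -> cderiv cauchy_int1 z (cauchy_int2 z).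
Proof.
move=> Hz; apply: (cderiv_kernel_int (fun a => a) (fun a => a * a) (fun a b => 1)) => //.
- move=> a b h Eb; transitivity (h * a * b - h * (a * a)).
    rewrite {1}Eb; ring.
  rewrite {1}Eb; ring.
- move=> x x0; exists (x * x * x)%R; split; first nra.
  move=> a b Ha Hb; rewrite !Cmod_mult Cmod_1 Rmult_1_r.
  have [a0 b0] := conj (Cmod_ge_0 a) (Cmod_ge_0 b).
  apply: Rmult_le_compat => //; [nra|apply: Rmult_le_compat => //].
- move=> w t Hw; exact: kern_cont.
- move=> w t Hw; apply cont_mult; exact: kern_cont.
Qed.

(** The cofactor comes from b^2 - a^2 - 2 h a^3 = h a (b - a) (2 a + b), in which b - a = h a b. *)
Lemma cderiv_cint2 z : (Cmod z < rho)%R -> cderiv cauchy_int2 z (cauchy_int3 z).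
Proof.
move=> Hz; apply: (cderiv_kernel_int (fun a => a * a) (fun a => 2 * (a * a * a)) (fun a b => 2 * a + b)) => //.
- move=> a b h Eb. 
  have E1 : h * a * b = b - a by rewrite {2}Eb; ring.
  transitivity ((b - a) * (b + a) - h * (2 * (a * a * a))); first ring.
  rewrite -E1. transitivity (h * a * (a * (b - a) + (b - a) * (b + a))); first by rewrite C2_eq; ring.
  rewrite -E1; rewrite C2_eq; ring.
- move=> x x0; exists (x * x * x * (3 * x))%R; split; first by apply: Rmult_le_pos; [apply: Rmult_le_pos; nra|lra].
  move=> a b Ha Hb; rewrite !Cmod_mult.
  have [a0 b0] := conj (Cmod_ge_0 a) (Cmod_ge_0 b).
  apply: Rmult_le_compat; [apply: Rmult_le_pos => //; nra|exact: Cmod_ge_0|apply: Rmult_le_compat => //; [nra|apply: Rmult_le_compat => //]|].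
  apply: Rle_trans (Cmod_triangle _ _) _; rewrite Cmod_mult Cmod_R Rabs_pos_eq; lra.
- move=> w t Hw; apply cont_mult; exact: kern_cont.
- move=> w t Hw; cont; exact: kern_cont.
Qed.

(** Likewise 2 b^3 - 2 a^3 - 6 h a^4 = 2 h a (b - a) (3 a^2 + 2 a b + b^2). *)
Lemma cderiv_cint3 z : (Cmod z < rho)%R -> cderiv cauchy_int3 z (cauchy_int4 z).
Proof.
move=> Hz; apply: (cderiv_kernel_int (fun a => 2 * (a * a * a)) (fun a => 2 * (3 * (a * a * a * a))) (fun a b => 2 * (3 * (a * a) + 2 * (a * b) + b * b))) => //.
- move=> a b h Eb. 
  have E1 : h * a * b = b - a by rewrite {2}Eb; ring.
  have E3 : RtoC 3 = 1 + 1 + 1 by rewrite -!RtoC_plus; f_equal; ring.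
  transitivity (2 * ((b - a) * (b * b + a * b + a * a)) - 2 * h * a * (a * a * a + a * a * a + a * a * a)); first by rewrite E3; ring.
  rewrite -E1. transitivity (2 * h * a * (a * a * (b - a) + a * (b - a) * (b + a) + (b - a) * (b * b + a * b + a * a))); first ring.
  rewrite -E1 E3 C2_eq; ring.
- move=> x x0; exists (x * x * x * (2 * (6 * (x * x))))%R; split; first by apply: Rmult_le_pos; [apply: Rmult_le_pos; nra|nra].
  move=> a b Ha Hb; rewrite !Cmod_mult.
  have [a0 b0] := conj (Cmod_ge_0 a) (Cmod_ge_0 b).
  have aa : (Cmod a * Cmod a <= x * x)%R by apply: Rmult_le_compat.
  have ab : (Cmod a * Cmod b <= x * x)%R by apply: Rmult_le_compat.
  have bb : (Cmod b * Cmod b <= x * x)%R by apply: Rmult_le_compat.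
  apply: Rmult_le_compat; [apply: Rmult_le_pos => //; nra| |apply: Rmult_le_compat => //; nra|].
    apply: Rmult_le_pos; exact: Cmod_ge_0.
  rewrite Cmod_R Rabs_pos_eq; last lra. apply: Rmult_le_compat_l; first lra.
  apply: Rle_trans (Cmod_triangle _ _) _; have := Cmod_triangle (3 * (a * a)) (2 * (a * b)).
  rewrite !Cmod_mult !Cmod_R !Rabs_pos_eq; lra.
- move=> w t Hw; cont; exact: kern_cont.
- move=> w t Hw; cont; exact: kern_cont.
Qed.
End CauchyKernel.

(** * Regularity of holomorphic functions, Cauchy's estimates, the maximum principle *)

Definition holo (f : C -> C) : Prop := forall z, in_disk z -> exists l, cderiv f z l.

Lemma holo_analytic f : holo f <-> analytic_on_disk f.
Proof.
split=> H z /H [l Hl]; exists l; apply/cderiv_is_derive; exact: Hl.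
Qed.

Lemma cderiv_C_derive f z l : cderiv f z l -> C_derive f z = l.
Proof. move=> /cderiv_is_derive; exact: is_C_derive_unique. Qed.

Lemma holo_cderiv f z : holo f -> in_disk z -> cderiv f z (C_derive f z).
Proof. by move=> H /H [l Hl]; rewrite (cderiv_C_derive _ _ _ Hl). Qed.

Lemma holo_cont f z : holo f -> in_disk z -> C_continuous f z.
Proof. move=> H /H [l]; exact: cderiv_cont. Qed.

Lemma circle_in_disk rho t : (0 <= rho)%R -> (rho < 1)%R -> in_disk (rho * cis t).
Proof. move=> r0 r1; rewrite /in_disk Cmod_circle //. Qed.

Lemma cont_circle f rho t : holo f -> (0 <= rho)%R -> (rho < 1)%R -> R_C_continuous (fun t => f (rho * cis t)) t.
Proof.
move=> H r0 r1; apply cont_comp; first by apply: holo_cont => //; exact: circle_in_disk.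
cont; apply: cont_cis; exact: continuous_id.
Qed.

Lemma cderiv_scal (c : C) f z l : cderiv f z l -> cderiv (fun w => c * f w) z (c * l).
Proof. move=> H; apply: cderiv_eq; first exact: (cderiv_mult (fun _ => c) f _ _ _ (cderiv_const _ _) H). cbv beta; ring. Qed.

Lemma two_PI_nz : RtoC (2 * PI) <> 0.
Proof. move=> /RtoC_inj; have := two_PI_pos; lra. Qed.

Lemma near_in_ball (z h : C) rho : (Cmod h < rho - Cmod z)%R -> (cmod (z + h) < rho)%R.
Proof. have := Cmod_triangle z h; lra. Qed.

(* [f] has a primitive [F] by Goursat's lemma, and Cauchy's formula for [F] can be
   differentiated three times under the integral sign. *)
Theorem holo_derive f : holo f -> holo (C_derive f).
Proof.
move=> Hf.
have [F HF] := primitive f Hf.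
have hF : holo F by move=> z /HF H; exists (f z).
move=> z Hz; rewrite /in_disk in Hz.
set rho := ((1 + Cmod z) / 2)%R.
have z0 := Cmod_ge_0 z.
have [r0 [r1 zr]] : (0 <= rho /\ rho < 1 /\ Cmod z < rho)%R by rewrite /rho; lra.
pose phi t := F (rho * cis t) * (rho * cis t).
have phi_continuous t : R_C_continuous phi t.
  apply cont_mult; first exact: cont_circle. cont; apply: cont_cis; exact: continuous_id.
have FE w : (Cmod w < rho)%R -> F w = / (2 * PI)%R * cauchy_int1 phi rho w.
  move=> Hw; rewrite /cauchy_int1.
  have := cauchy_C1 F f HF (fun z => holo_cont f z Hf) rho w Hw r1.
  have -> : CInt (fun t => phi t * cauchy_kernel rho w t) 0 (2 * PI) = CInt (fun t : R => F (rho * cis t) * (rho * cis t * / (rho * cis t - w))) 0 (2 * PI).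
    f_equal; apply: functional_extensionality => t; rewrite /phi /cauchy_kernel; ring.
  move=> ->; field; exact: two_PI_nz.
have D w : (Cmod w < rho)%R -> in_disk w by move=> Hw; rewrite /in_disk; lra.
have fE w : (Cmod w < rho)%R -> f w = / (2 * PI)%R * cauchy_int2 phi rho w.
  move=> Hw; apply: (cderiv_unique F w); first by apply: HF; exact: D.
  apply: (cderiv_ext_loc (fun w => / (2 * PI)%R * cauchy_int1 phi rho w) _ _ _ (rho - Cmod w)); first lra.
    move=> h Hh; rewrite FE //; exact: near_in_ball.
  apply: cderiv_scal; exact: cderiv_cint1.
have dE w : (Cmod w < rho)%R -> C_derive f w = / (2 * PI)%R * cauchy_int3 phi rho w.
  move=> Hw; apply: cderiv_C_derive.
  apply: (cderiv_ext_loc (fun w => / (2 * PI)%R * cauchy_int2 phi rho w) _ _ _ (rho - Cmod w)); first lra.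
    move=> h Hh; rewrite fE //; exact: near_in_ball.
  apply: cderiv_scal; exact: cderiv_cint2.
exists (/ (2 * PI)%R * cauchy_int4 phi rho z).
apply: (cderiv_ext_loc (fun w => / (2 * PI)%R * cauchy_int3 phi rho w) _ _ _ (rho - Cmod z)); first lra.
  move=> h Hh; rewrite dE //; exact: near_in_ball.
apply: cderiv_scal; exact: cderiv_cint3.
Qed.

(** [cauchy_C1] asks for a continuous derivative, which [holo_derive] supplies. *)
Theorem cauchy_formula f rho z : holo f -> (Cmod z < rho)%R -> (rho < 1)%R ->
  f z = / (2 * PI)%R * cauchy_int1 (fun t => f (rho * cis t) * (rho * cis t)) rho z.
Proof.
move=> Hf zr r1.
have := cauchy_C1 f (C_derive f) (fun w Hw => holo_cderiv f w Hf Hw) (fun w Hw => holo_cont _ w (holo_derive f Hf) Hw) rho z zr r1.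
rewrite /cauchy_int1.
have -> : CInt (fun t => f (rho * cis t) * (rho * cis t) * cauchy_kernel rho z t) 0 (2 * PI) = CInt (fun t : R => f (rho * cis t) * (rho * cis t * / (rho * cis t - z))) 0 (2 * PI).
  f_equal; apply: functional_extensionality => t; rewrite /cauchy_kernel; ring.
move=> ->; field; exact: two_PI_nz.
Qed.

Lemma phi_cont f rho t : holo f -> (0 <= rho)%R -> (rho < 1)%R -> R_C_continuous (fun t => f (rho * cis t) * (rho * cis t)) t.
Proof. move=> Hf r0 r1; apply cont_mult; first exact: cont_circle. cont; apply: cont_cis; exact: continuous_id. Qed.

Lemma cauchy_cderiv f rho z : holo f -> (Cmod z < rho)%R -> (rho < 1)%R ->
  cderiv f z (/ (2 * PI)%R * cauchy_int2 (fun t => f (rho * cis t) * (rho * cis t)) rho z).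
Proof.
move=> Hf zr r1. have r0 := Rle_lt_trans _ _ _ (Cmod_ge_0 z) zr.
apply: (cderiv_ext_loc (fun w => / (2 * PI)%R * cauchy_int1 (fun t => f (rho * cis t) * (rho * cis t)) rho w) _ _ _ (rho - Cmod z)); first lra.
  by move=> h Hh; rewrite -cauchy_formula //; exact: near_in_ball.
apply: cderiv_scal; apply: cderiv_cint1 => // t; apply: phi_cont => //; lra.
Qed.

Lemma nz_Cmod (z : C) : (Cmod z <> 0)%R -> z <> 0.
Proof. by move=> H E; apply: H; rewrite E Cmod_0. Qed.
Lemma Cmod_pos (z : C) : z <> 0 -> (0 < Cmod z)%R.
Proof. by move=> H; apply/(Cmod_gt_0 z). Qed.

Lemma disk0 : in_disk 0.
Proof. rewrite /in_disk Cmod_0; lra. Qed.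

Lemma Cmod_mean f (M : R) : (forall t, R_C_continuous f t) -> (forall t, (Cmod (f t) <= M)%R) -> (cmod (/ (2 * PI)%R * CInt f 0 (2 * PI)) <= M)%R.
Proof.
move=> Hc HM; have p := two_PI_pos.
have := is_CInt_bound f 0 (2 * PI) _ M (Rlt_le _ _ p) (fun t _ => HM t) (CInt_correct f 0 (2 * PI) (Rlt_le _ _ p) (fun t _ => Hc t)).
rewrite Cmod_mult Cmod_inv; last exact: two_PI_nz. rewrite Cmod_R Rabs_pos_eq; last lra.
move=> H; apply: (Rmult_le_reg_l (2 * PI)) => //.
rewrite -Rmult_assoc Rinv_r; last lra. lra.
Qed.

Lemma derive0_bound f M : holo f -> (forall z, in_disk z -> (Cmod (f z) <= M)%R) -> (Cmod (C_derive f 0) <= M)%R.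
Proof.
move=> Hf HM.
have M0 : (0 <= M)%R by apply: Rle_trans (HM _ disk0); exact: Cmod_ge_0.
apply: le_epsilon => eps e0.
(* Then M / rho = M + eps M / (M + 1) <= M + eps; taking M + 1 instead of M admits M = 0. *)
pose rho := ((M + 1) / (M + 1 + eps))%R.
have rE : (rho * (M + 1 + eps) = M + 1)%R by rewrite /rho; field; lra.
have [r0 r1] : (0 < rho < 1)%R.
  split; first by apply: Rdiv_lt_0_compat; lra. nra.
have r00 : (Cmod 0 < rho)%R by rewrite Cmod_0.
rewrite (cderiv_C_derive _ _ _ (cauchy_cderiv f rho 0 Hf r00 r1)).
apply: (Rle_trans _ (M * / rho)).
  apply: Cmod_mean.
    move=> t; apply cont_mult; first by apply: phi_cont => //; lra.
    apply cont_mult; exact: kern_cont.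
  move=> t; rewrite /cauchy_kernel; replace (rho * cis t - 0) with (rho * cis t) by ring.
  have C1 := Cmod_circle rho t (Rlt_le _ _ r0).
  have nz : rho * cis t <> 0 by apply/Cmod_gt_0; rewrite C1.
  have -> : f (rho * cis t) * (rho * cis t) * (/ (rho * cis t) * / (rho * cis t)) = f (rho * cis t) * / (rho * cis t).
    by move: (rho * cis t) nz => w nz; field.
  rewrite Cmod_mult Cmod_inv // C1; apply: Rmult_le_compat_r; first exact/Rlt_le/Rinv_0_lt_compat.
  apply: HM; exact: (circle_in_disk _ _ (Rlt_le _ _ r0)).
apply: (Rmult_le_reg_r rho) => //; rewrite Rmult_assoc Rinv_l; last lra. nra.
Qed.

Lemma circle_bound f rho M z : holo f -> (Cmod z < rho)%R -> (rho < 1)%R ->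
  (forall t, (cmod (f (rho * cis t)) <= M)%R) -> (Cmod (f z) <= M * (rho / (rho - Cmod z)))%R.
Proof.
move=> Hf zr r1 HM. have r0 := Rle_lt_trans _ _ _ (Cmod_ge_0 z) zr.
rewrite (cauchy_formula f rho z Hf zr r1).
apply: Cmod_mean.
  move=> t; apply cont_mult; first by apply: phi_cont => //; lra. exact: kern_cont.
move=> t; rewrite !Cmod_mult /cauchy_kernel Cmod_inv; last exact: circle_minus_nz.
have C1 := Cmod_circle rho t (Rlt_le _ _ r0); rewrite Cmod_mult in C1.
rewrite Rmult_assoc; apply: Rmult_le_compat; [exact: Cmod_ge_0| |exact: HM|].
  apply: Rmult_le_pos; first by rewrite C1; lra.
  apply/Rlt_le/Rinv_0_lt_compat; apply/Cmod_gt_0; exact: circle_minus_nz.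
rewrite C1; apply: Rmult_le_compat_l; first lra.
apply: Rinv_le_contravar; first lra.
have := Cmod_triangle (rho * cis t - z) z; replace (rho * cis t - z + z) with (rho * cis t) by ring.
rewrite Cmod_mult C1; lra.
Qed.

Fixpoint cpow (z : C) (n : nat) : C := if n is S m then z * cpow z m else 1.

Lemma Cmod_cpow z n : (Cmod (cpow z n) = Cmod z ^ n)%R.
Proof. by elim: n => [|n IH] /=; rewrite ?Cmod_1 // Cmod_mult IH. Qed.

Lemma holo_mult f g : holo f -> holo g -> holo (fun z => f z * g z).
Proof. move=> Hf Hg z Hz; have [a Ha] := Hf z Hz; have [b Hb] := Hg z Hz; eexists; exact: cderiv_mult Ha Hb. Qed.

Lemma holo_cpow f n : holo f -> holo (fun z => cpow (f z) n).
Proof.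
move=> Hf; elim: n => [|n IH] /=; first by move=> z _; eexists; exact: cderiv_const.
exact: holo_mult.
Qed.

(* Cauchy's formula only gives [M] times a constant depending on [z]; applying it to the powers
   of [f] removes the constant. *)
Theorem maximum_modulus f rho M z : holo f -> (Cmod z < rho)%R -> (rho < 1)%R ->
  (forall t, (cmod (f (rho * cis t)) <= M)%R) -> (Cmod (f z) <= M)%R.
Proof.
move=> Hf zr r1 HM.
have M0 : (0 <= M)%R by apply: Rle_trans (HM 0%R); exact: Cmod_ge_0.
have fz0 := Cmod_ge_0 (f z).
apply: Rnot_lt_le => H.
set c := (rho / (rho - Cmod z))%R.
have c0 : (0 < c)%R by apply: Rdiv_lt_0_compat; have := Cmod_ge_0 z; lra.
have B n : (Cmod (f z) ^ n <= M ^ n * c)%R.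
  rewrite -Cmod_cpow; apply: (circle_bound (fun z => cpow (f z) n) rho) => //; first exact: holo_cpow.
  move=> t; rewrite Cmod_cpow; apply: pow_incr; split; [exact: Cmod_ge_0|exact: HM].
case: (Req_dec M 0) => [ME|Mn].
  have := B 1%nat; rewrite ME /=; lra.
have Mp : (0 < M)%R by lra.
have q1 : (1 < Cmod (f z) / M)%R.
  apply: (Rmult_lt_reg_r M) => //; rewrite /Rdiv Rmult_assoc Rinv_l; lra.
have [n Hn] := Pow_x_infinity (Cmod (f z) / M) (ltac:(rewrite Rabs_pos_eq; lra)) (c + 1)%R.
have := Hn n (Nat.le_refl _).
rewrite Rabs_pos_eq; last by apply: pow_le; lra.
rewrite /Rdiv Rpow_mult_distr pow_inv.
have Mn0 := pow_lt M n Mp.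
have := B n => Bn.
have : (Cmod (f z) ^ n * / M ^ n <= c)%R.
  apply: (Rmult_le_reg_r (M ^ n)) => //; rewrite Rmult_assoc Rinv_l; lra.
lra.
Qed.

Lemma holo_ext f g : (forall z, in_disk z -> f z = g z) -> holo f -> holo g.
Proof.
move=> E Hf z Hz; have [l Hl] := Hf z Hz; exists l.
apply: (cderiv_ext_loc f _ _ _ (1 - Cmod z)); [rewrite /in_disk in Hz; lra| |exact: Hl].
move=> h Hh; apply: E; exact: near_in_ball.
Qed.

(** Subtracting Cauchy's formulas at h and at 0 leaves h times the Cauchy integral of f over the
    circle of radius 1/2, now without the factor rho cis t; that integral extends f(z) / z
    holomorphically through 0. *)
Theorem div_by_z f : holo f -> f 0 = 0 -> exists k, holo k /\ forall z, in_disk z -> f z = z * k z.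
Proof.
move=> Hf f0.
pose k (z : C) : C := if Req_dec_T (Cmod z) 0 is left _ then C_derive f 0 else f z / z.
have kE (z : C) : z <> 0 -> k z = f z / z.
  move=> /Cmod_pos H; rewrite /k; case: Req_dec_T => // E; lra.
have k0 : k 0 = C_derive f 0 by rewrite /k; case: Req_dec_T => // []; rewrite Cmod_0.
exists k; split; last first.
  move=> z Hz; case: (Req_dec (Cmod z) 0) => [/Cmod_eq_0 ->|/nz_Cmod nz]; first by rewrite f0; ring.
  rewrite kE //; field; exact: nz.
move=> z Hz.
case: (Req_dec (Cmod z) 0) => [/Cmod_eq_0 z0|H].
- have r00 : (Cmod 0 < /2)%R by rewrite Cmod_0; lra.
  have r1 : (/2 < 1)%R by lra.
  pose phi t := f ((/2)%R * cis t).
  have phi_continuous t : R_C_continuous phi t by apply: cont_circle => //; lra.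
  exists (/ (2 * PI)%R * cauchy_int2 phi (/2) z).
  rewrite z0.
  apply: (cderiv_ext_loc (fun w => / (2 * PI)%R * cauchy_int1 phi (/2) w) _ _ _ (/2)); first lra; last first.
    by apply: cderiv_scal; apply: cderiv_cint1.
  move=> h Hh; replace (0 + h) with h by ring.
  case: (Req_dec (Cmod h) 0) => [/Cmod_eq_0 ->|Hnz].
    rewrite k0 (cderiv_C_derive _ _ _ (cauchy_cderiv f (/2) 0 Hf r00 r1)); f_equal.
    rewrite /cauchy_int1 /cauchy_int2; f_equal; apply: functional_extensionality => t.
    rewrite /cauchy_kernel /phi; replace ((/2)%R * cis t - 0) with ((/2)%R * cis t) by ring.
    have nzw : (/2)%R * cis t <> 0 by apply/Cmod_gt_0; rewrite Cmod_circle; lra.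
    by move: ((/2)%R * cis t) nzw => w nzw; field.
  have nz := nz_Cmod h Hnz.
  rewrite kE //.
  have E : f h - f 0 = h * (/ (2 * PI)%R * cauchy_int1 phi (/ 2) h).
    rewrite (cauchy_formula f (/2) h Hf Hh r1) (cauchy_formula f (/2) 0 Hf r00 r1).
    have p0 := Rlt_le _ _ two_PI_pos.
    have I1 : is_CInt (fun t => phi t * ((/2)%R * cis t) * cauchy_kernel (/2) h t) 0 (2 * PI) (cauchy_int1 (fun t => phi t * ((/2)%R * cis t)) (/2) h).
      apply: CInt_correct => // t _; apply cont_mult; last exact: kern_cont. by apply: phi_cont => //; lra.
    have I2 : is_CInt (fun t => phi t * ((/2)%R * cis t) * cauchy_kernel (/2) 0 t) 0 (2 * PI) (cauchy_int1 (fun t => phi t * ((/2)%R * cis t)) (/2) 0).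
      apply: CInt_correct => // t _; apply cont_mult; last exact: kern_cont. by apply: phi_cont => //; lra.
    have I3 := is_CInt_minus _ _ _ _ _ _ I1 I2.
    have I4 : is_CInt (fun t => h * (phi t * cauchy_kernel (/2) h t)) 0 (2 * PI) (h * cauchy_int1 phi (/2) h).
      apply: is_CInt_scal; apply: CInt_correct => // t _; apply cont_mult => //; exact: kern_cont.
    have := is_CInt_unique _ _ _ _ _ I4; move=> /(_ (cauchy_int1 (fun t => phi t * ((/2)%R * cis t)) (/2) h - cauchy_int1 (fun t => phi t * ((/2)%R * cis t)) (/2) 0)) U.
    transitivity (/ (2 * PI)%R * (h * cauchy_int1 phi (/2) h)); last ring.
    rewrite U; first by rewrite /phi; ring.
    apply: is_CInt_ext I3 => t; rewrite /cauchy_kernel.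
    replace ((/2)%R * cis t - 0) with ((/2)%R * cis t) by ring.
    have nzw : (/2)%R * cis t <> 0 by apply/Cmod_gt_0; rewrite Cmod_circle; lra.
    have := circle_minus_nz (/2) t h Hh.
    by move: (phi t) ((/2)%R * cis t) nzw => x w nzw nzh; field.
  rewrite f0 in E; replace (f h) with (f h - 0) by ring; rewrite E; field; repeat split; first [exact: two_PI_nz | exact: nz].
- have nz := nz_Cmod z H.
  have [l Hl] := Hf z Hz.
  eexists; apply: (cderiv_ext_loc (fun w => f w * / w) _ _ _ (Cmod z)); last exact: (cderiv_mult f Cinv _ _ _ Hl (cderiv_inv z nz)).
    have := Cmod_ge_0 z; lra.
  move=> h Hh; rewrite kE // => E.
  have Eh : z = - h by replace z with (z + h - h) by ring; rewrite E; ring.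
  by rewrite Eh Cmod_opp in Hh; lra.
Qed.

(** * The lemmas of Schwarz, Schwarz-Pick and Dieudonné *)

Lemma Cmod_sqr (z : C) : (Cmod z * Cmod z = Re z * Re z + Im z * Im z)%R.
Proof. have := Cmod2_alt z; lra. Qed.

Lemma Cmod_lt_sqr (x y : C) : (Re x * Re x + Im x * Im x < Re y * Re y + Im y * Im y)%R -> (Cmod x < Cmod y)%R.
Proof. rewrite -!Cmod_sqr; have := Cmod_ge_0 x; have := Cmod_ge_0 y; nra. Qed.

Lemma schwarz_bound k : holo k -> (forall z, in_disk z -> (Cmod (z * k z)%C < 1)%R) ->
  forall z, in_disk z -> (Cmod (k z) <= 1)%R.
Proof.
move=> Hk H z Hz; rewrite /in_disk in Hz.
apply: Rnot_lt_le => K.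
set s := (Cmod (k z)) in K.
have z0 := Cmod_ge_0 z.
(* With s = |k z| > 1, this circle encloses z and has 1 / rho < s, against the bound 1 / rho given
   by the maximum principle. *)
pose rho := Rmax ((1 + Cmod z) / 2) ((1 + / s) / 2).
have si : (/ s < 1)%R by rewrite -Rinv_1; apply: Rinv_lt_contravar; lra.
have r1 : (rho < 1)%R by apply: Rmax_lub_lt; lra.
have zr : (Cmod z < rho)%R by apply: Rlt_le_trans (Rmax_l _ _); lra.
have sr : (/ s < rho)%R by apply: Rlt_le_trans (Rmax_r _ _); lra.
have r0 : (0 < rho)%R by lra.
have : (Cmod (k z) <= / rho)%R.
  apply: (maximum_modulus k rho) => // t.
  have := H _ (circle_in_disk rho t (Rlt_le _ _ r0) r1).
  rewrite Cmod_mult Cmod_circle; last lra. move=> Hl.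
  apply: (Rmult_le_reg_l rho) => //; rewrite Rinv_r; lra.
rewrite -/s => L.
have : (s * rho <= 1)%R by apply: (Rmult_le_reg_r (/ rho)); [exact: Rinv_0_lt_compat|rewrite Rmult_assoc Rinv_r; lra].
have : (/ s * s = 1)%R by field; lra.
nra.
Qed.

(** The squares of the two sides differ by (1 - |a|^2) (1 - |z|^2). *)
Lemma moebius_lt (a z : C) : (Cmod a < 1)%R -> (Cmod z < 1)%R -> (cmod (z + a) < cmod (1 + Cconj a * z))%R.
Proof.
move=> Ha Hz; apply: Cmod_lt_sqr.
have Ea := Cmod_sqr a; have Ez := Cmod_sqr z; have a0 := Cmod_ge_0 a; have z0 := Cmod_ge_0 z.
have A1 : (Re a * Re a + Im a * Im a < 1)%R by nra.
have Z1 : (Re z * Re z + Im z * Im z < 1)%R by nra.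
case: a A1 {Ha Ea a0} => a1 a2; case: z Z1 {Hz Ez z0} => z1 z2 /= Z1 A1.
have : (0 < (1 - (z1 * z1 + z2 * z2)) * (1 - (a1 * a1 + a2 * a2)))%R by apply: Rmult_lt_0_compat; lra.
lra.
Qed.

(** The disk automorphism m sends 0 to a, and n sends the value at a to 0; Cauchy's estimate at 0
    for the composite of m, k and n is the inequality. As |k| may equal 1, where n degenerates, the
    argument is run for s k with s < 1, and then s tends to 1. *)
Theorem schwarz_pick k : holo k -> (forall z, in_disk z -> (Cmod (k z) <= 1)%R) ->
  forall a, in_disk a -> (Cmod (C_derive k a) * (1 - Cmod a * Cmod a) <= 1 - Cmod (k a) * Cmod (k a))%R.
Proof.
move=> Hk Kb a Ha.
have a0 := Cmod_ge_0 a. have k0 := Cmod_ge_0 (k a). have k1 := Kb a Ha.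
have scaled s : (0 < s < 1)%R -> (s * (Cmod (C_derive k a) * (1 - Cmod a * Cmod a)) <= 1 - s * s * (Cmod (k a) * Cmod (k a)))%R.
  move=> s01.
  pose m z := (z + a) * / (1 + Cconj a * z).
  pose b := s * k a.
  have gb z : in_disk z -> (cmod (s * k z) < 1)%R.
    move=> /Kb; rewrite Cmod_mult Cmod_R Rabs_pos_eq; last lra. have := Cmod_ge_0 (k z); nra.
  have b1 : (Cmod b < 1)%R by exact: gb.
  have mnz z : in_disk z -> 1 + Cconj a * z <> 0.
    move=> Hz; apply/Cmod_gt_0; apply: Rle_lt_trans (moebius_lt a z Ha Hz); exact: Cmod_ge_0.
  have quot x y : (Cmod x < Cmod y)%R -> in_disk (x * / y).
    move=> H; have := Cmod_ge_0 x => x0.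
    rewrite /in_disk Cmod_mult Cmod_inv; last by apply/Cmod_gt_0; lra.
    apply: (Rmult_lt_reg_r (Cmod y)); first lra. rewrite Rmult_assoc Rinv_l; lra.
  have mD z : in_disk z -> in_disk (m z) by move=> Hz; apply: quot; exact: moebius_lt.
  pose n w := (s * k w - b) * / (1 - Cconj b * (s * k w)).
  have nlt w : in_disk w -> (cmod (s * k w - b) < cmod (1 - Cconj b * (s * k w)))%R.
    move=> Hw; have := moebius_lt (- b) (s * k w); rewrite Cmod_opp => /(_ b1 (gb w Hw)).
    replace (1 + Cconj (- b) * (s * k w)) with (1 - Cconj b * (s * k w)); first done.
    replace (Cconj (- b)) with (- Cconj b); first ring. by case: (b) => x y; rewrite /Cconj /Copp /=.
  have nnz w : in_disk w -> 1 - Cconj b * (s * k w) <> 0.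
    move=> Hw; apply/Cmod_gt_0; apply: Rle_lt_trans (nlt w Hw); exact: Cmod_ge_0.
  have CDm z : in_disk z -> cderiv m z ((1 - Cconj a * a) * (/ (1 + Cconj a * z) * / (1 + Cconj a * z))).
    move=> Hz; have nz := mnz z Hz.
    apply: cderiv_eq.
      apply: (cderiv_mult (fun z => z + a) (fun z => / (1 + Cconj a * z))).
        exact: (cderiv_plus (fun z => z) (fun _ => a) _ _ _ (cderiv_id _) (cderiv_const _ _)).
      apply: (cderiv_comp Cinv (fun z => 1 + Cconj a * z)); first exact: cderiv_inv.
      exact: (cderiv_plus (fun z => 1) (fun z => Cconj a * z) _ _ _ (cderiv_const _ _) (cderiv_scal _ _ _ _ (cderiv_id _))).
    cbv beta; field; exact: nz.
  have CDn w : in_disk w -> cderiv n w (s * C_derive k w * (1 - Cconj b * b) * (/ (1 - Cconj b * (s * k w)) * / (1 - Cconj b * (s * k w)))).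
    move=> Hw; have nz := nnz w Hw. have Hkw := cderiv_scal s _ _ _ (holo_cderiv k w Hk Hw).
    apply: cderiv_eq.
      apply: (cderiv_mult (fun w => s * k w - b) (fun w => / (1 - Cconj b * (s * k w)))).
        exact: (cderiv_minus (fun w => s * k w) (fun _ => b) _ _ _ Hkw (cderiv_const _ _)).
      apply: (cderiv_comp Cinv (fun w => 1 - Cconj b * (s * k w))); first exact: cderiv_inv.
      exact: (cderiv_minus (fun z => 1) (fun w => Cconj b * (s * k w)) _ _ _ (cderiv_const _ _) (cderiv_scal _ _ _ _ Hkw)).
    cbv beta; field; exact: nz.
  have m0 : m 0 = a by rewrite /m; replace (1 + Cconj a * 0) with (RtoC 1) by ring; field.
  have HD : holo (fun z => n (m z)).
    move=> z Hz; eexists; apply: cderiv_comp; [exact: (CDn _ (mD z Hz))|exact: (CDm z Hz)].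
  have := derive0_bound (fun z => n (m z)) 1 HD (fun z Hz => Rlt_le _ _ (quot _ _ (nlt _ (mD z Hz)))).
  have Cc x : Cconj x * x = RtoC (Cmod x * Cmod x).
    rewrite Cmod_sqr; case: x => x y; rewrite /Cconj /Cmult /RtoC /=; f_equal; ring.
  have D0 : cderiv (fun z => n (m z)) 0 ((1 - Cconj a * a) * (s * C_derive k a * / (1 - Cconj b * b))).
    apply: cderiv_eq; first by apply: cderiv_comp; [exact: (CDn _ (mD 0 disk0))|exact: (CDm 0 disk0)].
    rewrite m0 -/b; replace (1 + Cconj a * 0) with (RtoC 1) by ring.
    field; exact: (nnz a Ha).
  rewrite (cderiv_C_derive _ _ _ D0) !Cc -!RtoC_minus -RtoC_inv; last first.
    apply: Rgt_not_eq; have := Cmod_ge_0 b; nra.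
  rewrite 3!Cmod_mult.
  have b0 := Cmod_ge_0 b.
  have ib : (0 < 1 - Cmod b * Cmod b)%R by nra.
  rewrite /in_disk in Ha.
  rewrite !Cmod_R (Rabs_pos_eq s); last lra. rewrite (Rabs_pos_eq (1 - _)); last nra.
  rewrite Rabs_pos_eq; last exact/Rlt_le/Rinv_0_lt_compat.
  move=> H.
  have bE : (Cmod b * Cmod b = s * s * (Cmod (k a) * Cmod (k a)))%R.
    rewrite /b Cmod_mult Cmod_R Rabs_pos_eq; [ring|lra].
  rewrite -bE; apply: (Rmult_le_reg_r (/ (1 - Cmod b * Cmod b))); first exact: Rinv_0_lt_compat.
  rewrite Rinv_r; last lra. lra.
set X := (Cmod (C_derive k a) * _)%R in scaled *; set Y := (Cmod (k a) * Cmod (k a))%R in scaled *.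
have X0 : (0 <= X)%R.
  apply: Rmult_le_pos; first exact: Cmod_ge_0. rewrite /in_disk in Ha; nra.
have Y0 : (0 <= Y)%R by rewrite /Y; nra.
apply: le_epsilon => eps e0.
(* For s = 1 - t the loss is at most t (X + 2 Y), hence at most eps. *)
pose t := Rmin (/2) (eps / (X + 2 * Y + 1)).
have t0 : (0 < t)%R by apply: Rmin_glb_lt; [lra|apply: Rdiv_lt_0_compat; lra].
have t1 : (t <= /2)%R by exact: Rmin_l.
have t2 : (t * (X + 2 * Y + 1) <= eps)%R.
  have -> : eps = (eps / (X + 2 * Y + 1) * (X + 2 * Y + 1))%R by field; lra.
  apply: Rmult_le_compat_r; [lra|exact: Rmin_r].
have := scaled (1 - t)%R (ltac:(lra)). nra.
Qed.

(* Write [w = z k] and apply Schwarz-Pick to [k]. *)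
Theorem schwarz_dieudonne w z : holo w -> (forall z, in_disk z -> in_disk (w z)) -> w 0 = 0 -> in_disk z ->
  (Cmod (w z) <= Cmod z)%R /\
  (cmod (z * C_derive w z - w z) * (1 - Cmod z * Cmod z) <= Cmod z * Cmod z - Cmod (w z) * Cmod (w z))%R.
Proof.
move=> Hw wD w0 Hz.
have [k [Hk kE]] := div_by_z w Hw w0.
have kb := schwarz_bound k Hk (fun z Hz => eq_ind _ in_disk (wD z Hz) _ (kE z Hz)).
have z0 := Cmod_ge_0 z.
have k0 := Cmod_ge_0 (k z).
split; first by rewrite kE // Cmod_mult; have := kb z Hz; nra.
have D : cderiv w z (k z + z * C_derive k z).
  apply: (cderiv_ext_loc (fun z => z * k z) _ _ _ (1 - Cmod z)); first by rewrite /in_disk in Hz; lra.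
    by move=> h Hh; rewrite kE //; exact: near_in_ball.
  apply: cderiv_eq; first exact: (cderiv_mult (fun z => z) k _ _ _ (cderiv_id z) (holo_cderiv k z Hk Hz)).
  cbv beta; ring.
rewrite (cderiv_C_derive _ _ _ D) (kE z Hz).
replace (z * (k z + z * C_derive k z) - z * k z) with (z * z * C_derive k z) by ring.
rewrite !Cmod_mult.
have := schwarz_pick k Hk kb z Hz. nra.
Qed.

(** * Exponential, square root and logarithm *)

Lemma Cexp_plus a b : Cexp (a + b) = Cexp a * Cexp b.
Proof.
case: a => a1 a2; case: b => b1 b2; rewrite /Cexp /Cmult /Cplus /=.
rewrite exp_plus cos_plus sin_plus; f_equal; ring.
Qed.
Lemma Cexp_0 : Cexp 0 = 1.
Proof. rewrite /Cexp /RtoC /= exp_0 cos_0 sin_0; f_equal; ring. Qed.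
Lemma Cexp_opp a : Cexp (- a) * Cexp a = 1.
Proof. by rewrite -Cexp_plus; replace (- a + a) with (RtoC 0) by ring; exact: Cexp_0. Qed.
Lemma Cexp_nz a : Cexp a <> 0.
Proof.
move=> E; have := Cexp_opp a; rewrite E; replace (Cexp (- a) * 0) with (RtoC 0) by ring.
move=> /RtoC_inj; lra.
Qed.
Lemma Cexp_opp_inv a : Cexp (- a) = / Cexp a.
Proof.
transitivity (Cexp (- a) * Cexp a * / Cexp a); first by field; exact: Cexp_nz.
rewrite Cexp_opp; ring.
Qed.
Lemma Cmod_Cexp z : Cmod (Cexp z) = exp (Re z).
Proof.
rewrite /Cexp; have -> : ((exp (Re z) * cos (Im z))%R, (exp (Re z) * sin (Im z))%R) = exp (Re z) * cis (Im z).
  rewrite /cis /Cmult /RtoC /=; f_equal; ring.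
apply: Cmod_circle; exact/Rlt_le/exp_pos.
Qed.
Lemma cderiv_Cexp_0 : cderiv Cexp 0 1.
Proof.
move=> eps e0.
(* The four error terms below add up to 9 e1 |h|. *)
pose e1 := Rmin 1 (eps / 10).
have e10 : (0 < e1)%R by apply: Rmin_glb_lt; lra.
have e11 : (e1 <= 1)%R by exact: Rmin_l.
have e12 : (e1 <= eps / 10)%R by exact: Rmin_r.
have [d1 [d10 H1]] := proj1 (Rderive_eps exp 0 _) (is_derive_exp 0) e1 e10.
have [d2 [d20 H2]] := proj1 (Rderive_eps cos 0 _) (is_derive_cos 0) e1 e10.
have [d3 [d30 H3]] := proj1 (Rderive_eps sin 0 _) (is_derive_sin 0) e1 e10.
exists (Rmin e1 (Rmin d1 (Rmin d2 d3))); split; first by do 3 (apply: Rmin_glb_lt => //).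
case=> a b Hh.
have L0 := Rlt_le_trans _ _ _ Hh (Rmin_l _ _).
have L1 := Rlt_le_trans _ _ _ Hh (Rle_trans _ _ _ (Rmin_r _ _) (Rmin_l _ _)).
have L2 := Rlt_le_trans _ _ _ Hh (Rle_trans _ _ _ (Rmin_r _ _) (Rle_trans _ _ _ (Rmin_r _ _) (Rmin_l _ _))).
have L3 := Rlt_le_trans _ _ _ Hh (Rle_trans _ _ _ (Rmin_r _ _) (Rle_trans _ _ _ (Rmin_r _ _) (Rmin_r _ _))).
have Ha := re_le_Cmod (a, b); have Hb := im_le_Cmod (a, b); rewrite /= in Ha Hb.
set c := Cmod (a, b) in Hh L0 L1 L2 L3 Ha Hb *.
have c0 : (0 <= c)%R by exact: Cmod_ge_0.
have := H1 a (ltac:(lra)); have := H2 b (ltac:(lra)); have := H3 b (ltac:(lra)).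
rewrite !Rplus_0_l exp_0 cos_0 sin_0.
replace (cos b - 1 - b * - 0)%R with (cos b - 1)%R by ring.
replace (sin b - 0 - b * 1)%R with (sin b - b)%R by ring.
replace (exp a - 1 - a * 1)%R with (exp a - 1 - a)%R by ring.
move=> K3 K2 K1.
have K1' : (Rabs (exp a - 1 - a) <= e1 * c)%R by apply: Rle_trans K1 _; apply: Rmult_le_compat_l; lra.
have K2' : (Rabs (cos b - 1) <= e1 * c)%R by apply: Rle_trans K2 _; apply: Rmult_le_compat_l; lra.
have K3' : (Rabs (sin b - b) <= e1 * c)%R by apply: Rle_trans K3 _; apply: Rmult_le_compat_l; lra.
have X : (Rabs (exp a - 1) <= 2 * c)%R.
  replace (exp a - 1)%R with ((exp a - 1 - a) + a)%R by ring.
  apply: Rle_trans (Rabs_triang _ _) _; nra.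
have ea : (Rabs (exp a) <= 3)%R.
  replace (exp a)%R with ((exp a - 1) + 1)%R by ring.
  apply: Rle_trans (Rabs_triang _ _) _; rewrite Rabs_R1; nra.
apply: Rle_trans (Cmod_le_Re_Im _) _; rewrite /= .
rewrite !Rplus_0_l exp_0 cos_0 sin_0.
replace (exp a * cos b + - (1 * 1) + - (a * 1 - b * 0))%R with (exp a * (cos b - 1) + (exp a - 1 - a))%R by ring.
replace (exp a * sin b + - (1 * 0) + - (a * 0 + b * 1))%R with (exp a * (sin b - b) + (exp a - 1) * b)%R by ring.
have T1 := Rabs_triang (exp a * (cos b - 1)) (exp a - 1 - a).
have T2 := Rabs_triang (exp a * (sin b - b)) ((exp a - 1) * b).
rewrite !Rabs_mult in T1 T2.
have M1 : (Rabs (exp a) * Rabs (cos b - 1) <= 3 * (e1 * c))%R by apply: Rmult_le_compat; try exact: Rabs_pos.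
have M2 : (Rabs (exp a) * Rabs (sin b - b) <= 3 * (e1 * c))%R by apply: Rmult_le_compat; try exact: Rabs_pos.
have M3 : (Rabs (exp a - 1) * Rabs b <= 2 * c * e1)%R by apply: Rmult_le_compat; try exact: Rabs_pos; lra.
have : (9 * (e1 * c) <= eps * c)%R by nra.
lra.
Qed.

Lemma cderiv_Cexp z : cderiv Cexp z (Cexp z).
Proof.
apply: (cderiv_ext_loc (fun w => Cexp z * Cexp (- z + w)) _ _ _ 1); first lra.
  by move=> h _; rewrite -Cexp_plus; f_equal; ring.
apply: cderiv_eq; first apply: (cderiv_scal (Cexp z) (fun w => Cexp (- z + w)) _ (1 * 1)); last ring.
apply: (cderiv_comp Cexp (fun w => - z + w)).
  by replace (- z + z) with (RtoC 0) by ring; exact: cderiv_Cexp_0.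
apply: cderiv_eq; first exact: (cderiv_plus (fun _ => - z) (fun w => w) _ _ _ (cderiv_const _ _) (cderiv_id _)). ring.
Qed.

(** Serves for the square root and the logarithm, both continuous right inverses. Continuity makes
    the increment k of L small; as E has the nonzero derivative m at L z, |k| |m| <= 2 |h|, so an
    error small relative to k is small relative to h. *)
Lemma cderiv_inverse (E L : C -> C) (z m : C) (d : R) : (0 < d)%R -> m <> 0 -> cderiv E (L z) m -> C_continuous L z ->
  (forall h, (Cmod h < d)%R -> E (L (z + h)) = z + h) -> cderiv L z (/ m).
Proof.
move=> d0 m0 HE HL EL eps e0.
have mp := Cmod_pos m m0.
pose e1 := Rmin (Cmod m / 2) (eps * (Cmod m * Cmod m) / 2).
have e10 : (0 < e1)%R.
  apply: Rmin_glb_lt; first lra. apply: Rdiv_lt_0_compat; last lra. apply: Rmult_lt_0_compat => //; nra.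
have [d1 [d10 H1]] := HE e1 e10.
have [d2 [d20 H2]] := HL d1 d10.
exists (Rmin d d2); split; first exact: Rmin_glb_lt.
move=> h Hh.
have := H1 _ (H2 h (Rlt_le_trans _ _ _ Hh (Rmin_r _ _))).
set k := L (z + h) - L z.
have -> : L z + k = L (z + h) by rewrite /k; ring.
rewrite EL; last exact: (Rlt_le_trans _ _ _ Hh (Rmin_l _ _)).
have -> : E (L z) = z.
  have := EL 0; rewrite Cmod_0; replace (z + 0) with z by ring; exact.
replace (z + h - z - k * m) with (- (k * m - h)) by ring; rewrite Cmod_opp => Hk.
have k0 := Cmod_ge_0 k. have h0 := Cmod_ge_0 h.
have kb : (Cmod k * Cmod m <= 2 * Cmod h)%R.
  have := Cmod_triangle (k * m - h) h; replace (k * m - h + h) with (k * m) by ring.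
  rewrite Cmod_mult; have : (e1 * Cmod k <= Cmod m / 2 * Cmod k)%R by apply: Rmult_le_compat_r => //; exact: Rmin_l.
  lra.
replace (k - h * / m) with ((k * m - h) * / m) by (field; exact: m0).
rewrite Cmod_mult Cmod_inv //.
apply: (Rmult_le_reg_r (Cmod m * Cmod m)); first nra.
replace (cmod (k * m - h) * / Cmod m * (Cmod m * Cmod m))%R with (cmod (k * m - h) * Cmod m)%R by (field; lra).
have : (e1 * Cmod k <= eps * (Cmod m * Cmod m) / 2 * Cmod k)%R by apply: Rmult_le_compat_r => //; exact: Rmin_r.
move=> B.
have B2 : (cmod (k * m - h) * Cmod m <= eps * (Cmod m * Cmod m) / 2 * Cmod k * Cmod m)%R by apply: Rmult_le_compat_r; lra.
apply: Rle_trans B2 _.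
have : (0 <= eps * (Cmod m * Cmod m) / 2)%R by apply: Rlt_le; apply: Rdiv_lt_0_compat; [apply: Rmult_lt_0_compat => //; nra|lra].
nra.
Qed.

Lemma Csqrt_sqr (z : C) : Csqrt z * Csqrt z = z.
Proof.
have := Cmod_sqr z; have m0 := Cmod_ge_0 z.
have := re_le_Cmod z; case: z m0 => x y; set m := Cmod (x, y) => m0 /= Hx Hm.
have [h1 h2] := proj1 (Rabs_le_between _ _) Hx.
rewrite /Csqrt -/m /Re /Im /=; set p := sqrt ((m + x) / 2); set q := sqrt ((m - x) / 2).
have pp : (p * p = (m + x) / 2)%R by apply: sqrt_sqrt; lra.
have qq : (q * q = (m - x) / 2)%R by apply: sqrt_sqrt; lra.
have pq : (p * q = Rabs y / 2)%R.
  rewrite /p /q -sqrt_mult; [|lra|lra].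
  have -> : ((m + x) / 2 * ((m - x) / 2) = (Rabs y / 2) * (Rabs y / 2))%R.
    have : (Rabs y * Rabs y = y * y)%R by rewrite -Rabs_mult Rabs_pos_eq //; nra.
    nra.
  rewrite sqrt_square //; have := Rabs_pos y; lra.
case: Rle_dec => Hy; rewrite /Cmult /=; f_equal.
- lra.
- rewrite Rabs_pos_eq in pq; lra.
- lra.
- rewrite Rabs_left in pq; lra.
Qed.

Lemma Csqrt_Re_ge0 z : (0 <= Re (Csqrt z))%R.
Proof. exact: sqrt_pos. Qed.

Lemma Csqrt_Re_pos z : (0 < Re z)%R -> (0 < Re (Csqrt z))%R.
Proof. move=> H; apply: sqrt_lt_R0; have := Cmod_ge_0 z; lra. Qed.

(** The increment of the root times the sum of the two roots is h, and that sum has real part at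
    least Re (Csqrt z) > 0, because principal roots have nonnegative real part. *)
Lemma Csqrt_cont (z : C) : (0 < Re z)%R -> C_continuous Csqrt z.
Proof.
move=> Hz eps e0; have R0 := Csqrt_Re_pos z Hz.
exists (eps * Re (Csqrt z))%R; split; first exact: Rmult_lt_0_compat.
move=> h Hh.
have E : (Csqrt (z + h) - Csqrt z) * (Csqrt (z + h) + Csqrt z) = h.
  transitivity (Csqrt (z + h) * Csqrt (z + h) - Csqrt z * Csqrt z); first ring.
  rewrite !Csqrt_sqr; ring.
have := f_equal Cmod E; rewrite Cmod_mult.
have S : (Re (Csqrt z) <= cmod (Csqrt (z + h) + Csqrt z))%R.
  apply: Rle_trans (re_le_Cmod _); apply: Rle_trans (Rle_abs _).
  have := Csqrt_Re_ge0 (z + h); rewrite /Re /=; lra.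
have := Cmod_ge_0 (Csqrt (z + h) - Csqrt z). nra.
Qed.

Lemma Re_pos_nz (z : C) : (0 < Re z)%R -> z <> 0.
Proof. by move=> H E; rewrite E /Re /= in H; lra. Qed.

Lemma cderiv_Csqrt (z : C) : (0 < Re z)%R -> cderiv Csqrt z (/ (2 * Csqrt z)).
Proof.
move=> Hz; apply: (cderiv_inverse (fun x => x * x) Csqrt z _ 1); first lra.
- apply: Cmult_neq_0; first exact: C2_nz. apply: Re_pos_nz; exact: Csqrt_Re_pos.
- apply: cderiv_eq; first exact: (cderiv_mult (fun x => x) (fun x => x) _ _ _ (cderiv_id _) (cderiv_id _)).
  rewrite C2_eq; ring.
- exact: Csqrt_cont.
- move=> h _; exact: Csqrt_sqr.
Qed.

(** Meant for the right half-plane, where atan (Im z / Re z) is the principal argument; it contains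
    (1 + u) / (1 - u) for |u| < 1 and the exponentials of the points of the unit disk. *)
Definition Clog (z : C) : C := (ln (Cmod z), atan (Im z / Re z)).

Lemma Cexp_Clog (z : C) : (0 < Re z)%R -> Cexp (Clog z) = z.
Proof.
move=> Hz; have nz := Cmod_pos z (Re_pos_nz z Hz).
have m2 := Cmod_sqr z.
rewrite /Cexp /Clog /= exp_ln // cos_atan sin_atan.
set t := (Im z / Re z)%R.
have tE : (t * Re z = Im z)%R by rewrite /t; field; lra.
have -> : sqrt (1 + t²) = (Cmod z / Re z)%R.
  apply: sqrt_lem_1; [have := Rle_0_sqr t; lra|apply: Rlt_le; exact: Rdiv_lt_0_compat|].
  transitivity (Cmod z * Cmod z / (Re z * Re z))%R; first by field; lra.
  rewrite m2 -tE /Rsqr; field; lra.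
case: z Hz nz m2 @t tE => x y /= Hz nz m2 tE. rewrite /=; f_equal; field; lra.
Qed.

Lemma PI2_gt_1 : (1 < PI / 2)%R.
Proof. have := PI2_1; lra. Qed.

Lemma Clog_Cexp v : (Rabs (Im v) < 1)%R -> Clog (Cexp v) = v.
Proof.
move=> /Rabs_lt_between Hv; rewrite /Clog Cmod_Cexp ln_exp; case: v Hv => a b /= Hv.
have P := PI2_gt_1.
have c0 : (0 < cos b)%R by apply: cos_gt_0; lra.
have -> : (exp a * sin b / (exp a * cos b) = tan b)%R.
  rewrite /tan; field; split; [lra|have := exp_pos a; lra].
rewrite atan_tan //; lra.
Qed.

Lemma Clog_cont (z : C) : (0 < Re z)%R -> C_continuous Clog z.
Proof.
move=> Hz; have nz := Cmod_pos z (Re_pos_nz z Hz); apply/C_continuous_continuous.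
have cid : continuous (T := C_UniformSpace) (U := C_UniformSpace) (fun w => w) z by exact: continuous_id.
apply cont_pair; rewrite /Clog /=.
- apply: (continuous_comp (U := C_UniformSpace) (fun w => Cmod w) ln); last exact: continuous_ln.
  apply: (continuous_comp (U := C_UniformSpace) (fun w => (fst w ^ 2 + snd w ^ 2)%R) sqrt).
    apply: (continuous_plus (U := C_UniformSpace) (V := R_NormedModule) (fun w => (fst w ^ 2)%R) (fun w => (snd w ^ 2)%R)).
      apply: (continuous_comp (U := C_UniformSpace) fst (fun x => (x ^ 2)%R)); first exact: (cont_Re _ _ cid).
      apply: (ex_derive_continuous (V := R_NormedModule)); by auto_derive.
    apply: (continuous_comp (U := C_UniformSpace) snd (fun x => (x ^ 2)%R)); first exact: (cont_Im _ _ cid).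
    apply: (ex_derive_continuous (V := R_NormedModule)); by auto_derive.
  exact: continuous_sqrt.
- apply: (continuous_comp (U := C_UniformSpace) (fun w => (Im w / Re w)%R) atan); last first.
    apply: (ex_derive_continuous (V := R_NormedModule)); by auto_derive.
  apply: (continuous_mult (U := C_UniformSpace) (K := R_AbsRing) (fun w => Im w) (fun w => (/ Re w)%R)); first exact: (cont_Im _ _ cid).
  apply: (continuous_comp (U := C_UniformSpace) (fun w => Re w) Rinv); first exact: (cont_Re _ _ cid).
  apply: (ex_derive_continuous (V := R_NormedModule)); auto_derive; lra.
Qed.

Lemma cderiv_Clog (z : C) : (0 < Re z)%R -> cderiv Clog z (/ z).
Proof.
move=> Hz; apply: (cderiv_inverse Cexp Clog z _ (Re z)) => //.
- exact: Re_pos_nz.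
- by have := cderiv_Cexp (Clog z); rewrite Cexp_Clog.
- exact: Clog_cont.
- move=> h Hh; apply: Cexp_Clog.
  have := re_le_Cmod h; move=> /Rabs_le_between [] h1 h2; rewrite /Re /= in h1 h2 Hh *; lra.
Qed.

(** * An ellipse inside the range of the sigmoid *)

Lemma Re_cayley u : (Cmod u < 1)%R -> (0 < Re ((1 + u) * / (1 - u)))%R.
Proof.
move=> Hu; have := Cmod_sqr u; have := Cmod_ge_0 u => u0 E.
have L : (Re u * Re u + Im u * Im u < 1)%R by nra.
case: u L {Hu u0 E} => x y /= L.
set D := (_ ^ 2 + _ ^ 2)%R.
have D0 : (0 < D)%R by rewrite /D; nra.
have -> : ((1 + x) * ((1 + - x) / D) - (0 + y) * (- (0 + - y) / D) = (1 - x * x - y * y) / D)%R by field; lra.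
apply: Rdiv_lt_0_compat => //; lra.
Qed.

Lemma disk_one_minus u : (Cmod u < 1)%R -> 1 - u <> 0.
Proof.
move=> Hu; apply/Cmod_gt_0; have := Cmod_triangle (1 - u) u.
replace (1 - u + u) with (RtoC 1) by ring; rewrite Cmod_1; lra.
Qed.
Lemma disk_one_plus u : (Cmod u < 1)%R -> 1 + u <> 0.
Proof. move=> Hu; have := disk_one_minus (- u); rewrite Cmod_opp => /(_ Hu). by replace (1 - - u) with (1 + u) by ring. Qed.

(** This is 2 artanh u; as sigmoid v = 1 + tanh (v / 2), it recovers v from u = sigmoid v - 1. *)
Definition cayley_log (u : C) : C := Clog ((1 + u) * / (1 - u)).

Lemma cderiv_cayley_log (u : C) : (Cmod u < 1)%R -> cderiv cayley_log u (2 * / (1 - u * u)).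
Proof.
move=> Hu; have n1 := disk_one_minus u Hu; have n2 := disk_one_plus u Hu.
have n3 : 1 - u * u <> 0 by replace (1 - u * u) with ((1 - u) * (1 + u)) by ring; exact: Cmult_neq_0.
apply: cderiv_eq.
  apply: (cderiv_comp Clog (fun u => (1 + u) * / (1 - u))); first by apply: cderiv_Clog; exact: Re_cayley.
  apply: (cderiv_mult (fun u => 1 + u) (fun u => / (1 - u))).
    exact: (cderiv_plus (fun _ => 1) (fun u => u) _ _ _ (cderiv_const _ _) (cderiv_id _)).
  apply: (cderiv_comp Cinv (fun u => 1 - u)); first exact: cderiv_inv.
  exact: (cderiv_minus (fun _ => 1) (fun u => u) _ _ _ (cderiv_const _ _) (cderiv_id _)).
cbv beta; rewrite C2_eq; field; repeat split; assumption.
Qed.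

Lemma C3_eq : RtoC 3 = 1 + 1 + 1.
Proof. rewrite -!RtoC_plus; f_equal; ring. Qed.
Lemma C1_plus_C1_plus_C1_nz : RtoC 1 + RtoC 1 + RtoC 1 <> RtoC 0.
Proof. rewrite -C3_eq => /RtoC_inj; lra. Qed.

Lemma is_derive_artanh x : (-1 < x < 1)%R -> is_derive (fun s => ln ((1 + s) / (1 - s))) x (2 / (1 - x * x))%R.
Proof.
move=> Hx.
have : (0 < (1 + x) / (1 - x))%R by apply: Rdiv_lt_0_compat; lra.
move=> H; auto_derive; first by repeat split => //; lra.
field; repeat split; nra.
Qed.

(* Comparing the Taylor remainders of [artanh u] and [artanh |u|] along the segment from 0 to u. *)
Lemma cayley_log_bound u : (Cmod u < 1)%R -> cayley_log u <> 0 ->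
  (Cmod (cayley_log u) <= 2 * cmod (u + u * u * u / 3) + ln ((1 + Cmod u) / (1 - Cmod u)) - 2 * Cmod u - 2 * Cmod u ^ 3 / 3)%R.
Proof.
move=> Hu vnz; set v := cayley_log u in vnz *; set rho := Cmod u in Hu *.
have r0 : (0 <= rho)%R by exact: Cmod_ge_0.
have v0 := Cmod_pos v vnz.
(* The conjugate of v = [cayley_log u] makes the modulus accessible to real calculus: at w = u the
   leading term is |v|^2, and a factor |v| is divided out at the end. *)
pose G w := Cconj v * (cayley_log w - 2 * (w + w * w * w / 3)).
have CG w : (Cmod w < 1)%R -> cderiv G w (Cconj v * (2 * (w * w * w * w) * / (1 - w * w))).
  move=> Hw; apply: cderiv_scal; apply: cderiv_eq.
    apply: (cderiv_minus cayley_log (fun w => 2 * (w + w * w * w / 3))); first exact: cderiv_cayley_log.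
    apply: cderiv_scal; apply: (cderiv_plus (fun w => w) (fun w => w * w * w / 3)); first exact: cderiv_id.
    apply: (cderiv_mult (fun w => w * w * w) (fun _ => / 3)); last exact: cderiv_const.
    apply: (cderiv_mult (fun w => w * w) (fun w => w)); last exact: cderiv_id.
    exact: (cderiv_mult (fun w => w) (fun w => w) _ _ _ (cderiv_id _) (cderiv_id _)).
  have n1 := disk_one_minus w Hw; have n2 := disk_one_plus w Hw.
  have n3 : 1 - w * w <> 0 by replace (1 - w * w) with ((1 - w) * (1 + w)) by ring; exact: Cmult_neq_0.
  have n4 := C1_plus_C1_plus_C1_nz.
  cbv beta; rewrite C2_eq C3_eq; field; repeat split; assumption.
pose phi (t : R) := (Re (G (0 + t * u)%C) - Cmod v * (ln ((1 + t * rho) / (1 - t * rho)) - 2 * (t * rho) - 2 * (t * rho) ^ 3 / 3))%R.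
pose dphi (t : R) := (Re (u * (Cconj v * (2 * ((t * u) * (t * u) * (t * u) * (t * u)) * / (1 - (t * u) * (t * u)))))%C - Cmod v * (2 * rho * (t * rho) ^ 4 / (1 - (t * rho) ^ 2)))%R.
have tr (t : R) : (0 <= t <= 1)%R -> (0 <= t * rho < 1)%R by move=> Ht; nra.
have Ctu (t : R) : (0 <= t <= 1)%R -> (cmod (t * u) < 1)%R.
  move=> Ht; rewrite Cmod_mult Cmod_R Rabs_pos_eq; [exact: (proj2 (tr t Ht))|lra].
have D (t : R) : (0 <= t <= 1)%R -> is_derive phi t (dphi t).
  move=> Ht; have rt := tr t Ht.
  have H1 := rderiv_Re (fun t : R => G (0 + t * u)) t (u * (Cconj v * (2 * ((t * u) * (t * u) * (t * u) * (t * u)) * / (1 - (t * u) * (t * u))))).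
  have {}H1 := H1 (rderiv_comp G (fun t : R => 0 + t * u) t _ _ (eq_ind_r (fun w => cderiv G w _) (CG (t * u) (Ctu t Ht)) (Cplus_0_l (t * u))) (rderiv_affine _ _ t)).
  have := is_derive_artanh (t * rho) (ltac:(lra)) => H.
  have H2 : is_derive (fun t => ln ((1 + t * rho) / (1 - t * rho))) t (rho * (2 / (1 - t * rho * (t * rho))))%R.
    apply: (is_derive_comp (fun s => ln ((1 + s) / (1 - s))) (fun t => t * rho)%R); first exact: H.
    by auto_derive => //; ring.
  have H3 : is_derive (fun t => - 2 * (t * rho) - 2 * (t * rho) ^ 3 / 3)%R t (- 2 * rho - 2 * (t * rho) ^ 2 * rho)%R.
    auto_derive => //; field.
  have H4 := is_derive_scal _ _ (Cmod v) _ (is_derive_plus _ _ _ _ _ H2 H3).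
  have H5 := is_derive_minus _ _ _ _ _ H1 H4.
  have -> : dphi t = minus (Re (u * (Cconj v * (2 * ((t * u) * (t * u) * (t * u) * (t * u)) * / (1 - (t * u) * (t * u)))))) (Cmod v * (plus (rho * (2 / (1 - t * rho * (t * rho)))) (- 2 * rho - 2 * (t * rho) ^ 2 * rho)))%R.
    rewrite /dphi /minus /plus /opp /=; rewrite /Rminus; f_equal; field; nra.
  apply: is_derive_ext H5 => s; rewrite /phi /minus /plus /opp /=; ring.
(* The Taylor remainder has derivative 2 w^4 / (1 - w^2), whose modulus at w = t u is at most its
   value at t |u|. *)
have neg (t : R) : (0 <= t <= 1)%R -> (dphi t <= 0)%R.
  move=> Ht; have rt := tr t Ht; rewrite /dphi; set X := u * _.
  have n1 := disk_one_minus _ (Ctu t Ht); have n2 := disk_one_plus _ (Ctu t Ht).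
  have n3 : 1 - (t * u) * (t * u) <> 0 by replace (1 - (t * u) * (t * u)) with ((1 - t * u) * (1 + t * u)) by ring; exact: Cmult_neq_0.
  have tu : (cmod (t * u) = t * rho)%R by rewrite Cmod_mult Cmod_R Rabs_pos_eq //; lra.
  have : (Cmod X <= Cmod v * (2 * rho * (t * rho) ^ 4 / (1 - (t * rho) ^ 2)))%R.
    rewrite /X; move: tu n3; move: (t * u) => w tu n3.
    rewrite !Cmod_mult Cmod_conj Cmod_inv // tu Cmod_R Rabs_pos_eq; last lra.
    have L : (1 - (t * rho) ^ 2 <= cmod (1 - w * w))%R.
      have := Cmod_triangle (1 - w * w) (w * w).
      replace (1 - w * w + w * w) with (RtoC 1) by ring.
      rewrite (Cmod_mult w w) Cmod_1 tu; lra.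
    have L0 : (0 < 1 - (t * rho) ^ 2)%R by nra.
    rewrite -/rho.
    have p4 : (0 <= rho * (Cmod v * (2 * (t * rho) ^ 4)))%R.
      apply: Rmult_le_pos => //; apply: Rmult_le_pos; first lra. apply: Rmult_le_pos; first lra. apply: pow_le; lra.
    have := Rinv_le_contravar _ _ L0 L.
    move=> /(Rmult_le_compat_l _ _ _ p4); rewrite /Rdiv; lra.
  have := re_le_Cmod X; have := Rle_abs (Re X); lra.
have [c [Hc E]] : exists c, (0 <= c <= 1)%R /\ (phi 1 - phi 0 = dphi c * (1 - 0))%R.
  have := MVT_gen phi 0 1 dphi; rewrite Rmin_left ?Rmax_right; [|lra|lra]; apply.
    move=> x Hx; apply: D; lra.
  move=> x Hx; apply/continuity_pt_filterlim.
  apply: (ex_derive_continuous (V := R_NormedModule)); exists (dphi x); exact: D.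
have G0 : G 0 = 0.
  rewrite /G /cayley_log; replace ((1 + 0) * / (1 - 0)) with (RtoC 1) by (field; move=> /RtoC_inj; lra).
  rewrite /Clog Cmod_1 ln_1 /= /Rdiv Rmult_0_l atan_0. change (0%R, 0%R) with (RtoC 0); rewrite /Cdiv; ring.
have p0 : phi 0%R = 0%R.
  rewrite /phi; replace (0 + 0 * u) with (RtoC 0) by ring; rewrite G0 Rmult_0_l /=.
  replace ((1 + 0) / (1 - 0))%R with 1%R by field. rewrite ln_1; field.
have := neg c Hc => N.
have : (phi 1 <= 0)%R by rewrite p0 in E; lra.
rewrite /phi Rmult_1_l; replace (0 + 1 * u) with u by ring.
rewrite /G -/v.
have -> : Re (Cconj v * (v - 2 * (u + u * u * u / 3))) = (Cmod v * Cmod v - Re (Cconj v * (2 * (u + u * u * u / 3))))%R.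
  rewrite Cmod_sqr; clear; move: (2 * (u + _)) (v : C) => [p q]; clear; case=> a b; rewrite /Cconj /Cmult /Cminus /Cplus /Copp /=; ring.
have := re_le_Cmod (Cconj v * (2 * (u + u * u * u / 3))); rewrite !Cmod_mult Cmod_conj Cmod_R (Rabs_pos_eq 2); last lra.
move=> H1 H2; have := Rle_abs (Re (Cconj v * (2 * (u + u * u * u / 3)))) => H3.
apply: (Rmult_le_reg_l (Cmod v)) => //; lra.
Qed.

Lemma artanh_e : ln ((1 + (exp 1 - 1) / (exp 1 + 1)) / (1 - (exp 1 - 1) / (exp 1 + 1))) = 1%R.
Proof.
have e0 := exp_pos 1.
replace ((1 + (exp 1 - 1) / (exp 1 + 1)) / (1 - (exp 1 - 1) / (exp 1 + 1)))%R with (exp 1); first exact: ln_exp.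
field; lra.
Qed.

(** These bounds are what 2/5 < delta <= 1/2 amounts to; the lower one comes from (5/4)^4 > 7/3. *)
Lemma exp_1_bounds : (7 / 3 < exp 1 <= 3)%R.
Proof.
split; last exact: exp_le_3.
have E : (exp 1 = exp (1/4) ^ 4)%R.
  replace (exp 1) with (exp (1/4 + (1/4 + (1/4 + 1/4))))%R by (f_equal; field).
  rewrite !exp_plus; ring.
have H : (1 + 1/4 < exp (1/4))%R by apply: exp_ineq1; lra.
have H2 : (25/16 < exp (1/4) * exp (1/4))%R by nra.
rewrite E; replace (exp (1/4) ^ 4)%R with ((exp (1/4) * exp (1/4)) * (exp (1/4) * exp (1/4)))%R by ring.
nra.
Qed.

Definition delta : R := ((exp 1 - 1) / (exp 1 + 1))%R.

Lemma delta_bounds : (2 / 5 < delta <= 1 / 2)%R.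
Proof.
have [H1 H2] := exp_1_bounds.
have E : (delta * (exp 1 + 1) = exp 1 - 1)%R by rewrite /delta; field; lra.
split; nra.
Qed.

(* An ellipse with horizontal semi-axis [delta] and vertical semi-axis [delta / sqrt 0.9];
   the vertical one must exceed [delta] for the bound needed in [T3]. *)
Definition ellipse_form (u : C) : R := (Re u * Re u + 9 / 10 * (Im u * Im u))%R.

(** With d = delta, it controls the excess of 2 artanh r over 1 for r slightly beyond delta. *)
Lemma artanh_MVT d r : (0 < d <= r)%R -> (r < 1)%R ->
  (ln ((1 + r) / (1 - r)) <= ln ((1 + d) / (1 - d)) + 2 * (r - d) / (1 - r * r))%R.
Proof.
move=> Hd r1.
have [c [Hc E]] : exists c, (d <= c <= r)%R /\ (ln ((1 + r) / (1 - r)) - ln ((1 + d) / (1 - d)) = 2 / (1 - c * c) * (r - d))%R.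
  have := MVT_gen (fun s => ln ((1 + s) / (1 - s))) d r (fun x => 2 / (1 - x * x))%R; rewrite Rmin_left ?Rmax_right; [|lra|lra]; apply.
    move=> x Hx; apply: is_derive_artanh; lra.
  move=> x Hx; apply/continuity_pt_filterlim.
  apply: (ex_derive_continuous (V := R_NormedModule) (fun s => ln ((1 + s) / (1 - s))) x); eexists; apply: is_derive_artanh; lra.
have : (/ (1 - c * c) <= / (1 - r * r))%R by apply: Rinv_le_contravar; nra.
move=> H.
have : (2 / (1 - c * c) * (r - d) <= 2 * (r - d) / (1 - r * r))%R by rewrite /Rdiv; nra.
lra.
Qed.

(** For |u| < delta the triangle inequality collapses [cayley_log_bound] to 2 artanh |u| < 1. For
    |u| >= delta the ellipse forces Re (u^2) below |u|^2 by more than 20 (|u|^2 - delta^2), so |1 +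
    u^2 / 3| falls short of 1 + |u|^2 / 3; this gain outweighs the excess of 2 artanh |u| over 1. *)
Lemma ellipse_artanh u : (ellipse_form u < delta * delta)%R -> (Cmod (cayley_log u) < 1)%R.
Proof.
move=> He; have [d1 d2] := delta_bounds.
have r2 := Cmod_sqr u; have r0 := Cmod_ge_0 u; rewrite /ellipse_form in He.
set r := Cmod u in r2 r0.
have rd : (r * r < 10 / 9 * (delta * delta))%R by nra.
have r1 : (r < 53 / 100)%R by nra.
case: (Req_dec (Cmod (cayley_log u)) 0) => [->|/nz_Cmod vnz]; first lra.
have := cayley_log_bound u (ltac:(rewrite -/r; lra)) vnz; rewrite -/r.
have A := artanh_e; rewrite -/delta in A.
case: (Rlt_le_dec r delta) => Hrd.
  have B : (ln ((1 + r) / (1 - r)) < 1)%R.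
    rewrite -A; apply: ln_increasing; first by apply: Rdiv_lt_0_compat; lra.
    apply: Rmult_le_0_lt_compat; [lra|apply: Rlt_le; apply: Rinv_0_lt_compat; lra|lra|].
    apply: Rinv_lt_contravar; [nra|lra].
  have := Cmod_triangle u (u * u * u / 3); rewrite Cmod_div; last by rewrite C3_eq; exact: C1_plus_C1_plus_C1_nz.
  rewrite !Cmod_mult Cmod_R Rabs_pos_eq -/r; last lra. lra.
have B := artanh_MVT delta r (ltac:(lra)) (ltac:(lra)); rewrite A in B.
set q := (Re u * Re u - Im u * Im u)%R.
have qb : (q < 20 * (delta * delta) - 19 * (r * r))%R by rewrite /q r2; lra.
(* The gain needed: 2 r eps is the excess 2 (r - delta) / (1 - r^2) allowed by [artanh_MVT]. *)
pose eps := ((r - delta) / (r * (1 - r * r)))%R.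
have rp : (0 < r)%R by lra.
have r3 : (0 < 1 - r * r)%R by nra.
have epsE : (eps * (r * (1 - r * r)) = r - delta)%R by rewrite /eps; field; lra.
have eps0 : (0 <= eps)%R by apply: Rmult_le_pos; [lra|apply/Rlt_le/Rinv_0_lt_compat; nra].
have pos : (0 < r * (1 - r * r))%R by nra.
(* The squares of 1 + r^2 / 3 and |1 + u^2 / 3| differ by 2/3 (r^2 - q) > 40/3 (r^2 - delta^2); it
   suffices that (1 + r^2 / 3) eps is at most half of this bound. *)
have big : (1 + r * r / 3 <= 20 / 3 * (r + delta) * (r * (1 - r * r)))%R.
  have : (7 / 10 <= 1 - r * r)%R by nra.
  move=> h; have : (7/10 * r <= r * (1 - r * r))%R by nra.
  move=> h1; have : (20 / 3 * (4 / 5) * (7 / 10 * (2 / 5)) <= 20 / 3 * (r + delta) * (r * (1 - r * r)))%R.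
    apply: Rmult_le_compat; nra.
  nra.
have step : ((1 + r * r / 3) * eps <= 20 / 3 * (r + delta) * (r - delta))%R.
  rewrite -epsE; apply: Rle_trans (Rmult_le_compat_r _ _ _ eps0 big) _; right; ring.
have epsu : (eps <= 1 / 2)%R.
  apply: (Rmult_le_reg_r (r * (1 - r * r))) => //; rewrite epsE; nra.
have mod1 : (cmod (1 + u * u / 3) < 1 + r * r / 3 - eps)%R.
  have S : (cmod (1 + u * u / 3) * cmod (1 + u * u / 3) = 1 + 2 / 3 * q + r * r * (r * r) / 9)%R.
    rewrite Cmod_sqr /q r2; have -> : 1 + u * u / 3 = 1 + u * u * RtoC (/ 3) by rewrite RtoC_inv //; lra.
    case: (u) => x y /=; field.
  have C0 := Cmod_ge_0 (1 + u * u / 3).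
  apply: Rsqr_incrst_0; [|exact: C0|nra].
  rewrite /Rsqr S; nra.
have E : cmod (u + u * u * u / 3) = (r * cmod (1 + u * u / 3))%R.
  rewrite /r -Cmod_mult; f_equal; rewrite C3_eq; field; exact: C1_plus_C1_plus_C1_nz.
rewrite E.
have : (r * cmod (1 + u * u / 3) < r * (1 + r * r / 3 - eps))%R by apply: Rmult_lt_compat_l.
have : (2 * (r - delta) / (1 - r * r) = 2 * r * eps)%R by rewrite /eps; field; lra.
move=> e1; rewrite e1 in B; lra.
Qed.

Lemma sigmoid_cayley_log u : (Cmod u < 1)%R -> sigmoid (cayley_log u) = 1 + u.
Proof.
move=> Hu; have n1 := disk_one_minus u Hu; have n2 := disk_one_plus u Hu.
rewrite /sigmoid Cexp_opp_inv /cayley_log Cexp_Clog; last exact: Re_cayley.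
rewrite C2_eq; field; repeat split => //.
by replace (1 + u + (1 - u)) with (RtoC 2) by (rewrite C2_eq; ring); exact: C2_nz.
Qed.

Lemma ellipse_sigmoid u : (ellipse_form u < delta * delta)%R -> exists v, in_disk v /\ 1 + u = sigmoid v.
Proof.
move=> H; exists (cayley_log u); split; first exact: ellipse_artanh.
rewrite sigmoid_cayley_log //.
have [d1 d2] := delta_bounds; have := Cmod_sqr u; have := Cmod_ge_0 u; rewrite /ellipse_form in H; nra.
Qed.

(** * Radii of ratio classes *)

(** The multiplicative form [phi w * L w] avoids both a division and a choice of branch of log
    phi. *)
Definition has_log_derivative (phi L : C -> C) : Prop :=
  forall w, in_disk w -> phi w <> 0 /\ cderiv phi w (phi w * L w).

Definition schwarz_function (w : C -> C) : Prop :=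
  holo w /\ (forall z, in_disk z -> in_disk (w z)) /\ w 0 = 0.

Lemma subordinate_log_derivative f phi L : subordinate f phi -> has_log_derivative phi L ->
  exists w, schwarz_function w /\ has_log_derivative f (fun z => C_derive w z * L (w z)).
Proof.
move=> [_ [_ [w [Hw [wD [w0 E]]]]]] HL.
have hw : holo w by apply/holo_analytic.
exists w; split=> // z Hz; have [nz D] := HL _ (wD z Hz).
rewrite E //; split=> //.
apply: (cderiv_ext_loc (fun z => phi (w z)) _ _ _ (1 - Cmod z)); first by rewrite /in_disk in Hz; lra.
  by move=> h Hh; rewrite E //; exact: near_in_ball.
apply: cderiv_eq; first exact: (cderiv_comp phi w _ _ _ D (holo_cderiv w z hw Hz)).
ring.
Qed.

Lemma log_derivative_mult f g L M : has_log_derivative f L -> has_log_derivative g M ->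
  has_log_derivative (fun z => f z * g z) (fun z => L z + M z).
Proof.
move=> Hf Hg z Hz; have [nf Df] := Hf z Hz; have [ng Dg] := Hg z Hz.
split; first exact: Cmult_neq_0.
apply: cderiv_eq; first exact: cderiv_mult Df Dg. ring.
Qed.

Lemma log_derivative_holo f L : has_log_derivative f L -> holo f.
Proof. by move=> H z Hz; have [_ D] := H z Hz; eexists; exact: D. Qed.

Lemma ratio_class_factor phi psi L M f :
  has_log_derivative phi L -> has_log_derivative psi M -> ratio_class phi psi f ->
  exists w1 w2 w3 K, schwarz_function w1 /\ schwarz_function w2 /\ schwarz_function w3 /\
    (forall z, in_disk z -> f z = z * K z) /\
    has_log_derivative K (fun z => C_derive w1 z * L (w1 z) + C_derive w2 z * L (w2 z) + C_derive w3 z * M (w3 z)).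
Proof.
move=> Hphi Hpsi [[_ [f0 _]] [g [p [[_ [g0 _]] [Sp [[h1 [[_ Q1] S1]] [h2 [[_ Q2] S2]]]]]]]].
have [w1 [W1 D1]] := subordinate_log_derivative _ _ _ S1 Hphi.
have [w2 [W2 D2]] := subordinate_log_derivative _ _ _ S2 Hphi.
have [w3 [W3 D3]] := subordinate_log_derivative _ _ _ Sp Hpsi.
exists w1, w2, w3, (fun z => h1 z * h2 z * p z); do 3 split=> //; split; last first.
  exact: log_derivative_mult (log_derivative_mult _ _ _ _ D1 D2) D3.
(* The quotients are prescribed only away from 0; at 0 both sides vanish. *)
move=> z Hz; case: (Req_dec (Cmod z) 0) => [/Cmod_eq_0 ->|/nz_Cmod nz]; first by rewrite f0; ring.
have [gn E1] := Q1 z Hz nz; have [pn E2] := Q2 z Hz nz.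
have [pn' _] := D3 z Hz.
rewrite E1 E2; field; repeat split=> //.
Qed.

Lemma Cinv_nz (z : C) : z <> 0 -> / z <> 0.
Proof.
move=> nz E; have : z * / z = 1 by field.
rewrite E; replace (z * 0) with (RtoC 0) by ring; move=> /RtoC_inj; lra.
Qed.

(** |Im v| < 1 < pi / 2 keeps the exponential in the right half-plane. *)
Lemma one_plus_Cexp_nz v : in_disk v -> 1 + Cexp (- v) <> 0.
Proof.
move=> Hv; apply: Re_pos_nz; have := im_le_Cmod v; rewrite /in_disk in Hv.
move=> /Rabs_le_between Hi; rewrite /Cexp /=; have P := PI2_gt_1.
have : (0 < cos (- snd v))%R by apply: cos_gt_0; rewrite /Im in Hi; lra.
have := exp_pos (- fst v). nra.
Qed.

Lemma sigmoid_inverse v : in_disk v ->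
  sigmoid v <> 0 /\ 2 - sigmoid v <> 0 /\ sigmoid v * / (2 - sigmoid v) = Cexp v.
Proof.
move=> Hv; have n1 := one_plus_Cexp_nz v Hv; have n2 := Cexp_nz (- v).
have E : 2 - sigmoid v = 2 * Cexp (- v) / (1 + Cexp (- v)) by rewrite /sigmoid; field.
have n3 : 2 - sigmoid v <> 0.
  rewrite E; apply: Cmult_neq_0; [apply: Cmult_neq_0 => //; exact: C2_nz|exact: Cinv_nz].
split; first by apply: Cmult_neq_0; [exact: C2_nz|exact: Cinv_nz].
split=> //.
rewrite E /sigmoid; transitivity (/ Cexp (- v)); first by field; repeat split => //; exact: C2_nz.
rewrite Cexp_opp_inv; field; exact: Cexp_nz.
Qed.

Lemma Cexp_Re_pos v : in_disk v -> (0 < Re (Cexp v))%R.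
Proof.
move=> Hv; have := im_le_Cmod v; rewrite /in_disk in Hv.
move=> /Rabs_le_between Hi; rewrite /Cexp /=; have P := PI2_gt_1.
apply: Rmult_lt_0_compat; first exact: exp_pos.
apply: cos_gt_0; rewrite /Im in Hi *; lra.
Qed.

Lemma sigmoid_holo : holo sigmoid.
Proof.
move=> v Hv; eexists.
apply: (cderiv_scal 2 (fun v => / (1 + Cexp (- v)))).
apply: (cderiv_comp Cinv (fun v => 1 + Cexp (- v))); first by apply: cderiv_inv; exact: one_plus_Cexp_nz.
apply: (cderiv_plus (fun _ => 1) (fun v => Cexp (- v))); first exact: cderiv_const.
apply: (cderiv_comp Cexp (fun v => - v)); first exact: cderiv_Cexp.
apply: (cderiv_opp (fun v => v)); exact: cderiv_id.
Qed.

(** * Dilations of f = z K and existence of the largest radius *)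

Section Dilation.
Variables (f K L : C -> C).
Hypothesis fA : class_A f.
Hypothesis fK : forall z, in_disk z -> f z = z * K z.
Hypothesis KL : has_log_derivative K L.

Lemma factor_cderiv z : in_disk z -> cderiv f z (K z * (1 + z * L z)).
Proof.
move=> Hz; have [_ D] := KL z Hz.
apply: (cderiv_ext_loc (fun z => z * K z) _ _ _ (1 - Cmod z)); first by rewrite /in_disk in Hz; lra.
  by move=> h Hh; rewrite fK //; exact: near_in_ball.
apply: cderiv_eq; first exact: (cderiv_mult (fun z => z) K _ _ _ (cderiv_id z) D). cbv beta; ring.
Qed.

Lemma log_derivative_eq z : in_disk z -> C_derive K z * / K z = L z.
Proof. move=> Hz; have [nz D] := KL z Hz; rewrite (cderiv_C_derive _ _ _ D); field; exact: nz. Qed.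

(** L = K' / K and K' is again holomorphic. This makes z f' / f = 1 + z L analytic, as [S_SG]
    demands. *)
Lemma log_derivative_is_holo : holo L.
Proof.
apply: (holo_ext (fun z => C_derive K z * / K z)); first exact: log_derivative_eq.
have HK := log_derivative_holo _ _ KL.
move=> z Hz; have [nz D] := KL z Hz; eexists.
apply: (cderiv_mult (C_derive K) (fun z => / K z)); first exact: holo_cderiv (holo_derive K HK) Hz.
apply: (cderiv_comp Cinv K); [exact: cderiv_inv|exact: D].
Qed.

Lemma RtoC_nz (r : R) : (0 < r)%R -> RtoC r <> 0.
Proof. move=> H /RtoC_inj; lra. Qed.

Lemma dilate_in_disk r z : (0 < r <= 1)%R -> in_disk z -> (cmod (r * z) < r)%R.
Proof.
move=> Hr Hz; rewrite /in_disk in Hz; rewrite Cmod_mult Cmod_R Rabs_pos_eq; [nra|lra].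
Qed.

Lemma cderiv_dilate r z l : (0 < r <= 1)%R -> cderiv f (r * z) l -> cderiv (dilate r f) z l.
Proof.
move=> Hr D; rewrite /dilate.
apply: cderiv_eq.
  apply: (cderiv_mult (fun z => f (r * z)) (fun _ => / r)); last exact: cderiv_const.
  apply: (cderiv_comp f (fun z => r * z)); [exact: D|exact: cderiv_scal (cderiv_id z)].
cbv beta; field; exact: RtoC_nz (proj1 Hr).
Qed.

(** 1 + z L is z f' / f; at 0 it equals 1 = sigmoid 0, so the condition concerns nonzero points. For
    the converse the pointwise preimages v have to be assembled into one analytic function. *)
Lemma S_SG_dilate r : (0 < r <= 1)%R ->
  (S_SG (dilate r f) <-> forall z, (Cmod z < r)%R -> z <> 0 -> exists v, in_disk v /\ 1 + z * L z = sigmoid v).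
Proof.
move=> Hr; have rn := RtoC_nz r (proj1 Hr).
have D w : (Cmod w < r)%R -> in_disk w by move=> H; rewrite /in_disk; lra.
have quot z : in_disk z -> z <> 0 -> dilate r f z <> 0 /\
   z * C_derive (dilate r f) z / dilate r f z = 1 + (r * z) * L (r * z).
  move=> Hz nz; have Hrz := D _ (dilate_in_disk r z Hr Hz).
  rewrite (cderiv_C_derive _ _ _ (cderiv_dilate r z _ Hr (factor_cderiv _ Hrz))) /dilate fK //.
  have [nK _] := KL _ Hrz.
  split; last by field; repeat split.
  do 2 (apply: Cmult_neq_0; last by try exact: Cinv_nz). exact: Cmult_neq_0.
split.
- move=> [_ [h [[_ Q] [_ [_ [w [_ [wD [_ E]]]]]]]]] z Hz nz.
  have Hz' : in_disk (z / r).
    rewrite /in_disk Cmod_div // Cmod_R Rabs_pos_eq; last lra.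
    apply: (Rmult_lt_reg_r r); first lra. rewrite /Rdiv Rmult_assoc Rinv_l; lra.
  have nz' : z / r <> 0 by apply: Cmult_neq_0 => //; exact: Cinv_nz.
  exists (w (z / r)); split; first exact: wD.
  have [_ E1] := Q _ Hz' nz'; have [_ E2] := quot _ Hz' nz'.
  rewrite -E // E1 E2; replace (r * (z / r)) with z by (field; exact: rn). done.
- move=> H.
  have f0 : f 0 = 0 by case: fA => _ [].
  have fd : cderiv f 0 1 by case: fA => _ [_ /cderiv_is_derive].
  split.
    split; first last.
      split; first by rewrite /dilate; replace (r * 0) with (RtoC 0) by ring; rewrite f0; field.
      apply/cderiv_is_derive; apply: cderiv_dilate => //; by replace (r * 0) with (RtoC 0) by ring.
    apply/holo_analytic => z Hz; eexists; apply: cderiv_dilate => //; apply: factor_cderiv; apply: D; exact: dilate_in_disk.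
  pose h z := 1 + (r * z) * L (r * z).
  have hh : holo h.
    move=> z Hz; eexists; apply: (cderiv_plus (fun _ => 1) (fun z => (r * z) * L (r * z))); first exact: cderiv_const.
    apply: (cderiv_mult (fun z => r * z) (fun z => L (r * z))); first exact: cderiv_scal (cderiv_id z).
    apply: (cderiv_comp L (fun z => r * z)); last exact: cderiv_scal (cderiv_id z).
    apply: (holo_cderiv L _ log_derivative_is_holo); apply: D; exact: dilate_in_disk.
  pose w z := Clog (h z * / (2 - h z)).
  have S0 : sigmoid 0 = 1.
    rewrite /sigmoid; replace (- 0) with (RtoC 0) by ring. rewrite Cexp_0 C2_eq; field; exact: C1_plus_C1_nz.
  have hv z : in_disk z -> exists v, in_disk v /\ h z = sigmoid v.
    move=> Hz; case: (Req_dec (Cmod z) 0) => [/Cmod_eq_0 ->|/nz_Cmod nz].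
      exists 0; split; [exact: disk0|rewrite S0 /h; ring].
    apply: H; [exact: dilate_in_disk|exact: Cmult_neq_0].
  have wv z : in_disk z -> in_disk (w z) /\ h z = sigmoid (w z).
    move=> Hz; have [v [Dv E]] := hv z Hz.
    suff -> : w z = v by [].
    rewrite /w E; have [_ [_ ->]] := sigmoid_inverse v Dv.
    apply: Clog_Cexp; have := im_le_Cmod v; rewrite /in_disk in Dv; lra.
  exists h; split.
    split; first exact/holo_analytic.
    by move=> z Hz nz; have [nd E] := quot z Hz nz; rewrite E.
  split; first exact/holo_analytic.
  split; first by apply/holo_analytic; exact: sigmoid_holo.
  exists w; split; last split; last split.
  + apply/holo_analytic => z Hz; have [v [Dv E]] := hv z Hz.
    have [_ [n2 E2]] := sigmoid_inverse v Dv.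
    eexists; apply: (cderiv_comp Clog (fun z => h z * / (2 - h z))).
      apply: cderiv_Clog; rewrite E E2; exact: Cexp_Re_pos.
    apply: (cderiv_mult h (fun z => / (2 - h z))); first exact: holo_cderiv hh Hz.
    apply: (cderiv_comp Cinv (fun z => 2 - h z)); first by apply: cderiv_inv; rewrite E.
    apply: (cderiv_minus (fun _ => 2) h); [exact: cderiv_const|exact: holo_cderiv hh Hz].
  + by move=> z Hz; exact: (proj1 (wv z Hz)).
  + rewrite /w /h; replace (1 + r * 0 * L (r * 0)) with (RtoC 1) by ring.
    replace (1 * / (2 - 1)) with (Cexp 0); last by rewrite Cexp_0 C2_eq; field; replace (1 + 1 - 1) with (RtoC 1) by ring; move=> /RtoC_inj; lra.
    apply: Clog_Cexp; rewrite /= Rabs_R0; lra.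
  + by move=> z Hz; exact: (proj2 (wv z Hz)).
Qed.

(** The radius is the supremum m of the admissible ones. It is admissible itself: a point with |z| <
    r <= m already lies in the open disk of some admissible radius, where [S_SG_dilate] supplies its
    preimage. *)
Lemma rho_exists R0 : (0 < R0 <= 1)%R ->
  (forall z, (Cmod z < R0)%R -> exists v, in_disk v /\ 1 + z * L z = sigmoid v) ->
  exists rho, is_rho S_SG f rho /\ (R0 <= rho)%R.
Proof.
move=> HR H.
have P0 : has_property_upto S_SG f R0.
  split=> // r Hr; apply/S_SG_dilate; first lra. move=> z Hz _; apply: H; lra.
have [m [Hu Hl]] : {m | is_lub (has_property_upto S_SG f) m}.
  apply: completeness; last by exists R0.
  exists 1%R => x [[_ x1] _]; exact: x1.
have m1 : (m <= 1)%R by apply: Hl => x [[_ x1] _].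
have Rm : (R0 <= m)%R by exact: Hu.
exists m; split=> //; split; last by move=> x; exact: Hu.
split; first lra.
move=> r Hr; apply/S_SG_dilate; first lra.
move=> z Hz nz.
have [rho [[Hrho1 Hrho] zr]] : exists rho, has_property_upto S_SG f rho /\ (Cmod z < rho)%R.
  apply: Classical_Prop.NNPP => N.
  have : (m <= Cmod z)%R.
    apply: Hl => x Hx; apply: Rnot_lt_le => Hlt; apply: N; exists x; split=> //.
  lra.
have /S_SG_dilate S := Hrho rho (ltac:(lra)).
exact: (S Hrho1 z zr nz).
Qed.
End Dilation.

(** 1 - delta = 2 / (1 + e) is the sigmoid at -1; any preimage v has Cexp (- v) = e, hence Re v =
    -1, which excludes the open disk. *)
Lemma sigmoid_boundary v : in_disk v -> sigmoid v <> 1 - delta.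
Proof.
move=> Hv E.
have n1 := one_plus_Cexp_nz v Hv.
have e0 := exp_pos 1.
have E1 : RtoC 1 - RtoC delta = 2 / (1 + exp 1).
  rewrite -RtoC_minus -RtoC_plus -RtoC_div; last lra. f_equal; rewrite /delta; field; lra.
have n2 : RtoC 1 + exp 1 <> 0 by rewrite -RtoC_plus; apply: RtoC_nz; lra.
have E2 : Cexp (- v) = exp 1.
  have : (1 + exp 1) * (sigmoid v * (1 + Cexp (- v))) = (1 + exp 1) * 2.
    rewrite /sigmoid; field; exact: n1.
  rewrite E E1 => E3.
  have : 2 * (1 + Cexp (- v)) = 2 * (1 + exp 1).
    transitivity ((1 + exp 1) * (2 / (1 + exp 1) * (1 + Cexp (- v)))); first by field; exact: n2.
    rewrite E3; ring.
  move=> E4; have : / 2 * (2 * (1 + Cexp (- v))) = / 2 * (2 * (1 + exp 1)) by rewrite E4.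
  have C2 := C2_nz.
  replace (/ 2 * (2 * (1 + Cexp (- v)))) with (1 + Cexp (- v)) by (field; exact: C2).
  replace (/ 2 * (2 * (1 + exp 1))) with (1 + exp 1) by (field; exact: C2).
  move=> E5; replace (Cexp (- v)) with (1 + Cexp (- v) - 1) by ring; rewrite E5; ring.
have := f_equal Cmod E2; rewrite Cmod_Cexp Cmod_R Rabs_pos_eq; last lra.
move=> /exp_inv E3; have := re_le_Cmod v; rewrite /in_disk in Hv.
move=> /Rabs_le_between; rewrite /Re /= in E3 *; lra.
Qed.

Lemma is_filled_quotient_intro (num den h : C -> C) : holo h ->
  (forall z, in_disk z -> z <> 0 -> den z <> 0) ->
  (forall z, in_disk z -> num z = den z * h z) -> is_filled_quotient num den h.
Proof.
move=> Hh Hd E; split; first exact/holo_analytic.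
move=> z Hz nz; have d0 := Hd z Hz nz; split=> //; rewrite E //; field; exact: d0.
Qed.

Lemma subordinate_refl phi : holo phi -> subordinate phi phi.
Proof.
move=> H; split; first exact/holo_analytic. split; first exact/holo_analytic.
exists (fun z => z); split; last by [].
apply/holo_analytic => z _; eexists; exact: cderiv_id.
Qed.

(** * The extremal function and a criterion for the radius *)

Section Extremal.
Variables (phi psi L M : C -> C).
Hypothesis phiL : has_log_derivative phi L.
Hypothesis psiM : has_log_derivative psi M.
Hypothesis phi0 : phi 0 = 1.
Hypothesis psi0 : psi 0 = 1.

Lemma class_A_intro k : holo k -> k 0 = 1 -> class_A (fun z => z * k z).
Proof.
move=> Hk k0.
have Hz : holo (fun z => z) by move=> z _; eexists; exact: cderiv_id.
split; first by apply/holo_analytic; exact: holo_mult.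
split; first by ring.
have [l Hl] := Hk 0 disk0.
apply/cderiv_is_derive; apply: cderiv_eq; first exact: (cderiv_mult (fun z => z) k _ _ _ (cderiv_id _) Hl).
cbv beta; rewrite k0; ring.
Qed.

(** All three Schwarz functions are the identity, with g = z phi psi and p = psi. *)
Lemma extremal_ratio_class : ratio_class phi psi (fun z => z * (phi z * phi z * psi z)).
Proof.
have Hphi := log_derivative_holo _ _ phiL. have Hpsi := log_derivative_holo _ _ psiM.
split.
  apply: (class_A_intro (fun z => phi z * phi z * psi z)).
    by apply: (holo_mult (fun z => phi z * phi z)) => //; exact: holo_mult.
  by rewrite phi0 psi0; ring.
exists (fun z => z * (phi z * psi z)), psi; split; last split; last split.
- apply: (class_A_intro (fun z => phi z * psi z)); first exact: holo_mult.
  by rewrite phi0 psi0; ring.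
- exact: subordinate_refl.
- exists phi; split; last exact: subordinate_refl.
  apply: is_filled_quotient_intro => // z Hz; last ring.
  move=> nz; apply: Cmult_neq_0 => //; apply: Cmult_neq_0; [exact: (proj1 (phiL z Hz))|exact: (proj1 (psiM z Hz))].
- exists phi; split; last exact: subordinate_refl.
  apply: is_filled_quotient_intro => // z Hz; last ring.
  move=> nz; apply: Cmult_neq_0 => //; exact: (proj1 (psiM z Hz)).
Qed.

(** The estimate gives rho_f >= R0 throughout the class. The last equation gives z f' / f of the
    extremal function the value 1 - delta at -R0, so its rho_f is exactly R0 and the infimum is
    attained. *)
Theorem radius_ratio_class R0 : (0 < R0 < 1)%R ->
  (forall w1 w2 w3 z, schwarz_function w1 -> schwarz_function w2 -> schwarz_function w3 -> (Cmod z < R0)%R ->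
   (ellipse_form (z * (C_derive w1 z * L (w1 z) + C_derive w2 z * L (w2 z) + C_derive w3 z * M (w3 z))) < delta * delta)%R) ->
  R0 * (L (- R0) + L (- R0) + M (- R0)) = delta ->
  is_radius S_SG (ratio_class phi psi) R0.
Proof.
move=> HR H Hext.
have ex f : ratio_class phi psi f -> exists rho, is_rho S_SG f rho /\ (R0 <= rho)%R.
  move=> Hf; have [w1 [w2 [w3 [K [W1 [W2 [W3 [fK KL]]]]]]]] := ratio_class_factor _ _ _ _ _ phiL psiM Hf.
  apply: (rho_exists f K _ (proj1 Hf) fK KL); first lra.
  move=> z Hz; apply: ellipse_sigmoid; exact: H.
have uniq f a b : is_rho S_SG f a -> is_rho S_SG f b -> a = b.
  move=> [Pa Ma] [Pb Mb]; apply: Rle_antisym; [exact: Mb|exact: Ma].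
split; first by move=> f /ex [rho [Hr _]]; exists rho.
split.
  move=> x [f [Mf Hx]]; have [rho [Hr Hle]] := ex f Mf.
  by rewrite (uniq f x rho Hx Hr).
move=> b Hb.
have [rho [Hr Hle]] := ex _ extremal_ratio_class.
suff E : rho = R0 by apply: Hb; eexists; split; [exact: extremal_ratio_class|rewrite -E; exact: Hr].
apply: Rle_antisym => //; apply: Rnot_lt_le => Hlt.
have [[r1 P] _] := Hr.
have D := log_derivative_mult _ _ _ _ (log_derivative_mult _ _ _ _ phiL phiL) psiM.
have /(S_SG_dilate _ _ _ (proj1 extremal_ratio_class) (fun z _ => eq_refl _) D rho r1) S := P rho (ltac:(lra)).
(* As rho is assumed larger than R0, this point lies in the disk |z| < rho. *)
have [||v [Hv E]] := S (- R0).
- rewrite Cmod_opp Cmod_R Rabs_pos_eq; lra.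
- move=> E; have := f_equal Cmod E; rewrite Cmod_opp Cmod_R Cmod_0 Rabs_pos_eq; lra.
apply: (sigmoid_boundary v Hv); rewrite -E -Hext; cbv beta; ring.
Qed.
End Extremal.

(** * The three classes *)

Lemma log_derivative_Cexp : has_log_derivative Cexp (fun _ => 1).
Proof.
move=> w _; split; first exact: Cexp_nz.
apply: cderiv_eq; [exact: cderiv_Cexp|ring].
Qed.

Lemma Re_1_plus_pos (w : C) : (Cmod w < 1)%R -> (0 < Re (1 + w))%R.
Proof. move=> H; have := re_le_Cmod w; move=> /Rabs_le_between [h1 h2]; rewrite /Re /= in h1 h2 *; lra. Qed.

Lemma log_derivative_sqrt_1_plus : has_log_derivative sqrt_1_plus (fun w => / (2 * (1 + w))).
Proof.
move=> w Hw; have P := Re_1_plus_pos w Hw; rewrite /sqrt_1_plus.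
have n1 := Re_pos_nz _ (Csqrt_Re_pos _ P).
split=> //.
apply: cderiv_eq.
  apply: (cderiv_comp Csqrt (fun w => 1 + w)); first exact: cderiv_Csqrt.
  exact: (cderiv_plus (fun _ => 1) (fun w => w) _ _ _ (cderiv_const _ _) (cderiv_id _)).
cbv beta; move: (Csqrt_sqr (1 + w)) n1; move: (Csqrt (1 + w)) => s <- n1; field; repeat split; first [exact: C2_nz | done].
Qed.

Lemma Re_1_plus_sqr_pos (w : C) : (Cmod w < 1)%R -> (0 < Re (1 + w * w))%R.
Proof. move=> H; apply: Re_1_plus_pos; rewrite Cmod_mult; have := Cmod_ge_0 w; nra. Qed.

Lemma log_derivative_crescent : has_log_derivative crescent (fun w => / Csqrt (1 + w * w)).
Proof.
move=> w Hw; have P := Re_1_plus_sqr_pos w Hw; rewrite /crescent.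
have n1 := Re_pos_nz _ (Csqrt_Re_pos _ P).
split.
  (* The conjugate factor shows that the crescent function has no zero. *)
  move=> E; have : (w + Csqrt (1 + w * w)) * (Csqrt (1 + w * w) - w) = 1.
    transitivity (Csqrt (1 + w * w) * Csqrt (1 + w * w) - w * w); first ring.
    rewrite Csqrt_sqr; ring.
  rewrite E; replace (0 * (Csqrt (1 + w * w) - w)) with (RtoC 0) by ring; move=> /RtoC_inj; lra.
apply: cderiv_eq.
  apply: (cderiv_plus (fun w => w) (fun w => Csqrt (1 + w * w))); first exact: cderiv_id.
  apply: (cderiv_comp Csqrt (fun w => 1 + w * w)); first exact: cderiv_Csqrt.
  apply: (cderiv_plus (fun _ => 1) (fun w => w * w)); first exact: cderiv_const.
  exact: (cderiv_mult (fun w => w) (fun w => w) _ _ _ (cderiv_id _) (cderiv_id _)).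
cbv beta; have C2 := C1_plus_C1_nz; move: (Csqrt _) n1 => s n1; rewrite C2_eq; field; repeat split; assumption.
Qed.

(** * Bounds for one summand of the logarithmic derivative *)

Lemma ellipse_le_Cmod u : (ellipse_form u <= Cmod u * Cmod u)%R.
Proof. rewrite /ellipse_form Cmod_sqr; nra. Qed.

(** As the [Cmod] of a rescaled number, the square root of [ellipse_form] inherits the triangle
    inequality. *)
Definition ellipse_norm (u : C) : R := Cmod (Re u, sqrt (9 / 10) * Im u)%R.

Lemma ellipse_norm_sqr u : (ellipse_norm u * ellipse_norm u = ellipse_form u)%R.
Proof.
rewrite /ellipse_norm Cmod_sqr /ellipse_form /=.
have := sqrt_sqrt (9 / 10) (ltac:(lra)); set s := sqrt _; nra.
Qed.

Lemma ellipse_norm_ge_0 u : (0 <= ellipse_norm u)%R.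
Proof. exact: Cmod_ge_0. Qed.

Lemma ellipse_norm_triangle u v : (ellipse_norm (u + v)%C <= ellipse_norm u + ellipse_norm v)%R.
Proof.
apply: Rle_trans (Cmod_triangle _ _); right; rewrite /ellipse_norm.
case: u v => [a b] [c d]; rewrite /Cplus /= Rmult_plus_distr_l //.
Qed.

Lemma ellipse_norm_le u : (ellipse_norm u <= Cmod u)%R.
Proof.
have := ellipse_le_Cmod u; rewrite -ellipse_norm_sqr; have := ellipse_norm_ge_0 u; have := Cmod_ge_0 u; nra.
Qed.

(** With x = |w z| <= r = |z|, Dieudonné's lemma gives x + (r^2 - x^2) / (1 - r^2), which is at most
    r once r + x <= 1 - r^2; the hypothesis covers the worst case x = r. *)
Lemma schwarz_bound_exp w z : schwarz_function w -> in_disk z -> (2 * Cmod z <= 1 - Cmod z * Cmod z)%R ->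
  (cmod (z * C_derive w z) <= Cmod z)%R.
Proof.
move=> [Hw [wD w0]] Hz Hr; have [h1 h2] := schwarz_dieudonne w z Hw wD w0 Hz.
rewrite /in_disk in Hz.
have := Cmod_triangle (z * C_derive w z - w z) (w z).
replace (z * C_derive w z - w z + w z) with (z * C_derive w z) by ring.
have := Cmod_ge_0 (w z); have := Cmod_ge_0 z.
move: (Cmod z) (Cmod (w z)) (cmod (z * C_derive w z - w z)) Hz Hr h1 h2 => r x t Hz Hr h1 h2 r0 x0 T.
have : (t <= r - x)%R.
  apply: (Rmult_le_reg_r (1 - r * r)); first nra.
  apply: Rle_trans h2 _; nra.
lra.
Qed.

(** With x = |w z|, (r^2 - x^2) / (1 - r^2) <= (r - x) / (1 - r), so |z w'| <= r (1 - x) / (1 - r);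
    the factor 1 - x cancels against |1 + w z| >= 1 - x. *)
Lemma schwarz_bound_sqrt w z : schwarz_function w -> in_disk z ->
  (cmod (z * (C_derive w z * / (2 * (1 + w z)))) <= Cmod z / (2 * (1 - Cmod z)))%R.
Proof.
move=> [Hw [wD w0]] Hz; have [h1 h2] := schwarz_dieudonne w z Hw wD w0 Hz.
have n1 := disk_one_plus _ (wD z Hz).
rewrite /in_disk in Hz.
replace (z * (C_derive w z * / (2 * (1 + w z)))) with ((z * C_derive w z) / (2 * (1 + w z))); last first.
  by field; repeat split; first [exact: C2_nz | assumption].
have n2 : 2 * (1 + w z) <> 0 by apply: Cmult_neq_0 => //; exact: C2_nz.
rewrite Cmod_div // (Cmod_mult 2) Cmod_R (Rabs_pos_eq 2); last lra.
have L : (1 - Cmod (w z) <= cmod (1 + w z))%R.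
  have := Cmod_triangle (1 + w z) (- w z); replace (1 + w z + - w z) with (RtoC 1) by ring.
  rewrite Cmod_opp Cmod_1; lra.
have := Cmod_triangle (z * C_derive w z - w z) (w z).
replace (z * C_derive w z - w z + w z) with (z * C_derive w z) by ring.
have := Cmod_ge_0 (w z); have := Cmod_ge_0 z.
move: (Cmod z) (Cmod (w z)) (cmod (z * C_derive w z - w z)) (cmod (z * C_derive w z)) (cmod (1 + w z)) Hz h1 h2 L => r x t c a Hz h1 h2 L r0 x0 T.
have t1 : (t * (1 - r) <= r - x)%R.
  apply: (Rmult_le_reg_r (1 + r)); first lra.
  apply: (Rle_trans _ (r * r - x * x)); first lra. nra.
have a0 : (0 < a)%R by lra.
apply: (Rmult_le_reg_r (2 * a * (1 - r))); first by apply: Rmult_lt_0_compat; lra.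
replace (c / (2 * a) * (2 * a * (1 - r)))%R with (c * (1 - r))%R by (field; lra).
replace (r / (2 * (1 - r)) * (2 * a * (1 - r)))%R with (r * a)%R by (field; lra).
nra.
Qed.

(* Equality holds for real [w]; with [A = |1 + w^2|] the difference of the two sides factors through [1 + |w|^2 - A]. *)
Lemma crescent_center w : (Cmod w * Cmod w <= 3 / 100)%R ->
  (ellipse_form (w / Csqrt (1 + w * w)) <= Cmod w * Cmod w / (1 + Cmod w * Cmod w))%R.
Proof.
move=> Hw; have w0 := Cmod_ge_0 w.
have P := Re_1_plus_sqr_pos w (ltac:(nra)).
set S := Csqrt _; have S2 : S * S = 1 + w * w by exact: Csqrt_sqr.
have Sn : S <> 0 := Re_pos_nz _ (Csqrt_Re_pos _ P).
set u := w / S.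
have U2 : u * u * (S * S) = w * w by rewrite /u; field.
rewrite S2 in U2.
pose A := cmod (1 + w * w).
have wn : 1 + w * w <> 0 := Re_pos_nz _ P.
have A0 : (0 < A)%R := Cmod_pos _ wn.
set y := (Cmod w * Cmod w)%R in Hw *.
have y0 : (0 <= y)%R by rewrite /y; nra.
have A1 : (A <= 1 + y)%R.
  apply: Rle_trans (Cmod_triangle _ _) _; rewrite Cmod_1 Cmod_mult -/y; lra.
have A2 : (A * A = 1 + 2 * Re (w * w)%C + y * y)%R.
  rewrite /A Cmod_sqr /y Cmod_sqr; case: (w) => a b /=; ring.
have uA : (Cmod u * Cmod u * A = y)%R.
  by rewrite /A -!Cmod_mult U2 Cmod_mult.
have uR : (Re (u * u)%C * (A * A) = Re (w * w)%C + y * y)%R.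
  have -> : (A * A = Re ((1 + w * w) * Cconj (1 + w * w))%C)%R.
    rewrite /A Cmod_sqr; case: (w) => a b /=; ring.
  have E : u * u * ((1 + w * w) * Cconj (1 + w * w)) = w * w * Cconj (1 + w * w) by rewrite Cmult_assoc U2.
  have := f_equal Re E.
  have -> : Re (w * w * Cconj (1 + w * w)) = (Re (w * w)%C + y * y)%R.
    rewrite /y Cmod_sqr; case: (w) => a b /=; ring.
  move=> <-; case: (w) => a b; case: (u) => c d /=; ring.
(* 0.95 and 0.05 have sum 1 and difference 0.9, the coefficients of (Re u)^2 and (Im u)^2. *)
have ellE : (ellipse_form u = 95 / 100 * (Cmod u * Cmod u) + 5 / 100 * Re (u * u)%C)%R.
  rewrite /ellipse_form Cmod_sqr; case: (u) => c d /=; field.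
have F : (ellipse_form u * (A * A) = 95 / 100 * y * A + 25 / 1000 * (A * A - 1 + y * y))%R.
  rewrite ellE Rmult_plus_distr_r.
  replace (95 / 100 * (Cmod u * Cmod u) * (A * A))%R with (95 / 100 * (Cmod u * Cmod u * A) * A)%R by ring.
  replace (5 / 100 * Re (u * u)%C * (A * A))%R with (5 / 100 * (Re (u * u)%C * (A * A)))%R by ring.
  rewrite uA uR; lra.
apply: (Rmult_le_reg_r (A * A * (1 + y))); first by apply: Rmult_lt_0_compat; [nra|lra].
replace (y / (1 + y) * (A * A * (1 + y)))%R with (y * (A * A))%R by (field; lra).
rewrite -Rmult_assoc F.
(* The bound y <= 3/100 keeps the second factor nonnegative. *)
have : (0 <= (1 + y - A) * ((25 / 1000 * (1 + y) - y) * A + 25 / 1000 * (1 - y * y)))%R.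
  apply: Rmult_le_pos; nra.
nra.
Qed.

(** z w' / S is split into the center w / S, at most q = x / sqrt(1 + x^2) in the ellipse norm, and
    a deviation of order r^2 - x^2 in modulus. The target is p = r / sqrt(1 + r^2); for small r the
    sum p + q is small, so r^2 - x^2 is a small multiple of p - q. *)
Lemma schwarz_bound_crescent w z : schwarz_function w -> (Cmod z * Cmod z <= 3 / 100)%R ->
  (ellipse_norm (z * (C_derive w z * / Csqrt (1 + w z * w z))) <= Cmod z / sqrt (1 + Cmod z * Cmod z))%R.
Proof.
move=> [Hw [wD w0]] Hr.
have r0 := Cmod_ge_0 z.
have Hz : in_disk z by rewrite /in_disk; nra.
have [h1 h2] := schwarz_dieudonne w z Hw wD w0 Hz.
have x0 := Cmod_ge_0 (w z).
have xr : (Cmod (w z) * Cmod (w z) <= 3 / 100)%R by nra.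
have P := Re_1_plus_sqr_pos (w z) (wD z Hz).
have Cc := crescent_center (w z) xr.
set S := Csqrt _ in Cc *; have S2 : S * S = 1 + w z * w z by exact: Csqrt_sqr.
have Sn : S <> 0 := Re_pos_nz _ (Csqrt_Re_pos _ P).
have -> : z * (C_derive w z * / S) = w z / S + (z * C_derive w z - w z) / S by field.
apply: Rle_trans (ellipse_norm_triangle _ _) _.
have B2 := ellipse_norm_le ((z * C_derive w z - w z) / S); rewrite Cmod_div // in B2.
rewrite -ellipse_norm_sqr in Cc.
have N0 := ellipse_norm_ge_0 (w z / S).
have SL : (97 / 100 <= Cmod S * Cmod S)%R.
  rewrite -Cmod_mult S2; have := Cmod_triangle (1 + w z * w z) (- (w z * w z)).
  replace (1 + w z * w z + - (w z * w z)) with (RtoC 1) by ring.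
  rewrite Cmod_opp Cmod_mult Cmod_1; lra.
have S0 := Cmod_ge_0 S.
have t0 := Cmod_ge_0 (z * C_derive w z - w z).
move: (ellipse_norm ((z * C_derive w z - w z) / S)) (ellipse_norm (w z / S)) (cmod (z * C_derive w z - w z)) B2 N0 Cc h2 t0 => c n t B2 N0 Cc h2 t0.
move: (Cmod S) (Cmod (w z)) (Cmod z) r0 Hr h1 h2 x0 xr SL S0 B2 Cc => s x r r0 Hr h1 h2 x0 xr SL S0 B2 Cc.
have s9 : (9 / 10 <= s)%R by nra.
have Y0 : (1 <= sqrt (1 + r * r))%R by rewrite -{1}sqrt_1; apply: sqrt_le_1_alt; nra.
have Y2 := sqrt_sqrt (1 + r * r) (ltac:(nra)).
have X0 : (1 <= sqrt (1 + x * x))%R by rewrite -{1}sqrt_1; apply: sqrt_le_1_alt; nra.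
have X2 := sqrt_sqrt (1 + x * x) (ltac:(nra)).
set Y := sqrt (1 + r * r) in Y0 Y2 *; set X := sqrt (1 + x * x) in X0 X2.
pose p := (r / Y)%R; pose q := (x / X)%R.
have pE : (p * Y = r)%R by rewrite /p; field; lra.
have qE : (q * X = x)%R by rewrite /q; field; lra.
have p0 : (0 <= p)%R by apply: Rmult_le_pos => //; apply/Rlt_le/Rinv_0_lt_compat; lra.
have q0 : (0 <= q)%R by apply: Rmult_le_pos => //; apply/Rlt_le/Rinv_0_lt_compat; lra.
have p2 : (p * p * (1 + r * r) = r * r)%R by rewrite -Y2; transitivity ((p * Y) * (p * Y))%R; [ring|rewrite pE].
have q2 : (q * q * (1 + x * x) = x * x)%R by rewrite -X2; transitivity ((q * X) * (q * X))%R; [ring|rewrite qE].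
have nq : (n <= q)%R.
  have E : (x * x / (1 + x * x) = q * q)%R by transitivity (q * q * (1 + x * x) / (1 + x * x))%R; [rewrite q2|field; nra].
  rewrite E in Cc; exact: (Rsqr_incr_0 _ _ Cc N0 q0).
rewrite -/p.
(* p <= r and 0.18^2 > 3/100. *)
have p1 : (p <= 18 / 100)%R by nra.
have q1 : (q <= 18 / 100)%R by nra.
pose D := (r * r - x * x)%R.
have D0 : (0 <= D)%R by rewrite /D; nra.
have pq : ((p * p - q * q) * ((1 + r * r) * (1 + x * x)) = D)%R.
  have -> : ((p * p - q * q) * ((1 + r * r) * (1 + x * x)) = (p * p * (1 + r * r)) * (1 + x * x) - (q * q * (1 + x * x)) * (1 + r * r))%R by ring.
  rewrite p2 q2 /D; ring.
have pq0 : (0 <= p * p - q * q)%R.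
  have : (0 < (1 + r * r) * (1 + x * x))%R by nra. nra.
have pgq : (q <= p)%R by nra.
have DL : (D <= 11 / 10 * (p * p - q * q))%R.
  rewrite -pq Rmult_comm; apply: Rmult_le_compat_r => //; nra.
have DL2 : (D <= 4 / 10 * (p - q))%R.
  apply: Rle_trans DL _; have -> : (11 / 10 * (p * p - q * q) = 11 / 10 * (p + q) * (p - q))%R by ring.
  apply: Rmult_le_compat_r; lra.
have tD : (t <= 11 / 10 * D)%R.
  have : (t * (97 / 100) <= D)%R by apply: Rle_trans h2; apply: Rmult_le_compat_l => //; lra.
  lra.
have cs : (c * s <= t)%R.
  have := Rmult_le_compat_r s _ _ (ltac:(lra)) B2.
  by replace (t / s * s)%R with t by (field; lra).
nra.
Qed.

(** * Closed forms of the three radii *)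

Lemma delta_e : (delta * (exp 1 + 1) = exp 1 - 1)%R.
Proof. have := exp_pos 1; rewrite /delta => H; field; lra. Qed.

(** The last conclusion, that x is not to the right of the vertex, records which of the two roots is
    meant. *)
Lemma quadratic_smaller_root (a b q : R) : (0 < q)%R -> (0 < b)%R -> (0 <= a * a - b * q)%R ->
  (0 < a)%R -> let x := ((a - sqrt (a * a - b * q)) / q)%R in
  (0 < x)%R /\ (q * x * x - 2 * a * x + b = 0)%R /\ (q * x <= a)%R.
Proof.
move=> q0 b0 D0 a0 x.
have s0 := sqrt_pos (a * a - b * q); have s2 := sqrt_sqrt _ D0.
have qx : (q * x = a - sqrt (a * a - b * q))%R by rewrite /x; field; lra.
have bq : (0 < b * q)%R by exact: Rmult_lt_0_compat.
have sa : (sqrt (a * a - b * q) < a)%R by nra.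
split; first by apply: Rdiv_lt_0_compat; lra.
split; last lra.
apply: (Rmult_eq_reg_l q); last lra.
replace (q * (q * x * x - 2 * a * x + b))%R with ((q * x) * (q * x) - 2 * a * (q * x) + b * q)%R by ring.
rewrite qx; nra.
Qed.

(** The value at r factors as (x - r) (2 a - q x - q r), both factors being positive for r < x. *)
Lemma quadratic_pos_below_root (a b q x r : R) : (0 < q)%R -> (q * x * x - 2 * a * x + b = 0)%R -> (q * x <= a)%R ->
  (r < x)%R -> (0 < q * r * r - 2 * a * r + b)%R.
Proof.
move=> q0 E H Hr.
have : (q * r * r - 2 * a * r + b = (x - r) * (2 * a - q * x - q * r))%R by nra.
move=> ->; apply: Rmult_lt_0_compat; nra.
Qed.

Lemma Cmod_sum3 (a b c : C) : (cmod (a + b + c) <= Cmod a + Cmod b + Cmod c)%R.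
Proof. have := Cmod_triangle (a + b) c; have := Cmod_triangle a b; lra. Qed.

Lemma ellipse_lt_of_Cmod u : (Cmod u < delta)%R -> (ellipse_form u < delta * delta)%R.
Proof. move=> H; have := ellipse_le_Cmod u; have := Cmod_ge_0 u; nra. Qed.

Lemma Csqrt_1 : Csqrt 1 = 1.
Proof.
rewrite /Csqrt Cmod_1 /RtoC /=; case: Rle_dec => [_|]; last by move=> /(_ (Rle_refl 0)).
replace ((1 + 1) / 2)%R with 1%R by field; replace ((1 - 1) / 2)%R with 0%R by field.
by rewrite sqrt_1 sqrt_0.
Qed.

Lemma sqrt_1_plus_0 : sqrt_1_plus 0 = 1.
Proof. by rewrite /sqrt_1_plus; replace (RtoC 1 + RtoC 0) with (RtoC 1) by ring; exact: Csqrt_1. Qed.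

Lemma crescent_0 : crescent 0 = 1.
Proof. rewrite /crescent; replace (RtoC 1 + 0 * 0) with (RtoC 1) by ring; rewrite Csqrt_1; ring. Qed.

(** The quadratic is 2 x + x / (2 (1 - x)) = delta with denominators cleared, and the last
    hypothesis selects its smaller root. The bound x < 3/10 below yields 2 r <= 1 - r^2 for the
    exponential summands. *)
Lemma radius_T1 x : (0 < x)%R -> (4 * x * x - (5 + 2 * delta) * x + 2 * delta = 0)%R -> (8 * x <= 5 + 2 * delta)%R ->
  is_radius S_SG T1 x.
Proof.
move=> x0 E H; have [d1 d2] := delta_bounds.
have x1 : (x < 3 / 10)%R by nra.
apply: (radius_ratio_class _ _ _ _ log_derivative_Cexp log_derivative_sqrt_1_plus Cexp_0 sqrt_1_plus_0); first lra.
- move=> w1 w2 w3 z W1 W2 W3 Hz; apply: ellipse_lt_of_Cmod.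
  have Dz : in_disk z by rewrite /in_disk; lra.
  have z0 := Cmod_ge_0 z.
  have B1 := schwarz_bound_exp w1 z W1 Dz (ltac:(nra)).
  have B2 := schwarz_bound_exp w2 z W2 Dz (ltac:(nra)).
  have B3 := schwarz_bound_sqrt w3 z W3 Dz.
  replace (z * (C_derive w1 z * 1 + C_derive w2 z * 1 + C_derive w3 z * / (2 * (1 + w3 z)))) with
    (z * C_derive w1 z + z * C_derive w2 z + z * (C_derive w3 z * / (2 * (1 + w3 z)))) by ring.
  apply: Rle_lt_trans (Cmod_sum3 _ _ _) _.
  set r := Cmod z in Hz z0 B1 B2 B3 *.
  have Q := quadratic_pos_below_root ((5 + 2 * delta) / 2) (2 * delta) 4 x r (ltac:(lra)) (ltac:(lra)) (ltac:(lra)) Hz.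
  suff : (2 * r + r / (2 * (1 - r)) < delta)%R by lra.
  apply: (Rmult_lt_reg_r (2 * (1 - r))); first lra.
  replace ((2 * r + r / (2 * (1 - r))) * (2 * (1 - r)))%R with (4 * r * (1 - r) + r)%R by (field; lra).
  lra.
- have -> : RtoC x * (1 + 1 + / (2 * (1 + - x))) = RtoC (x * (1 + 1 + / (2 * (1 - x)))).
    rewrite RtoC_mult (RtoC_plus (1 + 1)) (RtoC_plus 1 1) RtoC_inv; last lra. by rewrite (RtoC_mult 2) RtoC_minus C2_eq.
  f_equal; apply: (Rmult_eq_reg_r (2 * (1 - x))); last lra.
  replace (x * (1 + 1 + / (2 * (1 - x))) * (2 * (1 - x)))%R with (4 * x * (1 - x) + x)%R by (field; lra).
  lra.
Qed.

(** Here the equation is x / (1 - x) + x = delta: two square root summands and one exponential. *)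
Lemma radius_T2 x : (0 < x)%R -> (x * x - (2 + delta) * x + delta = 0)%R -> (2 * x <= 2 + delta)%R ->
  is_radius S_SG T2 x.
Proof.
move=> x0 E H; have [d1 d2] := delta_bounds.
have x1 : (x < 3 / 10)%R by nra.
apply: (radius_ratio_class _ _ _ _ log_derivative_sqrt_1_plus log_derivative_Cexp sqrt_1_plus_0 Cexp_0); first lra.
- move=> w1 w2 w3 z W1 W2 W3 Hz; apply: ellipse_lt_of_Cmod.
  have Dz : in_disk z by rewrite /in_disk; lra.
  have z0 := Cmod_ge_0 z.
  have B1 := schwarz_bound_sqrt w1 z W1 Dz.
  have B2 := schwarz_bound_sqrt w2 z W2 Dz.
  have B3 := schwarz_bound_exp w3 z W3 Dz (ltac:(nra)).
  replace (z * (C_derive w1 z * / (2 * (1 + w1 z)) + C_derive w2 z * / (2 * (1 + w2 z)) + C_derive w3 z * 1)) with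
    (z * (C_derive w1 z * / (2 * (1 + w1 z))) + z * (C_derive w2 z * / (2 * (1 + w2 z))) + z * C_derive w3 z) by ring.
  apply: Rle_lt_trans (Cmod_sum3 _ _ _) _.
  set r := Cmod z in Hz z0 B1 B2 B3 *.
  have Q := quadratic_pos_below_root ((2 + delta) / 2) delta 1 x r (ltac:(lra)) (ltac:(lra)) (ltac:(lra)) Hz.
  suff : (2 * (r / (2 * (1 - r))) + r < delta)%R by lra.
  apply: (Rmult_lt_reg_r (1 - r)); first lra.
  replace ((2 * (r / (2 * (1 - r))) + r) * (1 - r))%R with (r + r * (1 - r))%R by (field; lra).
  lra.
- have -> : RtoC x * (/ (2 * (1 + - x)) + / (2 * (1 + - x)) + 1) = RtoC (x * (/ (2 * (1 - x)) + / (2 * (1 - x)) + 1)).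
    rewrite RtoC_mult (RtoC_plus _ 1) (RtoC_plus (/ _)) RtoC_inv; last lra. by rewrite (RtoC_mult 2) RtoC_minus ?C2_eq.
  f_equal; apply: (Rmult_eq_reg_r (1 - x)); last lra.
  replace (x * (/ (2 * (1 - x)) + / (2 * (1 - x)) + 1) * (1 - x))%R with (x + x * (1 - x))%R by (field; lra).
  lra.
Qed.

Lemma Csqrt_R (t : R) : (0 <= t)%R -> Csqrt t = sqrt t.
Proof.
move=> t0; rewrite /Csqrt Cmod_R Rabs_pos_eq // /RtoC /=; case: Rle_dec => [_|]; last by move=> /(_ (Rle_refl 0)).
replace ((t + t) / 2)%R with t by field; replace ((t - t) / 2)%R with 0%R by field.
by rewrite sqrt_0.
Qed.

(** The square of 3 x / sqrt(1 + x^2) = delta. *)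
Lemma radius_T3 x : (0 < x)%R -> (9 * (x * x) = delta * delta * (1 + x * x))%R -> is_radius S_SG T3 x.
Proof.
move=> x0 E; have [d1 d2] := delta_bounds.
have d3 : (delta * delta <= 1 / 4)%R by nra.
(* x^2 = delta^2 / (9 - delta^2) <= 1/35, within the range of [schwarz_bound_crescent]. *)
have x1 : (x * x < 3 / 100)%R.
  have : (0 <= (x * x) * (1 / 4 - delta * delta))%R by apply: Rmult_le_pos; nra.
  nra.
apply: (radius_ratio_class _ _ _ _ log_derivative_crescent log_derivative_crescent crescent_0 crescent_0); first nra.
- move=> w1 w2 w3 z W1 W2 W3 Hz.
  have z0 := Cmod_ge_0 z.
  have z2 : (Cmod z * Cmod z <= 3 / 100)%R by nra.
  have B1 := schwarz_bound_crescent w1 z W1 z2. have B2 := schwarz_bound_crescent w2 z W2 z2. have B3 := schwarz_bound_crescent w3 z W3 z2.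
  rewrite !Cmult_plus_distr_l -ellipse_norm_sqr.
  set u1 := z * _ in B1 *; set u2 := z * _ in B2 *; set u3 := z * _ in B3 *.
  have T1 := ellipse_norm_triangle (u1 + u2) u3; have T2 := ellipse_norm_triangle u1 u2.
  have N0 := ellipse_norm_ge_0 (u1 + u2 + u3).
  set r := Cmod z in Hz z0 z2 B1 B2 B3.
  have Y0 : (0 < sqrt (1 + r * r))%R by apply: sqrt_lt_R0; nra.
  have Y2 := sqrt_sqrt (1 + r * r) (ltac:(nra)).
  suff : (3 * (r / sqrt (1 + r * r)) < delta)%R by nra.
  set Y := sqrt _ in Y0 Y2 *.
  apply: (Rmult_lt_reg_r Y) => //; replace (3 * (r / Y) * Y)%R with (3 * r)%R by (field; lra).
  have : (9 * (r * r) < delta * delta * (Y * Y))%R by rewrite Y2; nra.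
  have : (0 < delta * Y)%R by apply: Rmult_lt_0_compat; lra.
  nra.
- have Y0 : (0 < sqrt (1 + x * x))%R by apply: sqrt_lt_R0; nra.
  have Y2 := sqrt_sqrt (1 + x * x) (ltac:(nra)).
  have -> : RtoC 1 + - x * - x = RtoC (1 + x * x) by rewrite RtoC_plus RtoC_mult; ring.
  rewrite Csqrt_R; last nra. rewrite -RtoC_inv; last lra. rewrite -!RtoC_plus -RtoC_mult; f_equal.
  set Y := sqrt _ in Y0 Y2 *.
  apply: (Rmult_eq_reg_r Y); last lra.
  replace (x * (/ Y + / Y + / Y) * Y)%R with (3 * x)%R by (field; lra).
  apply: Rsqr_inj; [lra|apply: Rmult_le_pos; lra|].
  rewrite /Rsqr; replace (delta * Y * (delta * Y))%R with (delta * delta * (Y * Y))%R by ring.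
  rewrite Y2; lra.
Qed.

Theorem theorem3p8 :
  let e := exp 1 in
  is_radius S_SG T1 ((3 + 7 * e - sqrt (41 + 42 * e + 17 * e ^ 2)) / (8 + 8 * e))%R /\
  is_radius S_SG T2 ((1 + 3 * e - sqrt (5 + 6 * e + 5 * e ^ 2)) / (2 + 2 * e))%R /\
  is_radius S_SG T3 (sqrt ((1 - 2 * e + e ^ 2) / (8 + 20 * e + 8 * e ^ 2)))%R.
Proof.
move=> e; have [e1 e2] := exp_1_bounds; have dE := delta_e; rewrite -/e in e1 e2 dE.
have [d1 d2] := delta_bounds.
split; last split.
(* The quadratic of [radius_T1] multiplied by 2 (e + 1), using delta (e + 1) = e - 1. *)
- have := quadratic_smaller_root (3 + 7 * e) (4 * (e - 1)) (8 + 8 * e) (ltac:(lra)) (ltac:(lra)).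
  have -> : ((3 + 7 * e) * (3 + 7 * e) - 4 * (e - 1) * (8 + 8 * e) = 41 + 42 * e + 17 * e ^ 2)%R by ring.
  move=> /(_ (ltac:(nra)) (ltac:(lra))) /=; set x := (_ / _)%R => [[x0 [Ex Hx]]].
  apply: radius_T1 => //.
  + apply: (Rmult_eq_reg_r (2 * (e + 1))); last lra. nra.
  + apply: (Rmult_le_reg_r (e + 1)); first lra. nra.
(* The same multiplication for the quadratic of [radius_T2]. *)
- have := quadratic_smaller_root (1 + 3 * e) (2 * (e - 1)) (2 + 2 * e) (ltac:(lra)) (ltac:(lra)).
  have -> : ((1 + 3 * e) * (1 + 3 * e) - 2 * (e - 1) * (2 + 2 * e) = 5 + 6 * e + 5 * e ^ 2)%R by ring.
  move=> /(_ (ltac:(nra)) (ltac:(lra))) /=; set x := (_ / _)%R => [[x0 [Ex Hx]]].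
  apply: radius_T2 => //.
  + apply: (Rmult_eq_reg_r (2 * (e + 1))); last lra. nra.
  + apply: (Rmult_le_reg_r (e + 1)); first lra. nra.
- have t0 : (0 < (1 - 2 * e + e ^ 2) / (8 + 20 * e + 8 * e ^ 2))%R by apply: Rdiv_lt_0_compat; nra.
  have s2 := sqrt_sqrt _ (Rlt_le _ _ t0).
  apply: radius_T3; first exact: sqrt_lt_R0.
  (* The denominator is 9 (e + 1)^2 - (e - 1)^2, so the fraction is delta^2 / (9 - delta^2). *)
  rewrite s2 /delta -/e; field; split; nra.
Qed.
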